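(* For each $j=1,\dots,M$, consider the eigenvalue problem: find $\phi\in V_{hD}(\omega_j^* )$ and $\lambda$ such that $$a_{\omega_j^*}(\phi,v)=\lambda\,b_{\omega_j^*}(\phi,v)\quad\forall v\in V_{hD}(\omega_j^* ),\qquad b_{\omega_j^*}(\phi,v)=\int_{\partial\omega_j^*\cap\Omega}\phi v\,ds.$$ (i) There are $N_j=\dim(W_h(\omega_j^* ))$ finite eigenvalues $0\le\lambda_1^j\le\dots\le\lambda_{N_j}^j<\infty$ (counted according to multiplicity) with corresponding eigenfunctions $\{\phi_k^j\}_{k=1}^{N_j}$, which can be normalized to form an orthonormal basis of $W_h(\omega_j^* )$ with respect to $b_{\omega_j^*}(\cdot,\cdot)$. (ii) There are $K_j=\dim(V_{h,0}(\omega_j^* ))$ infinite eigenvalues (equal to $+\infty$) with associated eigenfunctions $\{\varphi_i^j\}_{i=1}^{K_j}$ forming a basis of $V_{h,0}(\omega_j^* )$. Here (this being the meaning of an eigenfunction with infinite eigenvalue) each $\varphi_i^j$ satisfies $$b_{\omega_j^*}(\varphi_i^j,v)=0\quad\forall v\in V_{h,0}(\omega_j^* )\qquad\text{and}\qquad a_{\omega_j^*}(\varphi_i^j,\phi_k^j)=0\quad\forall k=1,\dots,N_j.$$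
   Context: $\Omega\subset\mathbb R^d$ ($d=2,3$) is a bounded Lipschitz polygonal (polyhedral) domain, $\partial\Omega_D\cap\partial\Omega_N=\emptyset$, $\overline{\partial\Omega_D}\cup\overline{\partial\Omega_N}=\partial\Omega$. $A\in(L^\infty(\Omega))^{d\times d}$ is symmetric and there are $0<\alpha<\beta<\infty$ with $\alpha|\xi|^2\le A(x)\xi\cdot\xi\le\beta|\xi|^2$ for all $\xi\in\mathbb R^d$, $x\in\Omega$. $a_\omega(u,v)=\int_\omega A\nabla u\cdot\nabla v\,dx$. $\mathcal T_h$ is a regular partition of $\Omega$ into triangles/quadrilaterals ($d=2$) or tetrahedra/hexahedra ($d=3$), and $V_h\subset H^1(\Omega)$ is the conforming finite element space with the standard basis of piecewise linear nodal functions. $\{\omega_i\}_{i=1}^M$ is an overlapping decomposition of $\Omega$ into subdomains resolved by $\mathcal T_h$, and each $\omega_i$ is extended by layers of mesh elements to an oversampling domain $\omega_i^*\supset\omega_i$, a connected union of mesh elements that is a proper subdomain of $\Omega$. For each $j$: $V_h(\omega_j^* )=\{v|_{\omega_j^*}: v\in V_h\}$; $V_{hD}(\omega_j^* )=\{v\in V_h(\omega_j^* ): v=0\text{ on }\partial\omega_j^*\cap\partial\Omega_D\}$; $V_{h,0}(\omega_j^* )=\{v\in V_{hD}(\omega_j^* ): v=w|_{\omega_j^*}\text{ for some }w\in V_h\text{ with }\mathrm{supp}(w)\subset\overline{\omega_j^*}\}$, i.e. the functions of $V_h(\omega_j^* )$ vanishing on $(\partial\omega_j^*\cap\partial\Omega_D)\cup(\partial\omega_j^*\cap\Omega)$;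 $W_h(\omega_j^* )=\{u\in V_{hD}(\omega_j^* ): a_{\omega_j^*}(u,v)=0\ \forall v\in V_{h,0}(\omega_j^* )\}$ (discrete $A$-harmonic space). *)

(* Defs.v *)
From HB Require Import structures.
From mathcomp Require Import all_boot all_order all_algebra.
From mathcomp Require Import all_classical all_reals all_analysis.
Set Implicit Arguments.
Unset Strict Implicit.
Unset Printing Implicit Defensive.
Import Order.TTheory GRing.Theory Num.Theory.
Import numFieldNormedType.Exports.
Local Open Scope classical_set_scope.
Local Open Scope ring_scope.

Definition rV_display : measure_display. Proof. exact: default_measure_display. Qed.

(* The product sigma-algebra on R^n; it coincides with the Borel one. *)
Section rV_measurable.
Variables (R : realType) (n : nat).

Definition rV_coord (i : 'I_n) (x : 'rV[R]_n) : measurableTypeR R := x ord0 i.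

Let rV_set0 : g_sigma_preimage rV_coord set0.
Proof. exact: sigma_algebra0. Qed.

Let rV_setC A : g_sigma_preimage rV_coord A -> g_sigma_preimage rV_coord (~` A).
Proof. exact: sigma_algebraC. Qed.

Let rV_bigcup (F : (set 'rV[R]_n)^nat) :
  (forall i, g_sigma_preimage rV_coord (F i)) ->
  g_sigma_preimage rV_coord (\bigcup_i F i).
Proof. exact: sigma_algebra_bigcup. Qed.

HB.instance Definition _ := @isMeasurable.Build rV_display
  'rV[R]_n (g_sigma_preimage rV_coord) rV_set0 rV_setC rV_bigcup.

End rV_measurable.

Section lebesgue_rV.
Variable R : realType.
Implicit Types n : nat.

Lemma measurable_rV_coord n (i : 'I_n) :
  measurable_fun [set: 'rV[R]_n] (@rV_coord R n i).
Proof.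
move=> _ Y mY; rewrite setTI; apply: sub_sigma_algebra => /=.
rewrite -bigcup_seq/=; exists i => /=; first by rewrite mem_index_enum.
by exists Y => //; rewrite setTI.
Qed.

Lemma measurable_rV d (T : measurableType d) n (f : T -> 'rV[R]_n) :
  (forall i, measurable_fun [set: T] (@rV_coord R n i \o f)) ->
  measurable_fun [set: T] f.
Proof.
move=> mf _ /= Y mY; rewrite setTI.
suff : @measurable _ 'rV[R]_n `<=` [set B | measurable (f @^-1` B)] by exact.
apply: smallest_sub.
  split=> /=.
  - by rewrite preimage_set0.
  - by move=> A mA; rewrite setTD preimage_setC; exact: measurableC.
  - by move=> F mF; rewrite preimage_bigcup; exact: bigcup_measurable.
rewrite -bigcup_seq; apply: bigcup_sub => /= i _ A [B mB <-]; rewrite setTI /=.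
by have := mf i measurableT B mB; rewrite setTI.
Qed.

Definition rV_cons n (p : measurableTypeR R * 'rV[R]_n) : 'rV[R]_n.+1 :=
  \row_i (if unlift ord0 i is Some j then p.2 ord0 j else p.1).

Lemma measurable_rV_cons n : measurable_fun [set: _] (@rV_cons n).
Proof.
apply: measurable_rV => i; have [j ij|i0] := unliftP ord0 i.
  rewrite (_ : _ \o _ =
      (fun p : measurableTypeR R * 'rV[R]_n => rV_coord j p.2)); last first.
    by apply/funext => p; rewrite /= /rV_coord mxE ij liftK.
  exact: (measurableT_comp (@measurable_rV_coord n j) measurable_snd).
rewrite (_ : _ \o _ = @fst (measurableTypeR R) 'rV[R]_n); last first.
  by apply/funext => p; rewrite /= /rV_coord mxE i0 unlift_none.
exact: measurable_fst.
Qed.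


Lemma rV_cons_inj n : injective (@rV_cons n).
Proof.
move=> [x y] [x' y'] /rowP xy; congr pair.
  by have := xy ord0; rewrite !mxE unlift_none.
by apply/rowP => j; have := xy (lift ord0 j); rewrite !mxE liftK.
Qed.

End lebesgue_rV.

Section measure_cons.
Variables (R : realType) (n : nat).
Variable nu : {sigma_finite_measure set (measurableTypeR R) -> \bar R}.
Variable mu : {sigma_finite_measure set 'rV[R]_n -> \bar R}.

Definition measure_cons : set 'rV[R]_n.+1 -> \bar R :=
  pushforward (nu \x mu)%E (@rV_cons R n).

Let mcons := @measurable_rV_cons R n.

Let measure_cons0 : measure_cons set0 = 0%E.
Proof. by rewrite /measure_cons measure0. Qed.

Let measure_cons_ge0 A : (0 <= measure_cons A)%E.
Proof. exact: measure_ge0. Qed.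

Let measure_cons_sigma_additive : semi_sigma_additive measure_cons.
Proof. exact: measure_semi_sigma_additive. Qed.

HB.instance Definition _ := isMeasure.Build _ _ _ measure_cons
  measure_cons0 measure_cons_ge0 measure_cons_sigma_additive.

Let measure_cons_sigma_finite : sigma_finite setT measure_cons.
Proof.
have /sigma_finiteP[F [TF ndF Foo]] := sigma_finiteT nu.
have /sigma_finiteP[G [TG ndG Goo]] := sigma_finiteT mu.
pose g (x : 'rV[R]_n.+1) : measurableTypeR R * 'rV[R]_n :=
  (rV_coord ord0 x, \row_j x ord0 (lift ord0 j)).
have mg : measurable_fun setT g.
  apply/measurable_fun_pairP; split; first exact: measurable_rV_coord.
  apply/measurable_rV => j.
  rewrite (_ : _ \o _ = rV_coord (lift ord0 j)); last first.
    by apply/funext => x /=; rewrite /rV_coord mxE.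
  exact: measurable_rV_coord.
exists (fun k => g @^-1` (F k `*` G k)).
  rewrite -preimage_bigcup -(preimage_setT g); congr (g @^-1` _).
  rewrite -setXTT TF TG predeqE => -[x y]; split.
    move=> [/= [i _ Fix] [k _ Gky]]; exists (maxn i k) => //; split.
    - by move: x Fix; exact/subsetPset/ndF/leq_maxl.
    - by move: y Gky; exact/subsetPset/ndG/leq_maxr.
  by move=> [i _ []/= ? ?]; split; exists i.
move=> k; have [? ?] := Foo k; have [? ?] := Goo k; split.
  by rewrite -[X in measurable X]setTI; apply: mg => //; exact: measurableX.
have gK : g \o @rV_cons R n = idfun.
  apply/funext => -[x y]; congr pair; rewrite /rV_coord ?mxE ?unlift_none//.
  by apply/rowP => j; rewrite !mxE liftK.
rewrite /measure_cons /pushforward -comp_preimage gK.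
by rewrite product_measure1E// lte_mul_pinfty// ge0_fin_numE.
Qed.

HB.instance Definition _ := Measure_isSigmaFinite.Build _ _ _ measure_cons
  measure_cons_sigma_finite.

End measure_cons.

(* The n-dimensional Lebesgue measure, as an iterated product. *)
Fixpoint lebesgue_rV (R : realType) (n : nat) :
    {sigma_finite_measure set 'rV[R]_n -> \bar R} :=
  if n is m.+1 then measure_cons lebesgue_measure (lebesgue_rV R m)
  else \d_(0 : 'rV[R]_0).

Lemma lebesgue_rV_box (R : realType) (n : nat) (A : 'I_n -> set (measurableTypeR R)) :
  (forall i, measurable (A i)) ->
  lebesgue_rV R n [set x | forall i, A i (x ord0 i)] =
  (\prod_(i < n) lebesgue_measure (A i))%E.
Proof.
elim: n A => [|n ih] A mA.
  by rewrite big_ord0 /= diracE mem_set// => -[].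
rewrite big_ord_recl -ih; last by [].
rewrite /= /measure_cons /pushforward -product_measure1E//; last first.
  rewrite [X in measurable X](_ : _ = \big[setI/setT]_(i < n)
      (rV_coord i @^-1` A (lift ord0 i))); last first.
    apply/seteqP; split=> x /=.
      by move=> Ax; elim/big_ind : _ => // i _; exact: Ax.
    by move=> + i; rewrite (bigD1 i)//= => -[].
  apply: bigsetI_measurable => i _; rewrite -[X in measurable X]setTI.
  exact: measurable_rV_coord.
congr (product_measure1 _ _ _); apply/seteqP; split=> -[x y] /=.
  move=> Axy; split; first by have := Axy ord0; rewrite mxE unlift_none.
  by move=> i; have := Axy (lift ord0 i); rewrite mxE liftK.
move=> [Ax Ay] i; rewrite mxE; case: unliftP => [j ->|->//]; exact: Ay.
Qed.

Section euclidean.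
Variable R : realType.

Definition dotv m (u v : 'rV[R]_m) : R := (u *m v^T) ord0 ord0.

Definition frontier m (A : set 'rV[R]_m) : set 'rV[R]_m :=
  closure A `\` interior A.

Definition domain m (A : set 'rV[R]_m) : Prop :=
  [/\ open A, connected A & A !=set0].

(* Near [p], [Omega] is the strict epigraph, in the direction [e], of a
   Lipschitz function on the hyperplane orthogonal to [e], inside the cylinder
   of radius [r] and half-height [h] centred at [p]. *)
Definition lipschitz_epigraph_at m (Omega : set 'rV[R]_m) (p : 'rV[R]_m) : Prop :=
  exists (e : 'rV[R]_m) (r h L : R) (g : 'rV[R]_m -> R),
    [/\ dotv e e = 1, 0 < r, 0 < h, L.-lipschitz g
      & (forall y, dotv y e = 0 -> `|y| < r -> `|g y| < h) /\
        forall x, let t := dotv (x - p) e in let y := x - p - t *: e in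
          `|y| < r -> `|t| < h -> (Omega x <-> g y < t)].

Definition lipschitz_polyhedral_domain m (Omega : set 'rV[R]_m) : Prop :=
  [/\ domain Omega, bounded_set Omega,
      forall p, frontier Omega p -> lipschitz_epigraph_at Omega p
    & exists (N : nat) (nu : 'I_N -> 'rV[R]_m) (c : 'I_N -> R),
        (forall i, nu i != 0) /\
        forall x, frontier Omega x -> exists i, dotv (nu i) x = c i].

Definition boundary_partition m (Omega GammaD GammaN : set 'rV[R]_m) : Prop :=
  GammaD `&` GammaN = set0 /\ closure GammaD `|` closure GammaN = frontier Omega.

Definition essentially_bounded_coefficient m (Omega : set 'rV[R]_m)
    (A : 'rV[R]_m -> 'M[R]_m) : Prop :=
  forall i j, measurable_fun Omega (fun x => A x i j : measurableTypeR R) /\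
    exists C : R, {ae lebesgue_rV R m, forall x, Omega x -> `|A x i j| <= C}.

Definition symmetric_elliptic m (Omega : set 'rV[R]_m)
    (A : 'rV[R]_m -> 'M[R]_m) (alpha beta : R) : Prop :=
  forall x, Omega x -> (A x)^T = A x /\
    forall xi : 'rV[R]_m, alpha * dotv xi xi <= dotv (xi *m (A x)^T) xi
                          <= beta * dotv xi xi.

End euclidean.

(* [is_basis V e]: the finite family [e] is a basis of the subspace [V]; the
   ambient function spaces are infinite-dimensional, so they are not
   [vectType]s. *)
Definition is_basis (R : realType) (F : lmodType R) (V : set F) (N : nat)
    (e : 'I_N -> F) : Prop :=
  (forall c : 'I_N -> R, \sum_i c i *: e i = 0 -> forall i, c i = 0) /\
  V = range (fun c : 'I_N -> R => \sum_i c i *: e i).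

Definition has_dim (R : realType) (F : lmodType R) (V : set F) (N : nat) : Prop :=
  exists e : 'I_N -> F, is_basis V e.

(* Cells are images of a reference simplex or a reference cube of dimension [m]
   under the P1, resp. Q1, interpolant of their vertices: segments, triangles,
   quadrilaterals, tetrahedra and hexahedra. *)
Variant cell_kind := Simplex | Cube.

Definition node (k : cell_kind) (m : nat) : finType :=
  match k with
  | Simplex => 'I_m.+1
  | Cube => {ffun 'I_m -> bool}
  end.

Definition facet (k : cell_kind) (m : nat) : finType :=
  match k with
  | Simplex => 'I_m.+2
  | Cube => ('I_m.+1 * bool)%type
  end.

(* A facet of a simplex is labelled by the opposite node, and a facet of the
   cube by the coordinate that is constant on it and the value of that
   coordinate. *)
Definition facet_node (k : cell_kind) (m : nat) (f : facet k m) :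
    node k m -> node k m.+1 :=
  match k return facet k m -> node k m -> node k m.+1 with
  | Simplex => fun f a => lift f a
  | Cube => fun f a =>
      [ffun i => if unlift f.1 i is Some j then (a : {ffun 'I_m -> bool}) j
                 else f.2]
  end f.

Definition on_facet (k : cell_kind) (m : nat) (f : facet k m)
  (a : node k m.+1) : bool := a \in codom (facet_node f).

(* Faces of all dimensions: the intersections of sets of facets. *)
Definition is_face (k : cell_kind) (m : nat) (S : {set node k m.+1}) : Prop :=
  exists Fs : {set facet k m},
    forall a, (a \in S) = [forall f in Fs, on_facet f a].

Definition ref_cell (R : realType) (k : cell_kind) (m : nat) : set 'rV[R]_m :=
  match k with
  | Simplex => [set x | (forall i, 0 <= x ord0 i) /\ \sum_i x ord0 i <= 1]
  | Cube => [set x | forall i, 0 <= x ord0 i <= 1]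
  end.
Arguments ref_cell {R} k m _.

Section cells.
Variable R : realType.

Definition shape_fun (k : cell_kind) (m : nat) (a : node k m) (x : 'rV[R]_m) : R :=
  match k return node k m -> R with
  | Simplex => fun a => if unlift ord0 a is Some i then x ord0 i
                        else 1 - \sum_i x ord0 i
  | Cube => fun a => \prod_i (if (a : {ffun 'I_m -> bool}) i then x ord0 i
                              else 1 - x ord0 i)
  end a.

Variable d : nat.

Definition cell_map (k : cell_kind) (m : nat) (p : node k m -> 'rV[R]_d)
  (x : 'rV[R]_m) : 'rV[R]_d := \sum_a shape_fun a x *: p a.

Definition cell (k : cell_kind) (m : nat) (p : node k m -> 'rV[R]_d) :
  set 'rV[R]_d := cell_map p @` ref_cell k m.

Definition face_points (k : cell_kind) (m : nat) (p : node k m -> 'rV[R]_d)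
    (S : {set node k m}) : set 'rV[R]_d :=
  cell_map p @` [set x | ref_cell k m x /\ forall a, a \notin S -> shape_fun a x = 0].

(* The integral of [g] over the part of an [m]-dimensional cell lying in [S],
   with respect to [m]-dimensional surface measure (area formula). *)
Definition cell_integral (k : cell_kind) (m : nat) (p : node k m -> 'rV[R]_d)
    (S : set 'rV[R]_d) (g : 'rV[R]_d -> R) : R :=
  \int[lebesgue_rV R m]_(x in ref_cell k m `&` cell_map p @^-1` S)
    (g (cell_map p x) *
     Num.sqrt (\det (jacobian (cell_map p) x *m (jacobian (cell_map p) x)^T))).

End cells.

(* An element is a convex polytope with the combinatorics of its reference cell
   (each facet is cut out by a supporting hyperplane), parametrized
   diffeomorphically by the reference cell. *)
Definition regular_element (R : realType) (k : cell_kind) (m : nat)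
    (p : node k m.+1 -> 'rV[R]_m.+1) : Prop :=
  [/\ set_inj (ref_cell k m.+1) (cell_map p),
      forall x, ref_cell k m.+1 x -> \det (jacobian (cell_map p) x) != 0
    & forall f : facet k m, exists (nu : 'rV[R]_m.+1) (c : R),
        forall a, if on_facet f a then dotv nu (p a) = c else dotv nu (p a) < c].

Record mesh (R : realType) (n : nat) := Mesh {
  elt : finType;
  kind : elt -> cell_kind;
  vertex : forall K : elt, node (kind K) n.+1 -> 'rV[R]_n.+1 }.

Section finite_elements.
Variables (R : realType) (n : nat).
Local Notation E := 'rV[R]_n.+1.
Variable T : mesh R n.

Definition element (K : elt T) : set E := cell (vertex (K := K)).

Definition regular_partition (Omega : set E) : Prop :=
  [/\ forall K, regular_element (vertex (m := T) (K := K)),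
      \bigcup_(K in [set: elt T]) element K = closure Omega,
      forall K K', K != K' ->
        interior (element K) `&` interior (element K') = set0
    & forall K K', K != K' ->
        exists (S : {set node (kind K) n.+1}) (S' : {set node (kind K') n.+1}),
        [/\ is_face S, is_face S',
            @vertex _ _ _ K @` [set` S] = @vertex _ _ _ K' @` [set` S'],
            element K `&` element K' = face_points (vertex (K := K)) S
          & element K `&` element K' = face_points (vertex (K := K')) S']].

(* Functions on a set are encoded as total functions vanishing off that set. *)
Definition Vh (Omega : set E) : set (E -> R) :=
  [set v | [/\ forall x, ~ closure Omega x -> v x = 0,
               {within closure Omega, continuous v}
             & forall K : elt T, exists c : node (kind K) n.+1 -> R,
                 forall x, ref_cell (kind K) n.+1 x ->
                   v (cell_map (vertex (K := K)) x) = \sum_a c a * shape_fun a x]].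

(* The open subdomain resolved by the mesh whose elements are those in [J]. *)
Definition subdomain (J : {set elt T}) : set E :=
  interior (\bigcup_(K in [set` J]) element K).

Definition overlapping_decomposition (Omega : set E) (M : nat)
    (J : 'I_M -> {set elt T}) : Prop :=
  \bigcup_(i in [set: 'I_M]) subdomain (J i) = Omega.

Definition touches (K K' : elt T) : bool :=
  [exists a, exists b, vertex (K := K) a == vertex (K := K') b].

(* [J'] is obtained from [J] by adding one layer: some elements that share a
   vertex with an element of [J]. *)
Definition layer : rel {set elt T} := fun J J' =>
  (J \subset J') && [forall K in J', exists K' in J, touches K K'].

(* [connect layer J Js]: [Js] is reached from [J] by finitely many layers. *)
Definition oversampling (Omega : set E) (J Js : {set elt T}) : Prop :=
  [/\ connect layer J Js, domain (subdomain Js) & subdomain Js `<` Omega].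

(* The classical gradient inside the elements; the skeleton of the mesh, where
   it need not exist, is a null set. *)
Definition grad (u : E -> R) : E -> E :=
  patch (fun=> 0) (\bigcup_(K in [set: elt T]) interior (element K))
    (fun x => \row_i 'D_(delta_mx ord0 i) u x).

Definition a_form (A : E -> 'M[R]_n.+1) (omega : set E) (u v : E -> R) : R :=
  \int[lebesgue_rV R n.+1]_(x in omega)
    dotv (grad u x *m (A x)^T) (grad v x).

(* The frontier of the subdomain is made of facets of its elements; a facet
   common to two elements of [J] meets it in a null set. *)
Definition b_form (Omega : set E) (J : {set elt T}) (u v : E -> R) : R :=
  \sum_(K in J) \sum_(f : facet (kind K) n)
    cell_integral (fun a => vertex (facet_node f a))
      (frontier (subdomain J) `&` Omega) (fun x => u x * v x).

Section local_spaces.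
Variables (Omega GammaD : set E) (A : E -> 'M[R]_n.+1) (J : {set elt T}).

Local Notation omega := (subdomain J).

Definition Vh_loc : set (E -> R) :=
  [set patch (fun=> 0) (closure omega) w | w in Vh Omega].

Definition VhD : set (E -> R) :=
  [set v | Vh_loc v /\ forall x, (frontier omega `&` GammaD) x -> v x = 0].

Definition Vh0 : set (E -> R) :=
  [set v | VhD v /\ exists w, [/\ Vh Omega w,
     v = patch (fun=> 0) (closure omega) w
   & closure [set x | w x != 0] `<=` closure omega]].

Definition Wh : set (E -> R) :=
  [set u | VhD u /\ forall v, Vh0 v -> a_form A omega u v = 0].

(* Spanned by the eigenfunctions of the pencil with finite eigenvalue [lambda]. *)
Definition pencil_eigenspace (lambda : R) : set (E -> R) :=
  [set phi | VhD phi /\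
     forall v, VhD v -> a_form A omega phi v = lambda * b_form Omega J phi v].

(* Eigenfunctions with eigenvalue [+oo], relative to the family [phi] of finite
   eigenfunctions: this is their definition, not a consequence of another one. *)
Definition infinite_eigenfunction (N : nat) (phi : 'I_N -> E -> R)
    (psi : E -> R) : Prop :=
  [/\ VhD psi, psi <> 0, forall v, Vh0 v -> b_form Omega J psi v = 0
    & forall k, a_form A omega psi (phi k) = 0].

End local_spaces.
End finite_elements.

(* Main.v *)
Require Import Defs.
From mathcomp Require Import all_boot all_order all_algebra.
From mathcomp Require Import all_classical all_reals all_analysis.
From mathcomp Require Import measurable_realfun.
From mathcomp Require Import ring lra.
Set Implicit Arguments.
Unset Strict Implicit.
Unset Printing Implicit Defensive.
Import Order.TTheory GRing.Theory Num.Theory.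
Import numFieldNormedType.Exports.
Local Open Scope classical_set_scope.
Local Open Scope ring_scope.

(** The spaces are finite dimensional, and the statement is linear algebra once
    four facts about the forms are known on [VD]: [a] and [b] are symmetric
    positive semidefinite bilinear forms, the kernel of [b] is exactly [V0], and
    [a] is definite on [V0]. Then [a + b] is a scalar product, for which [b] has an
    orthonormal eigenbasis with eigenvalues [mu i] in [[0, 1]]. On such a vector
    [a] is [1 - mu i] times, and [b] is [mu i] times, the scalar product. The
    vectors with [mu i = 0] are a basis of [V0], the eigenfunctions with infinite
    eigenvalue; those with [mu i > 0] are a basis of the [a]-orthogonal [W] of
    [V0], with finite eigenvalues [(1 - mu i) / mu i] ([pencil_eigenbasis]).

    The kernel of [b]. Functions of [V0] vanish on the interface
    [frontier omega `&` Omega], because [omega] is the interior of a closed union of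
    elements, so that every point of the interface is a limit of points of [Omega]
    outside [closure omega] ([Vh0_interface]). Conversely, a function of [VD] that
    vanishes on the interface extends continuously by zero; at the boundary of
    [Omega] this uses that a Lipschitz domain has a single local component at each
    of its boundary points, so that points where [omega] and the rest of [Omega]
    meet are adherent to the interface ([interface_Vh0]). It remains to see that
    [b v v = 0] implies that [v] vanishes on the interface
    ([interface_form_definite]). If [v] is nonzero on a small ball [U] around a
    point of the interface, then inside [U] the frontier of [omega] contains no
    relatively open piece of a facet, as the surface jacobian is positive. But the
    frontier is covered by finitely many facets, each in a hyperplane, and closed
    subsets with empty relative interior of finitely many hyperplanes cannot
    separate the points of [U] in [omega] from those outside: a generic segment
    avoids them all ([generic_segment]).

    Definiteness of [a] on [V0]. If [a v v = 0], ellipticity makes the gradient of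
    [v] vanish inside the elements, so [v] is constant on each element of [omega],
    hence on the connected set [omega], and the constant is zero because the
    interface is not empty, [Omega] being connected ([energy_definite]).

    The analysis of the elements rests on polynomial functions. The element map [F]
    is polynomial with invertible jacobian on the compact reference cell. It is
    open there, by minimizing the distance from [F x] to a nearby point
    ([cell_map_open]), and its boundary goes to supporting hyperplanes, so the
    interior of the element is exactly the image of the interior of the reference
    cell ([interior_cell]). Hadamard's factorization [f y - f x = (y - x) D y] of
    polynomial functions then gives the gradient of a finite element function on an
    element as a bounded continuous function ([derive_element]), which makes all
    the integrals of the statement integrals of bounded measurable functions. *)

(** * Polynomial functions of several variables *)

Section polynomial_functions.
Variables (R : realType) (m : nat).
Local Notation E := 'rV[R]_m.

(** A predicate on plain functions: shape functions, jacobian entries and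
    determinants come as such, and only closure properties are needed. *)
Inductive polyfun : (E -> R) -> Prop :=
| polyfun_cst c : polyfun (fun=> c)
| polyfun_coord i : polyfun (fun x => x ord0 i)
| polyfunD f g : polyfun f -> polyfun g -> polyfun (fun x => f x + g x)
| polyfunM f g : polyfun f -> polyfun g -> polyfun (fun x => f x * g x).

Lemma polyfunN f : polyfun f -> polyfun (fun x => - f x).
Proof.
move=> pf; rewrite (_ : (fun x => _) = (fun x => -1 * f x)); last first.
  by apply/funext => x; rewrite mulN1r.
by apply: polyfunM => //; exact: polyfun_cst.
Qed.

Lemma polyfunB f g : polyfun f -> polyfun g -> polyfun (fun x => f x - g x).
Proof. by move=> pf pg; apply: polyfunD => //; exact: polyfunN. Qed.

Lemma polyfun_sum I (r : seq I) (P : pred I) (F : I -> E -> R) :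
  (forall i, polyfun (F i)) -> polyfun (fun x => \sum_(i <- r | P i) F i x).
Proof.
move=> pF; elim: r => [|i r ih].
  rewrite (_ : (fun x => _) = fun=> 0); first exact: polyfun_cst.
  by apply/funext => x; rewrite big_nil.
rewrite (_ : (fun x => _) = (fun x => (if P i then F i x else 0) +
    \sum_(i <- r | P i) F i x)); last first.
  by apply/funext => x; rewrite big_cons; case: ifP => //; rewrite add0r.
by apply: polyfunD => //; case: (P i) => //; exact: polyfun_cst.
Qed.

Lemma polyfun_prod I (r : seq I) (P : pred I) (F : I -> E -> R) :
  (forall i, polyfun (F i)) -> polyfun (fun x => \prod_(i <- r | P i) F i x).
Proof.
move=> pF; elim: r => [|i r ih].
  rewrite (_ : (fun x => _) = fun=> 1); first exact: polyfun_cst.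
  by apply/funext => x; rewrite big_nil.
rewrite (_ : (fun x => _) = (fun x => (if P i then F i x else 1) *
    \prod_(i <- r | P i) F i x)); last first.
  by apply/funext => x; rewrite big_cons; case: ifP => //; rewrite mul1r.
by apply: polyfunM => //; case: (P i) => //; exact: polyfun_cst.
Qed.

Lemma polyfun_differentiable f x : polyfun f -> differentiable f x.
Proof.
elim=> [c|i|{}f g _ df _ dg|{}f g _ df _ dg].
- exact: differentiable_cst.
- exact: differentiable_coord.
- exact: differentiableD.
- exact: differentiableM.
Qed.

Lemma polyfun_derivable f x v : polyfun f -> derivable f x v.
Proof. by move=> pf; exact/diff_derivable/polyfun_differentiable. Qed.

Lemma polyfun_continuous f : polyfun f -> continuous f.
Proof. by move=> pf x; exact/differentiable_continuous/polyfun_differentiable. Qed.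

Lemma derive_coord (i : 'I_m) (x v : E) :
  'D_v (fun x : E => x ord0 i) x = v ord0 i.
Proof.
apply/cvg_lim => //=.
apply: (@cvg_trans _ (cst (v ord0 i) @ (0:R)^')); last exact: cvg_cst.
apply: near_eq_cvg.
near=> h; have h0 : h != 0 by near: h; exact: nbhs_dnbhs_neq.
by rewrite /= !mxE addrK /GRing.scale/= mulKf.
Unshelve. all: by end_near. Qed.

Lemma polyfun_derive f v : polyfun f -> polyfun ('D_v f).
Proof.
elim=> [c|i|{}f g pf ihf pg ihg|{}f g pf ihf pg ihg].
- rewrite (_ : 'D_v _ = cst 0); first exact: polyfun_cst.
  by apply/funext => x; rewrite derive_cst.
- rewrite (_ : 'D_v _ = cst (v ord0 i)); first exact: polyfun_cst.
  by apply/funext => x; exact: derive_coord.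
- have -> : 'D_v (fun x => f x + g x) = (fun x => 'D_v f x + 'D_v g x).
  by apply/funext => x; rewrite deriveD//; exact: polyfun_derivable.
  exact: polyfunD.
- rewrite (_ : 'D_v _ = fun x => f x * 'D_v g x + g x * 'D_v f x).
    by apply: polyfunD; exact: polyfunM.
  by apply/funext => x; rewrite deriveM//; exact: polyfun_derivable.
Qed.

(** Hadamard's lemma, with factors that are again polynomial. For a product, use
    [f y * g y - f x * g x = (f y - f x) * g y + f x * (g y - g x)]. *)
Lemma polyfun_hadamard f x : polyfun f ->
  exists2 D : 'I_m -> E -> R, forall j, polyfun (D j)
  & forall y, f y = f x + \sum_j (y - x) ord0 j * D j y.
Proof.
elim=> [c|i|{}f g pf [Df pDf fD] pg [Dg pDg gD]|{}f g pf [Df pDf fD] pg [Dg pDg gD]].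
- exists (fun _ => cst 0) => [j|y]; first exact: polyfun_cst.
  by rewrite big1 ?addr0// => j _; rewrite mulr0.
- exists (fun j => cst (j == i)%:R) => [j|y]; first exact: polyfun_cst.
  rewrite (bigD1 i)//= eqxx mulr1 big1 ?addr0 => [|j /negPf ->]; last by rewrite mulr0.
  by rewrite !mxE; ring.
- exists (fun j y => Df j y + Dg j y) => [j|y]; first exact: polyfunD.
  rewrite (fD y) (gD y) addrACA -big_split/=; congr (_ + _).
  by apply: eq_bigr => j _; rewrite mulrDr.
- exists (fun j y => Df j y * g y + f x * Dg j y) => [j|y].
    by apply: polyfunD; apply: polyfunM => //; exact: polyfun_cst.
  under eq_bigr do rewrite mulrDr mulrA mulrCA.
  rewrite big_split/= -mulr_suml -mulr_sumr.
  have -> : \sum_j (y - x) ord0 j * Df j y = f y - f x.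
    by rewrite (fD y) addrAC subrr add0r.
  have -> : \sum_j (y - x) ord0 j * Dg j y = g y - g x.
    by rewrite (gD y) addrAC subrr add0r.
  by ring.
Qed.

(** The difference quotient of [f] along [v] at [x] is, for [f] factored as
    above, a continuous function of the increment. *)
Lemma hadamard_derive f x v (D : 'I_m -> E -> R) : polyfun f ->
  (forall j, polyfun (D j)) ->
  (forall y, f y = f x + \sum_j (y - x) ord0 j * D j y) ->
  'D_v f x = \sum_j v ord0 j * D j x.
Proof.
move=> pf pD fD; apply/cvg_lim => //.
have : (\sum_j v ord0 j * D j (h *: v + x)) @[h --> 0^'] -->
    \sum_j v ord0 j * D j (0 *: v + x).
  apply: cvg_within_filter.
  have pc : polyfun (fun y => \sum_j v ord0 j * D j y).
    by apply: polyfun_sum => j; apply: polyfunM => //; exact: polyfun_cst.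
  have cl : {for 0, continuous (fun h : R => h *: v + x)}.
    by apply: cvgD; [exact: scalel_continuous|exact: cvg_cst].
  exact: (continuous_comp cl (@polyfun_continuous _ pc _)).
rewrite scale0r add0r; apply: cvg_trans; apply: near_eq_cvg.
near=> h; have h0 : h != 0 by near: h; exact: nbhs_dnbhs_neq.
rewrite /= (fD (h *: v + x)) addrAC subrr add0r addrK scaler_sumr.
by apply: eq_bigr => j _; rewrite mxE -mulrA /GRing.scale/= mulKf.
Unshelve. all: by end_near. Qed.

End polynomial_functions.


(** * Symmetric pencils on a finite-dimensional space *)

Section bilinear_matrix.
Variables (R : realType) (m : nat).
Implicit Types (M : 'M[R]_m) (x y z : 'rV[R]_m).

Definition bil M x y : R := (x *m M *m y^T) ord0 ord0.

Lemma bilPl M c x y z : bil M (c *: x + y) z = c * bil M x z + bil M y z.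
Proof. by rewrite /bil !mulmxDl -!scalemxAl !mxE. Qed.

Lemma bilC M x y : M^T = M -> bil M x y = bil M y x.
Proof.
move=> MT; rewrite /bil -[in LHS](trmxK (x *m M *m y^T)) [LHS]mxE.
by rewrite !trmx_mul trmxK MT mulmxA.
Qed.

Lemma bilPr M c x y z : M^T = M ->
  bil M z (c *: x + y) = c * bil M z x + bil M z y.
Proof. by move=> MT; rewrite bilC// bilPl !(bilC _ z). Qed.

Lemma bil0l M x : bil M 0 x = 0.
Proof. by rewrite /bil !mul0mx mxE. Qed.

Lemma bilZl M c x y : bil M (c *: x) y = c * bil M x y.
Proof. by rewrite -[c *: x]addr0 bilPl bil0l addr0. Qed.

Lemma bil_suml M I (r : seq I) (F : I -> 'rV[R]_m) y :
  bil M (\sum_(i <- r) F i) y = \sum_(i <- r) bil M (F i) y.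
Proof.
elim: r => [|i r ih]; first by rewrite !big_nil bil0l.
by rewrite !big_cons -{1}[F i]scale1r bilPl mul1r ih.
Qed.

Lemma polyfun_bil M y : polyfun (fun x => bil M x y).
Proof.
rewrite (_ : (fun x => _) = fun x => \sum_i x ord0 i * (M *m y^T) i ord0).
  by apply: polyfun_sum => i; apply: polyfunM;
    [exact: polyfun_coord|exact: polyfun_cst].
by apply/funext => x; rewrite /bil -mulmxA mxE.
Qed.

Lemma polyfun_bilxx M : polyfun (fun x => bil M x x).
Proof.
rewrite (_ : (fun x => _) = fun x => \sum_j (\sum_i x ord0 i * M i j) * x ord0 j).
  apply: polyfun_sum => j; apply: polyfunM; last exact: polyfun_coord.
  by apply: polyfun_sum => i; apply: polyfunM; [exact: polyfun_coord|exact: polyfun_cst].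
apply/funext => x; rewrite /bil mxE; apply: eq_bigr => j _.
by rewrite !mxE.
Qed.

(** If [p] were nonzero, a small [t] of sign opposite to [p] would give a negative
    value. This is what makes an extremal vector of a Rayleigh quotient an
    eigenvector: [t] is the size of a perturbation in a fixed direction. *)
Lemma linear_coef_eq0 (p q : R) : (forall t, 0 <= t * p + t ^+ 2 * q) -> p = 0.
Proof.
move=> h; have [//|p0] := eqVneq p 0.
have q0 : 0 <= `|q| := normr_ge0 q.
have e0 : 0 < (`|q| + 1)^-1 by rewrite invr_gt0 ltr_wpDl.
have := h (- p * (`|q| + 1)^-1); set e := (_)^-1 in e0 *.
rewrite (_ : - p * e * p + (- p * e) ^+ 2 * q = p ^+ 2 * e * (e * q - 1)); last by ring.
have pe : 0 < p ^+ 2 * e by rewrite mulr_gt0// exprn_even_gt0.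
rewrite (pmulr_rge0 _ pe) subr_ge0 => eq1.
suff : e * q < 1 by rewrite ltNge eq1.
rewrite mulrC ltr_pdivrMr; last by rewrite ltr_wpDl.
rewrite mul1r.
by apply: le_lt_trans (ler_norm _) _; rewrite ltrDl.
Qed.

(** Greedy diagonalization of [B] relatively to the positive definite [C]: the
    next vector maximizes the Rayleigh quotient on the orthogonal of the previous
    ones, so that the eigenvalues come out in nonincreasing order. *)
Lemma simultaneous_diagonalization (C B : 'M[R]_m) : C^T = C -> B^T = B ->
  (forall x, x != 0 -> 0 < bil C x x) ->
  exists (p : nat -> 'rV[R]_m) (mu : nat -> R),
    [/\ forall i j, (i < m)%N -> (j < m)%N -> bil C (p i) (p j) = (i == j)%:R,
        forall i x, (i < m)%N -> bil B (p i) x = mu i * bil C (p i) x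
      & forall i j, (i <= j < m)%N -> mu j <= mu i].
Proof.
move=> CT BT C0.
suff /(_ m (leqnn m))[p [mu [pp pB pmax]]] : forall k, (k <= m)%N ->
    exists (p : nat -> 'rV[R]_m) (mu : nat -> R),
    [/\ forall i j, (i < k)%N -> (j < k)%N -> bil C (p i) (p j) = (i == j)%:R,
        forall i x, (i < k)%N -> bil B (p i) x = mu i * bil C (p i) x
      & forall i x, (i < k)%N -> (forall j, (j < i)%N -> bil C x (p j) = 0) ->
          bil B x x <= mu i * bil C x x].
  exists p, mu; split=> // i j /andP[ij jm].
  have im := leq_ltn_trans ij jm.
  have := pmax i (p j) im; rewrite pB// pp// eqxx !mulr1; apply => l li.
  by rewrite pp ?(ltn_trans li)// gtn_eqF// (leq_trans li).
elim=> [_|k ih km]; first by exists (fun=> 0), (fun=> 0); split.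
have [p [mu [pp pB pmax]]] := ih (ltnW km).
pose orth x := forall i, (i < k)%N -> bil C x (p i) = 0.
have [u ou u0] : exists2 u, orth u & u != 0.
  pose A := \matrix_(i < m, j < k) (C *m (p j)^T) i ord0.
  have : kermx A != 0.
    rewrite -mxrank_eq0 mxrank_ker subn_eq0 -ltnNge.
    exact: leq_ltn_trans (rank_leq_col _) km.
  move=> /rowV0Pn[u /sub_kermxP uA u0]; exists u => // i ik.
  move/rowP : uA => /(_ (Ordinal ik)); rewrite !mxE => uA.
  rewrite /bil -mulmxA mxE -[RHS]uA; apply: eq_bigr => l _; congr (_ * _).
  by rewrite [RHS]mxE.
pose S := [set x : 'rV[R]_m | `|x| = 1 /\ orth x].
have S0 : S !=set0.
  exists (`|u|^-1 *: u); split.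
    by rewrite normrZ normfV normr_id mulVf// normr_eq0.
  by move=> i ik; rewrite bilZl ou// mulr0.
have cS : compact S.
  apply: bounded_closed_compact.
    by exists 1; split => // x x1 y [y1 _] /=; rewrite y1; exact: ltW.
  rewrite (_ : S = (fun x => `|x|) @^-1` [set y | y = 1] `&`
      \bigcap_(i in [set i | (i < k)%N]) ((fun x => bil C x (p i)) @^-1` [set y | y = 0])).
    apply: closedI.
      by apply: closed_comp; [move=> x _; exact: norm_continuous|exact: closed_eq].
    apply: closed_bigI => i _; apply: closed_comp; last exact: closed_eq.
    by move=> x _; apply: polyfun_continuous; exact: polyfun_bil.
  by apply/seteqP; split => x.
have nS x : S x -> x != 0.
  by case=> x1 _; rewrite -normr_eq0 x1 oner_eq0.
have cf : {within S, continuous (fun x => bil B x x / bil C x x)}.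
  apply: continuous_in_subspaceT => x; rewrite inE => /nS x0.
  apply: (@continuousM R _ (fun x => bil B x x) (fun x => (bil C x x)^-1) x).
    by apply: polyfun_continuous; exact: polyfun_bilxx.
  apply: (@continuousV R _ (fun x => bil C x x) x); first by rewrite gt_eqF// C0.
  by apply: polyfun_continuous; exact: polyfun_bilxx.
have [q] := compact_EVT_max S0 cS cf.
rewrite inE => -[q1 oq] qmax; set nu := bil B q q / bil C q q in qmax.
have q0 : q != 0 by exact: nS.
have Cq := C0 _ q0.
have numax x : orth x -> bil B x x <= nu * bil C x x.
  move=> ox; have [->|x0] := eqVneq x 0; first by rewrite !bil0l mulr0.
  have := qmax (`|x|^-1 *: x); rewrite inE.
  have nx0 : `|x|^-1 ^+ 2 != 0 by rewrite sqrf_eq0 invr_eq0 normr_eq0.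
  have bilZZ M : M^T = M -> bil M (`|x|^-1 *: x) (`|x|^-1 *: x) =
      `|x|^-1 ^+ 2 * bil M x x.
    by move=> MT; rewrite bilZl bilC// bilZl mulrA.
  rewrite !bilZZ// -mulf_div divff// mul1r ler_pdivrMr ?C0//; apply; split.
    by rewrite normrZ normfV normr_id mulVf// normr_eq0.
  by move=> i ik; rewrite bilZl ox// mulr0.
have qB x : bil B q x = nu * bil C q x.
  pose y := x - \sum_(i < k) bil C x (p i) *: p i.
  have oy : orth y.
    move=> i ik; rewrite /y -scaleN1r addrC bilPl bil_suml.
    rewrite (bigD1 (Ordinal ik))//= bilZl pp// eqxx mulr1 big1 ?addr0 ?mulN1r ?addNr//.
    by move=> j; rewrite -val_eqE/= => /negPf ji; rewrite bilZl pp// ji mulr0.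
  suff qy : nu * bil C q y - bil B q y = 0.
    have -> : x = y + \sum_(i < k) bil C x (p i) *: p i by rewrite subrK.
    rewrite -[y]scale1r !bilPr// !mul1r mulrDr; congr (_ + _).
      by apply/eqP; rewrite eq_sym -subr_eq0 qy.
    rewrite ![bil _ q (\sum_(i < k) _)]bilC// !bil_suml mulr_sumr.
    apply: eq_bigr => i _; rewrite !bilZl pB// [bil C _ q]bilC// oq//.
    by rewrite !mulr0.
  suff : 2 * (nu * bil C q y - bil B q y) = 0.
    by move=> /eqP; rewrite mulf_eq0 pnatr_eq0/= => /eqP.
  apply: (@linear_coef_eq0 _ (nu * bil C y y - bil B y y)) => t.
  have := numax (t *: y + q); rewrite -subr_ge0.
  have BqE : bil B q q = nu * bil C q q by rewrite divfK// gt_eqF.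
  rewrite !(bilPr, bilPl)// BqE [bil C y q]bilC// [bil B y q]bilC// => /(_ _)/le_trans.
  apply; last by rewrite le_eqVlt; apply/orP; left; apply/eqP; ring.
  by move=> i ik; rewrite bilPl oy// oq// mulr0 addr0.
pose p' i := if (i < k)%N then p i else (Num.sqrt (bil C q q))^-1 *: q.
pose mu' i := if (i < k)%N then mu i else nu.
exists p', mu'; split => [i j|i x|i x].
- move=> ik jk; rewrite /p'; have [ik'|ik'] := ltnP i k; have [jk'|jk'] := ltnP j k.
  + exact: pp.
  + have -> : j = k by apply/eqP; rewrite eqn_leq jk' andbT -ltnS.
    by rewrite bilC// bilZl oq// mulr0 ltn_eqF.
  + have -> : i = k by apply/eqP; rewrite eqn_leq ik' andbT -ltnS.
    by rewrite bilZl oq// mulr0 gtn_eqF.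
  + have -> : j = k by apply/eqP; rewrite eqn_leq jk' andbT -ltnS.
    have -> : i = k by apply/eqP; rewrite eqn_leq ik' andbT -ltnS.
    rewrite eqxx bilZl bilC// bilZl mulrA -expr2 exprVn sqr_sqrtr ?(ltW Cq)//.
    by rewrite mulVf// gt_eqF.
- move=> ik; rewrite /p' /mu'; have [ik'|ik'] := ltnP i k; first exact: pB.
  by rewrite !bilZl qB mulrCA.
- move=> ik; rewrite /p' /mu'; have [ik'|ik'] := ltnP i k => h.
    by apply: pmax => // j ji; have := h j ji; rewrite (ltn_trans ji ik').
  by apply: numax => j jk; have := h j (leq_trans jk ik'); rewrite jk.
Qed.

End bilinear_matrix.

Section subspaces.
Variables (R : realType) (F : lmodType R).
Implicit Types (V : set F) (u v w : F).

Definition linear_subspace V : Prop :=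
  V 0 /\ forall c u v, V u -> V v -> V (c *: u + v).

Lemma linear_subspace_sum V I (r : seq I) (c : I -> R) (f : I -> F) :
  linear_subspace V -> (forall i, V (f i)) -> V (\sum_(i <- r) c i *: f i).
Proof.
move=> [V0 VP] Vf; elim: r => [|i r ih]; first by rewrite big_nil.
by rewrite big_cons; exact: VP.
Qed.

Lemma free_family_bound k r (e : 'I_k -> F) (f : 'I_r -> F) :
  (forall i, range (fun c : 'I_k -> R => \sum_j c j *: e j) (f i)) ->
  (forall c : 'I_r -> R, \sum_i c i *: f i = 0 -> forall i, c i = 0) ->
  (r <= k)%N.
Proof.
move=> /(_ _)/cid2-/all_sig2[M _ fM] free; rewrite leqNgt; apply/negP => kr.
pose A := \matrix_(i < r, j < k) M i j.
have : kermx A != 0.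
  rewrite -mxrank_eq0 mxrank_ker subn_eq0 -ltnNge.
  exact: leq_ltn_trans (rank_leq_col _) kr.
move=> /rowV0Pn[u /sub_kermxP uA /negP]; apply; apply/eqP/rowP => i; rewrite mxE.
apply: (free (u ord0)).
transitivity (\sum_j (u *m A) ord0 j *: e j); last first.
  by rewrite uA big1// => j _; rewrite mxE scale0r.
under eq_bigr do rewrite -fM scaler_sumr.
rewrite exchange_big/=; apply: eq_bigr => j _; rewrite mxE scaler_suml.
by apply: eq_bigr => l _; rewrite mxE scalerA.
Qed.

(** A free family of maximal size in [V] spans [V]; sizes are bounded by that
    of the spanning family of a larger space. *)
Lemma exists_basis V k (e : 'I_k -> F) : linear_subspace V ->
  V `<=` range (fun c : 'I_k -> R => \sum_j c j *: e j) ->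
  exists m, has_dim V m.
Proof.
move=> sV Ve.
pose P r := `[< exists f : 'I_r -> F, (forall i, V (f i)) /\
  (forall c : 'I_r -> R, \sum_i c i *: f i = 0 -> forall i, c i = 0) >].
have exP : exists r, P r.
  by exists 0%N; apply/asboolP; exists (fun=> 0); split => [[]//|c _ []].
have ubP r : P r -> (r <= k)%N.
  by move=> /asboolP[f [Vf free]]; apply: (@free_family_bound _ _ e f) => // i; exact: Ve.
case: (ex_maxnP exP ubP) => m /asboolP[f [Vf free]] mmax.
exists m, f; split=> //; apply/seteqP; split => [v Vv|_ [c _ <-]]; last exact: linear_subspace_sum.
apply: contrapT => fv.
suff : P m.+1 by move=> /mmax; rewrite ltnn.
apply/asboolP; exists (fun i => if unlift ord0 i is Some j then f j else v).
split=> [i|c]; first by case: unliftP.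
rewrite big_ord_recl unlift_none.
under eq_bigr do rewrite liftK.
have [c00|c0] := eqVneq (c ord0) 0.
  rewrite c00 scale0r add0r => /(free (fun j => c (lift ord0 j))) c0' i.
  by have [j ->|->//] := unliftP ord0 i; exact: c0'.
move=> cv; exfalso; apply: fv.
exists (fun j => - (c ord0)^-1 * c (lift ord0 j)) => //=.
under eq_bigr do rewrite -scalerA.
rewrite -scaler_sumr scaleNr; apply/eqP; rewrite eq_sym -addr_eq0.
by rewrite -[v in v + _](scalerK c0) -scalerDr cv scaler0.
Qed.

End subspaces.

Section pencil.
Variables (R : realType) (F : lmodType R) (V : set F) (a b : F -> F -> R).

Definition psd_form (q : F -> F -> R) : Prop :=
  [/\ forall c u v w, V u -> V v -> V w -> q (c *: u + v) w = c * q u w + q v w,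
      forall u v, V u -> V v -> q u v = q v u
    & forall u, V u -> 0 <= q u u].

Lemma psd_form_sum q I (r : seq I) (c : I -> R) (f : I -> F) v : linear_subspace V ->
  psd_form q -> (forall i, V (f i)) -> V v ->
  q (\sum_(i <- r) c i *: f i) v = \sum_(i <- r) c i * q (f i) v.
Proof.
move=> sV [qP _ _] Vf Vv; elim: r => [|i r ih].
  rewrite !big_nil; have := qP (-1) 0 0 v; rewrite scaler0 addr0 mulN1r addNr.
  by apply => //; case: sV.
by rewrite !big_cons qP// ?ih//; exact: linear_subspace_sum.
Qed.

Hypotheses (sV : linear_subspace V) (pa : psd_form a) (pb : psd_form b).
Hypothesis ab0 : forall v, V v -> b v v = 0 -> a v v = 0 -> v = 0.
Let c u v := a u v + b u v.

(** By [ab0] the form [a + b] is a scalar product, with respect to which [b] is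
    diagonalized; [a] then is diagonal as well. Compared with [b], which is
    degenerate, [a + b] treats the infinite eigenvalue of the pencil like the
    others: it corresponds to [mu i = 0]. *)
Lemma diagonalizing_basis m : has_dim V m ->
  exists (f : 'I_m -> F) (mu : 'I_m -> R),
    [/\ forall i, V (f i),
        forall i v, V v -> b (f i) v = mu i * c (f i) v,
        forall i j, c (f i) (f j) = (i == j)%:R,
        forall i j : 'I_m, (i <= j)%N -> mu j <= mu i
      & forall v, V v -> v = \sum_i c (f i) v *: f i].
Proof.
move=> [e [efree Ve]].
have eV i : V (e i).
  rewrite Ve; exists (fun j => (i == j)%:R) => //; rewrite (bigD1 i)//= eqxx scale1r.
  by rewrite big1 ?addr0// => j; rewrite eq_sym => /negPf ->; rewrite scale0r.
pose Phi (x : 'rV[R]_m) := \sum_i x ord0 i *: e i.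
have PhiV x : V (Phi x) by exact: linear_subspace_sum.
have PhiS v : V v -> exists x, v = Phi x.
  rewrite Ve => -[d _ <-]; exists (\row_i d i).
  by apply: eq_bigr => i _; rewrite mxE.
have Phi0 x : Phi x = 0 -> x = 0.
  by move=> /efree h; apply/rowP => i; rewrite mxE; exact: h.
have Phi_form q x y : psd_form q ->
    q (Phi x) (Phi y) = bil (\matrix_(i, j) q (e i) (e j)) x y.
  move=> pq; have [_ qC _] := pq; rewrite psd_form_sum// /bil -mulmxA mxE.
  apply: eq_bigr => i _; congr (_ * _); rewrite qC// psd_form_sum// mxE.
  by apply: eq_bigr => j _; rewrite !mxE mulrC qC.
have gram_sym q : psd_form q ->
    (\matrix_(i, j) q (e i) (e j))^T = \matrix_(i, j) q (e i) (e j).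
  by move=> [_ qC _]; apply/matrixP => i j; rewrite !mxE qC.
pose A := \matrix_(i, j) a (e i) (e j); pose B := \matrix_(i, j) b (e i) (e j).
have ABE x y : c (Phi x) (Phi y) = bil (A + B) x y.
  by rewrite /c !Phi_form// -/A -/B /bil mulmxDr mulmxDl [RHS]mxE.
have [_ _ a0] := pa; have [_ _ b0] := pb.
have C0 x : x != 0 -> 0 < bil (A + B) x x.
  move=> x0; rewrite -ABE lt_neqAle addr_ge0 ?a0 ?b0// andbT eq_sym.
  apply: contra x0; rewrite paddr_eq0 ?a0 ?b0// => /andP[/eqP ax /eqP bx].
  by apply/eqP/Phi0/ab0.
have CT : (A + B)^T = A + B by rewrite linearD/= /A /B !gram_sym.
have [p [mu [pp pB mule]]] := simultaneous_diagonalization CT (gram_sym _ pb) C0.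
exists (fun i => Phi (p i)), (fun i => mu i); split=> //.
- by move=> i v /PhiS[x ->]; rewrite ABE Phi_form// -/B pB.
- by move=> i j; rewrite ABE pp.
- by move=> i j ij; apply: mule; rewrite ij ltn_ord.
move=> v /PhiS[x ->].
pose P := \matrix_(i < m) p i.
have PE (i : 'I_m) : p i = row i P by rewrite rowK.
have PCP : P *m ((A + B) *m P^T) = 1%:M.
  apply/matrixP => i j; rewrite [RHS]mxE -(pp i j (ltn_ord i) (ltn_ord j)) /bil !PE.
  rewrite -row_mul mulmxA.
  rewrite [LHS]mxE [RHS]mxE; apply: eq_bigr => l _.
  by rewrite [in RHS]mxE; congr (_ * _); rewrite !mxE.
have xE : x = \sum_(i < m) bil (A + B) (p i) x *: p i.
  rewrite -[LHS]mulmx1 -(mulmx1C PCP) mulmxA mulmx_sum_row.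
  apply: eq_bigr => i _; rewrite PE bilC// -PE /bil; congr (_ *: _).
  rewrite mulmxA [LHS]mxE [RHS]mxE; apply: eq_bigr => l _; congr (_ * _).
  by rewrite PE !mxE.
have PhiD I (r : seq I) (G : I -> 'rV[R]_m) (d : I -> R) :
    Phi (\sum_(i <- r) d i *: G i) = \sum_(i <- r) d i *: Phi (G i).
  rewrite /Phi; under [RHS]eq_bigr do rewrite scaler_sumr.
  rewrite exchange_big/=; apply: eq_bigr => l _; rewrite summxE scaler_suml.
  by apply: eq_bigr => i _; rewrite mxE scalerA.
by rewrite {1}xE PhiD; apply: eq_bigr => i _; rewrite ABE.
Qed.


(** The kernel of [b], its [a]-orthogonal and each eigenspace of the pencil are cut
    out of [V] by the vanishing of some coordinates in a diagonalizing basis. *)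
Lemma coordinate_basis m (f : 'I_m -> F) (U : set F) r (g : 'I_r -> 'I_m)
    (s : 'I_r -> R) :
  (forall i, V (f i)) -> (forall i j, c (f i) (f j) = (i == j)%:R) ->
  (forall v, V v -> v = \sum_i c (f i) v *: f i) ->
  injective g -> (forall k, s k != 0) ->
  (forall v, U v <-> V v /\ forall i, i \notin codom g -> c (f i) v = 0) ->
  is_basis U (fun k => s k *: f (g k)).
Proof.
move=> fV ff fE ginj s0 UE.
have cC u v : V u -> V v -> c u v = c v u.
  by move=> Vu Vv; rewrite /c; have [_ -> //] := pa; have [_ -> //] := pb.
have csum I (t : seq I) (d : I -> R) (h : I -> F) v : (forall i, V (h i)) -> V v ->
    c (\sum_(i <- t) d i *: h i) v = \sum_(i <- t) d i * c (h i) v.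
  move=> hV Vv; rewrite /c !psd_form_sum// -big_split/=.
  by apply: eq_bigr => i _; rewrite mulrDr.
have gV k : V (f (g k)) by [].
have Vsum (d : 'I_r -> R) : V (\sum_k d k *: (s k *: f (g k))).
  by under eq_bigr do rewrite scalerA; exact: linear_subspace_sum.
have coordE (d : 'I_r -> R) i :
    c (f i) (\sum_k d k *: (s k *: f (g k))) = \sum_k d k * s k * (i == g k)%:R.
  rewrite cC//; under eq_bigr do rewrite scalerA.
  by rewrite csum//; apply: eq_bigr => k _; rewrite ff eq_sym.
split=> [d d0 k|].
  have := coordE d (g k); rewrite d0 (bigD1 k)//= eqxx mulr1 big1 => [|l lk]; last first.
    by rewrite (inj_eq ginj) eq_sym (negPf lk) mulr0.
  rewrite addr0 cC//; last by case: sV.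
  have := csum _ [::] (fun _ : 'I_m => 0) f (f (g k)) fV (gV k).
  rewrite !big_nil => -> /esym/eqP.
  by rewrite mulf_eq0 (negPf (s0 k)) orbF => /eqP.
apply/seteqP; split=> [v /UE[Vv v0]|_ [d _ <-]]; last first.
  apply/UE; split; first exact: Vsum.
  move=> i ig; rewrite coordE big1// => k _.
  case: eqVneq => [ik|]; last by rewrite mulr0.
  by rewrite ik codom_f in ig.
exists (fun k => c (f (g k)) v / s k) => //.
under eq_bigr do rewrite scalerA divfK//.
rewrite [RHS]fE// (bigID (mem (codom g)))/= [X in _ + X]big1 ?addr0; last first.
  by move=> i ig; rewrite v0// scale0r.
apply/esym; rewrite (@reindex_omap _ _ _ _ _ g (fun i => [pick k | g k == i])).
  apply: eq_bigl => k; rewrite codom_f/=; case: pickP => [l /eqP/ginj ->|/(_ k)].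
    by rewrite eqxx.
  by rewrite eqxx.
move=> i /codomP[k ->]; case: pickP => [l /eqP /= ->//|/(_ k)].
by rewrite eqxx.
Qed.


(** In a diagonalizing basis, [b] has the coefficients [mu i] and [a] the
    coefficients [1 - mu i], so the [i]-th vector has the eigenvalue
    [(1 - mu i) / mu i], finite if and only if [mu i > 0]; as [mu] is nonincreasing,
    the finite eigenvalues come first and in nondecreasing order. Dividing by the
    square root of [mu i] passes from [a + b]-orthonormal to [b]-orthonormal. *)
Theorem pencil_eigenbasis m : has_dim V m ->
  let V0 := [set v | V v /\ b v v = 0] in
  let W := [set u | V u /\ forall v, V0 v -> a u v = 0] in
  exists (N K : nat) (lambda : 'I_N -> R) (phi : 'I_N -> F) (varphi : 'I_K -> F),
    [/\ forall k, 0 <= lambda k,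
        forall k l : 'I_N, (k <= l)%N -> lambda k <= lambda l,
        forall k, [/\ V (phi k), phi k <> 0
            & forall v, V v -> a (phi k) v = lambda k * b (phi k) v]
      & [/\ forall nu, has_dim [set u | V u /\ forall v, V v -> a u v = nu * b u v]
                               #|[pred k | lambda k == nu]|,
            is_basis W phi
          & forall k l, b (phi k) (phi l) = (k == l)%:R]] /\
    [/\ is_basis V0 varphi, forall i, varphi i <> 0
      & forall i k, a (varphi i) (phi k) = 0].
Proof.
move=> /diagonalizing_basis[f [mu [fV fB ff mule fE]]] V0 W.
have [_ aC a0] := pa; have [_ bC b0] := pb.
have [Vz _] := sV.
have cC u v : V u -> V v -> c u v = c v u by move=> Vu Vv; rewrite /c aC// bC.
have fA i v : V v -> a (f i) v = (1 - mu i) * c (f i) v.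
  by move=> Vv; rewrite mulrBl mul1r -fB// /c addrK.
have mu_ge0 i : 0 <= mu i.
  by have := b0 _ (fV i); rewrite fB// ff eqxx mulr1.
have mu_le1 i : mu i <= 1.
  by have := a0 _ (fV i); rewrite fA// ff eqxx mulr1 subr_ge0.
have f_neq0 i : f i <> 0.
  move=> fi0; have /eqP := ff i i; rewrite eqxx {2}fi0.
  have := psd_form_sum [::] (fun _ : 'I_m => 0) sV pa fV (fV i).
  have := psd_form_sum [::] (fun _ : 'I_m => 0) sV pb fV (fV i).
  rewrite !big_nil cC// /c => -> ->.
  by rewrite addr0 eq_sym oner_eq0.
(* the indices of the positive [mu i] form an initial segment *)
have [N Nm NP] : exists2 N, (N <= m)%N & forall i : 'I_m, (i < N)%N = (0 < mu i).
  pose z (k : nat) := if insub k is Some i then mu i <= 0 else true.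
  exists (find z (iota 0 m)); first by rewrite -[leqRHS](size_iota 0) find_size.
  move=> i; rewrite ltNge.
  have zE (j : 'I_m) : z j = (mu j <= 0).
    by rewrite /z; case: insubP => [l _ /val_inj ->//|]; rewrite ltn_ord.
  rewrite -zE; apply/idP/idP => [im|].
    by have := before_find 0%N im; rewrite nth_iota// add0n => ->.
  apply: contraNT; rewrite -leqNgt => fi.
  have hz : has z (iota 0 m) by rewrite has_find size_iota (leq_ltn_trans fi).
  have := nth_find 0%N hz; rewrite has_find size_iota in hz.
  rewrite nth_iota// add0n -[find _ _]/(val (Ordinal hz)) !zE.
  by apply: le_trans; exact: mule.
pose hi (k : 'I_N) : 'I_m := widen_ord Nm k.
have hi_inj : injective hi by move=> k l /(congr1 val)/= /val_inj.
have lo_lt (k : 'I_(m - N)) : (N + k < m)%N by rewrite -ltn_subRL.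
pose lo k : 'I_m := Ordinal (lo_lt k).
have lo_inj : injective lo by move=> k l /(congr1 val)/= /addnI/val_inj.
have hiP i : (i \in codom hi) = (0 < mu i).
  rewrite -NP; apply/codomP/idP => [[k ->]/=|iN]; first exact: ltn_ord.
  by exists (Ordinal iN); exact: val_inj.
have loP i : (i \in codom lo) = (mu i == 0).
  rewrite eq_le mu_ge0 andbT leNgt -NP -leqNgt; apply/codomP/idP => [[k ->]/=|iN].
    exact: leq_addr.
  have ik : (i - N < m - N)%N by rewrite ltn_sub2r// (leq_ltn_trans iN).
  by exists (Ordinal ik); apply: val_inj => /=; rewrite subnKC.
have hi_gt0 k : 0 < mu (hi k) by rewrite -hiP codom_f.
have lo0 k : mu (lo k) = 0 by apply/eqP; rewrite -loP codom_f.
have bvv v : V v -> b v v = \sum_i mu i * c (f i) v ^+ 2.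
  move=> Vv; rewrite {1}(fE v)// psd_form_sum//; apply: eq_bigr => i _.
  by rewrite fB// mulrCA expr2.
have auv u v : V u -> V v -> a u v = \sum_i c (f i) u * ((1 - mu i) * c (f i) v).
  move=> Vu Vv; rewrite {1}(fE u)// psd_form_sum//; apply: eq_bigr => i _.
  by rewrite fA.
have V0P v : V0 v <-> V v /\ forall i, i \notin codom lo -> c (f i) v = 0.
  split=> [[Vv bv]|[Vv cv]]; split=> //.
    move=> i; rewrite loP => mui; apply/eqP; move/eqP: bv; rewrite bvv//.
    rewrite psumr_eq0 => [/allP/(_ i (mem_index_enum _))/=|j _].
      by rewrite mulf_eq0 (negPf mui) sqrf_eq0.
    by rewrite mulr_ge0// sqr_ge0.
  rewrite bvv// big1// => i _; have [->|mui] := eqVneq (mu i) 0; first by rewrite mul0r.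
  by rewrite cv ?loP// expr0n mulr0.
have lo_V0 k : V0 (f (lo k)) by split; rewrite ?fB ?lo0 ?mul0r.
have WP u : W u <-> V u /\ forall i, i \notin codom hi -> c (f i) u = 0.
  split=> [[Vu Wu]|[Vu cu]]; split=> //.
    move=> i; rewrite hiP -leNgt => mui.
    have mui0 : mu i = 0 by apply/eqP; rewrite eq_le mui mu_ge0.
    have : i \in codom lo by rewrite loP mui0.
    move=> /codomP[k ik]; have := Wu _ (lo_V0 k).
    by rewrite aC// fA// lo0 subr0 mul1r -ik.
  move=> v /V0P[Vv cv]; rewrite auv// big1// => i _.
  have [mui|mui] := boolP (0 < mu i); last by rewrite cu ?hiP// mul0r.
  by rewrite cv ?mulr0// loP gt_eqF.
exists N, (m - N)%N, (fun k => (1 - mu (hi k)) / mu (hi k)),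
  (fun k => (Num.sqrt (mu (hi k)))^-1 *: f (hi k)), (fun k => 1 *: f (lo k)).
have s0 k : (Num.sqrt (mu (hi k)))^-1 != 0.
  by rewrite invr_neq0// gt_eqF// sqrtr_gt0.
have scaleE q k s v : psd_form q -> V v -> q (s *: f k) v = s * q (f k) v.
  move=> pq Vv; have := psd_form_sum [:: k] (fun=> s) sV pq fV Vv.
  by rewrite !big_seq1.
have fsV k s : V (s *: f k) by rewrite -[_ *: _]addr0; case: sV => _; apply.
split; last first.
  split; first exact: (coordinate_basis fV ff fE lo_inj (fun=> oner_neq0 _) V0P).
    by move=> i; rewrite scale1r.
  move=> i k; rewrite scale1r aC// scaleE// fA// ff.
  case: eqVneq => [e|]; last by rewrite !mulr0.
  by have := hi_gt0 k; rewrite e lo0 ltxx.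
split.
- by move=> k; rewrite divr_ge0 ?subr_ge0.
- move=> k l kl; have mul_le := mule (hi k) (hi l) kl.
  rewrite !mulrBl !mul1r !divff ?gt_eqF// lerD2r lef_pV2 ?posrE//.
- move=> k; split=> //.
    by move=> /eqP; rewrite scaler_eq0 (negPf (s0 k))/= => /eqP; exact: f_neq0.
  move=> v Vv; rewrite !scaleE// fA// fB// [RHS]mulrCA; congr (_ * _).
  by rewrite mulrA divfK// gt_eqF.
split.
- move=> nu; set A := [pred k | _].
  exists (fun k => 1 *: f (hi (enum_val k))).
  apply: (@coordinate_basis _ f _ _ (hi \o enum_val) (fun=> 1)) => //;
    first exact: inj_comp hi_inj enum_val_inj.
  have inA i : (i \in codom (hi \o @enum_val _ A)) =
      (0 < mu i) && (1 - mu i == nu * mu i).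
    apply/codomP/idP => [[k ->]/=|/andP[mui e]].
      rewrite hi_gt0/=; have := enum_valP k; rewrite inE => /eqP <-.
      by rewrite divfK// gt_eqF.
    have /codomP[k ik] : i \in codom hi by rewrite hiP.
    have kA : k \in A by rewrite inE -ik (eqP e) mulfK// gt_eqF.
    by exists (enum_rank_in kA k); rewrite /= enum_rankK_in.
  move=> v; split=> [[Vv av]|[Vv cv]]; split=> //.
    move=> i; rewrite inA => ni; have := av _ (fV i).
    rewrite aC// bC// fA// fB// mulrA => /eqP; rewrite -subr_eq0 -mulrBl mulf_eq0.
    case/orP => [|/eqP//]; rewrite subr_eq0 => e; move: ni; rewrite e andbT.
    rewrite -leNgt => mui; have mui0 : mu i = 0 by apply/eqP; rewrite eq_le mui mu_ge0.
    by move: e; rewrite mui0 subr0 mulr0 oner_eq0.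
  move=> w Vw; rewrite (fE v)// !psd_form_sum// mulr_sumr; apply: eq_bigr => i _.
  have [|ni] := boolP (i \in codom (hi \o @enum_val _ A)).
    by rewrite inA fA// fB// => /andP[_ /eqP ->]; ring.
  by rewrite cv// !mul0r mulr0.
- exact: (coordinate_basis fV ff fE hi_inj s0 WP).
- move=> k l; rewrite scaleE// bC// scaleE// bC// fB// ff (inj_eq hi_inj).
  case: eqVneq => [->|]; last by rewrite !mulr0.
  by rewrite mulr1 mulrA -expr2 exprVn sqr_sqrtr// mulVf// gt_eqF.
Qed.

End pencil.

(** * Segments, frontiers and hyperplanes *)

Section dotv_theory.
Variables (R : realType) (m : nat).
Implicit Types (u v w : 'rV[R]_m).

Lemma dotvE u v : dotv u v = \sum_i u ord0 i * v ord0 i.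
Proof. by rewrite /dotv mxE; apply: eq_bigr => i _; rewrite mxE. Qed.

Lemma dotvC u v : dotv u v = dotv v u.
Proof. by rewrite !dotvE; apply: eq_bigr => i _; rewrite mulrC. Qed.

Lemma dotvDr u v w : dotv u (v + w) = dotv u v + dotv u w.
Proof.
by rewrite !dotvE -big_split; apply: eq_bigr => i _; rewrite mxE mulrDr.
Qed.

Lemma dotvZr k u v : dotv u (k *: v) = k * dotv u v.
Proof.
by rewrite !dotvE mulr_sumr; apply: eq_bigr => i _; rewrite mxE mulrCA.
Qed.

Lemma dotvBr u v w : dotv u (v - w) = dotv u v - dotv u w.
Proof. by rewrite dotvDr -scaleN1r dotvZr mulN1r. Qed.

Lemma dotvv_ge0 u : 0 <= dotv u u.
Proof. by rewrite dotvE sumr_ge0// => i _; rewrite -expr2 sqr_ge0. Qed.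

Lemma dotvv_eq0 u : (dotv u u == 0) = (u == 0).
Proof.
apply/eqP/eqP => [|->]; last by rewrite dotvE big1// => i _; rewrite mxE mul0r.
rewrite dotvE => /psumr_eq0P u0; apply/rowP => i; rewrite mxE.
have /eqP := u0 (fun i _ => sqr_ge0 (u ord0 i)) i isT.
by rewrite mulf_eq0 orbb => /eqP.
Qed.

Lemma polyfun_dotv u : polyfun (dotv u).
Proof.
rewrite (_ : dotv u = fun x => \sum_i u ord0 i * x ord0 i); last first.
  by apply/funext => x; rewrite dotvE.
by apply: polyfun_sum => i; apply: polyfunM; [exact: polyfun_cst|exact: polyfun_coord].
Qed.

Lemma polyfun_dotvv d (g : 'rV[R]_d -> 'rV[R]_m) :
  (forall j, polyfun (fun x => g x ord0 j)) -> polyfun (fun x => dotv (g x) (g x)).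
Proof.
move=> pg; rewrite (_ : (fun x => _) = fun x => \sum_j g x ord0 j * g x ord0 j).
  by apply: polyfun_sum => j; exact: polyfunM.
by apply/funext => x; rewrite dotvE.
Qed.

Lemma continuous_dotv u : continuous (dotv u).
Proof. exact/polyfun_continuous/polyfun_dotv. Qed.

End dotv_theory.

Section segments.
Variables (R : realType) (m : nat).
Local Notation E := 'rV[R]_m.
Implicit Types (x y z v : E) (A B U Y Z : set E).

Lemma continuous_line x v : continuous (fun t : R => x + t *: v).
Proof.
by move=> t; apply: cvgD; [exact: cvg_cst|exact: scalel_continuous].
Qed.

Lemma near_line A x v : open A -> A x -> \forall t \near 0, A (x + t *: v).
Proof.
move=> oA Ax; apply: (@continuous_line x v 0 A).
by rewrite /= scale0r addr0; exact: open_nbhs_nbhs.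
Qed.

Definition segment x y : set E := (fun t => x + t *: (y - x)) @` `[0, 1].

Lemma segmentl x y : segment x y x.
Proof.
by exists 0; rewrite ?scale0r ?addr0//= in_itv/= lexx ler01.
Qed.

Lemma segmentr x y : segment x y y.
Proof.
by exists 1; rewrite ?scale1r ?subrKC//= in_itv/= lexx ler01.
Qed.

Lemma connected_segment x y : connected (segment x y).
Proof.
apply: connected_continuous_connected; first exact: segment_connected.
exact/continuous_subspaceT/continuous_line.
Qed.

Lemma closed_frontier A : closed (frontier A).
Proof.
apply: closedI; first exact: closed_closure.
exact/open_closedC/open_interior.
Qed.

(** Otherwise [A `&` B] would be relatively open in [A], being [A `&` B°], and
    relatively closed, being [A `&` closure B]. *)
Lemma connected_frontier A B : connected A ->
  A `&` B !=set0 -> A `\` B !=set0 -> A `&` frontier B !=set0.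
Proof.
move=> cA AB [z [Az nBz]]; apply: contrapT => AF.
suff AE : A `&` B = A by apply: nBz; move: Az; rewrite -AE => -[].
have F x : A x -> closure B x -> interior B x.
  by move=> Ax Bx; apply: contrapT => nBx; apply: AF; exists x.
apply: cA => //.
  exists (interior B); first exact: open_interior.
  apply/seteqP; split => x [Ax Bx]; split=> //; last exact: interior_subset.
  exact/F/subset_closure.
exists (closure B); first exact: closed_closure.
apply/seteqP; split => x [Ax Bx]; split=> //; first exact: subset_closure.
by apply: interior_subset; exact: F.
Qed.

(** The conditions are imposed one after the other, each on a smaller nonempty open
    set. *)
Lemma generic_point (I : eqType) (s : seq I) (Q : I -> E -> Prop) Y :
  open Y -> Y !=set0 ->
  (forall i Y', open Y' -> Y' !=set0 -> Y' `<=` Y ->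
     exists2 y, Y' y & \forall x \near y, Q i x) ->
  exists2 y, Y y & forall i, i \in s -> Q i y.
Proof.
move=> oY Y0 QY.
suff : exists Y', [/\ open Y', Y' !=set0, Y' `<=` Y &
    forall y, Y' y -> forall i, i \in s -> Q i y].
  by move=> [Y' [_ [y Y'y] Y'Y Y'Q]]; exists y; [exact: Y'Y|exact: Y'Q].
elim: s => [|i s [Y' [oY' Y'0 Y'Y Y'Q]]]; first by exists Y; split.
have [y Y'y Qy] := QY i _ oY' Y'0 Y'Y.
exists (Y' `&` interior (Q i)); split.
- by apply: openI => //; exact: open_interior.
- by exists y; split.
- by move=> x [/Y'Y].
- move=> x [Y'x Qx] j; rewrite inE => /predU1P[->|]; last exact: Y'Q.
  exact: interior_subset Qx.
Qed.

(** Closed pieces of finitely many hyperplanes, none of which fills its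
    hyperplane around any of its points, do not separate a convex open set. If
    [h] is a point of the piece [P i] on the segment from [z] to [y], then [h]
    can be moved inside the hyperplane out of [P i]; the endpoint [y] follows by
    the central projection from [z], and the new segment cannot meet the
    hyperplane a second time, since [z] is off it. *)
Lemma generic_segment (I : finType) (nu : I -> E) (k : I -> R) (P : I -> set E)
    U Y Z :
  (forall x y, U x -> U y -> segment x y `<=` U) ->
  open Y -> Y !=set0 -> Y `<=` U -> open Z -> Z !=set0 -> Z `<=` U ->
  (forall i, nu i != 0) ->
  (forall i, closed (P i)) ->
  (forall i, P i `<=` [set x | dotv (nu i) x = k i]) ->
  (forall i h, U h -> P i h -> forall e, 0 < e ->
     exists h', [/\ dotv (nu i) h' = k i, `|h' - h| < e & ~ P i h']) ->
  exists y z, [/\ Y y, Z z & forall i, segment z y `&` P i = set0].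
Proof.
move=> convU oY Y0 YU oZ Z0 ZU nu0 clP PH thin.
have [z Zz zH] : exists2 z, Z z & forall i, i \in enum I -> dotv (nu i) z <> k i.
  apply: generic_point => // i Z' oZ' [z Z'z] _.
  have [z' Z'z' z'k] : exists2 z', Z' z' & dotv (nu i) z' <> k i.
    have [zk|zk] := pselect (dotv (nu i) z = k i); last by exists z.
    have : \forall t \near 0^', t != 0 /\ Z' (z + t *: nu i).
      near=> t; split; first by near: t; exact: nbhs_dnbhs_neq.
      by near: t; apply: nbhs_dnbhs; exact: near_line.
    move=> /filter_ex[t [t0 Z't]]; exists (z + t *: nu i) => //.
    rewrite dotvDr zk dotvZr => /eqP; rewrite -subr_eq0 addrAC subrr add0r.
    by rewrite mulf_eq0 (negPf t0) dotvv_eq0 (negPf (nu0 i)).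
  exists z' => //; apply: (@continuous_dotv _ _ (nu i) z' (~` [set x | x = k i])).
  by apply: open_nbhs_nbhs; split => //; exact/closed_openC/closed_eq.
have [y Yy yP] : exists2 y, Y y & forall i, i \in enum I -> segment z y `&` P i = set0.
  apply: generic_point => // i Y' oY' [y Y'y] Y'Y.
  have [y' Y'y' y'P] : exists2 y', Y' y' & segment z y' `&` P i = set0.
    have [yP|/set0P[h [[t t01 th] Ph]]] := eqVneq (segment z y `&` P i) set0.
      by exists y.
    have zi : dotv (nu i) z <> k i by apply: zH; rewrite mem_enum.
    have t0 : t != 0.
      apply/eqP => t0; apply: zi.
      by have := PH _ _ Ph; rewrite -th t0 scale0r addr0.
    have Uh : U h by apply: (convU z y); [exact: ZU|exact/YU/Y'Y|exists t].
    have /nbhs_ballP[e /= e0 eY'] : nbhs y Y' by exact: open_nbhs_nbhs.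
    have te0 : 0 < `|t| * e by rewrite mulr_gt0// normr_gt0.
    have [h' [h'k h'h nPh']] := thin i h Uh Ph _ te0.
    pose y' := z + t^-1 *: (h' - z).
    exists y'.
      apply: eY'; rewrite -ball_normE/= distrC.
      have -> : y' - y = t^-1 *: (h' - h).
        by apply/rowP => l; rewrite /y' -th !mxE; field.
      by rewrite normrZ normfV mulrC ltr_pdivrMr ?normr_gt0// mulrC.
    rewrite -subset0 => _ [[s s01 <-] Ps]; apply: nPh'.
    have := PH _ _ Ps; rewrite /= /y' addrAC subrr add0r scalerA.
    rewrite dotvDr dotvZr dotvBr h'k => sk.
    have /eqP : (s / t - 1) * (k i - dotv (nu i) z) = 0.
      by rewrite mulrBl mul1r -[X in X - _ = _](addrK (dotv (nu i) z)) [_ + dotv _ _]addrC sk; ring.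
    rewrite mulf_eq0 => /orP[|]; rewrite subr_eq0 => /eqP; last first.
      by move=> e'; case: zi.
    move=> st; move: Ps; rewrite /y' addrAC subrr add0r scalerA st scale1r.
    by rewrite subrKC.
  exists y' => //.
  have /compact_near_coveringP cov := @segment_compact R 0 1.
  have : \forall x \near y', `[0, 1]%classic `<=` (fun t : R => ~ P i (z + t *: (x - z))).
    apply: (cov _ (nbhs y') (fun x (t : R) => ~ P i (z + t *: (x - z)))) => t t01.
    have nP : nbhs (z + t *: (y' - z)) (~` P i).
      apply: open_nbhs_nbhs; split; first exact: closed_openC.
      move=> Pt; suff : (segment z y' `&` P i) (z + t *: (y' - z)) by rewrite y'P.
      by split=> //; exists t.
    have cf : {for (t, y'), continuous (fun p : R * E => z + p.1 *: (p.2 - z))}.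
      apply: cvgD; first exact: cvg_cst.
      by apply: cvgZ; [exact: cvg_fst|apply: cvgB; [exact: cvg_snd|exact: cvg_cst]].
    exact: cf nP.
  apply: filterS => x h; rewrite -subset0 => _ [[s s01 <-] Ps].
  exact: h Ps.
by exists y, z; split => // i; apply: yP; rewrite mem_enum.
Unshelve. all: by end_near. Qed.

End segments.

(** * Lebesgue measure on row vectors *)

Section lebesgue_rV_theory.
Variables (R : realType) (m : nat).
Local Notation E := 'rV[R]_m.
Local Notation mu := (lebesgue_rV R m).
Implicit Types (A D U : set E) (f g : E -> R).

Lemma ball_rVE (x : E) e : 0 < e ->
  ball x e = [set y | forall i, `|x ord0 i - y ord0 i| < e].
Proof.
move=> e0; apply/seteqP; split => y; first by move=> [_ xy] i; exact: xy.
by move=> xy; split=> // i j; rewrite (ord1 i); exact: xy.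
Qed.

Lemma measurable_box (B : 'I_m -> set (measurableTypeR R)) :
  (forall i, measurable (B i)) -> measurable [set x : E | forall i, B i (x ord0 i)].
Proof.
move=> mB; rewrite [X in measurable X](_ : _ = \big[setI/setT]_(i < m)
    (@rV_coord R m i @^-1` B i)); last first.
  apply/seteqP; split=> x /=.
    by move=> Ax; elim/big_ind : _ => // i _; exact: Ax.
  by move=> + i; rewrite (bigD1 i)//= => -[].
apply: bigsetI_measurable => i _; rewrite -[X in measurable X]setTI.
exact: measurable_rV_coord.
Qed.

Lemma ballRE (x e : R) : [set y | `|x - y| < e] = `]x - e, x + e[%classic.
Proof.
apply/seteqP; split => y /=; rewrite in_itv/= ltr_norml => /andP[? ?];
  by apply/andP; split; lra.
Qed.

Lemma measurable_ball_rV (x : E) e : 0 < e -> measurable (ball x e).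
Proof.
move=> e0; rewrite ball_rVE//.
apply: (@measurable_box (fun i => [set y | `|x ord0 i - y| < e])) => i.
by rewrite ballRE; exact: measurable_itv.
Qed.

(** An open set is the union of the balls with rational data that it contains. *)
Lemma open_measurable_rV A : open A -> measurable A.
Proof.
move=> oA.
pose q2r (q : 'rV[rat]_m) : E := map_mx ratr q.
pose B (p : 'rV[rat]_m * nat) : set E :=
  if `[< ball (q2r p.1) p.2.+1%:R^-1 `<=` A >]
  then ball (q2r p.1) p.2.+1%:R^-1 else set0.
have -> : A = \bigcup_p B p.
  apply/seteqP; split => [x Ax|x [[q k] _]]; last first.
    by rewrite /B/=; case: asboolP => //; apply.
  have /nbhs_ballP[e /= e0 eA] : nbhs x A by exact: open_nbhs_nbhs.
  have [k ke] : exists k : nat, k.+1%:R^-1 < e / 2.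
    have e20 : 0 < e / 2 by rewrite divr_gt0.
    exact: filter_ex (near_infty_natSinv_lt (PosNum e20)).
  have k0 : 0 < k.+1%:R^-1 :> R by rewrite invr_gt0.
  have /choice[q qx] : forall i, exists q : rat, `|ratr q - x ord0 i| < k.+1%:R^-1.
    move=> i; have [|q] := @rat_in_itvoo R (x ord0 i - k.+1%:R^-1) (x ord0 i + k.+1%:R^-1).
      by move: (k.+1%:R^-1) k0 => r r0; lra.
    by rewrite in_itv/= => /andP[h1 h2]; exists q; move: (k.+1%:R^-1) h1 h2 => r h1 h2;
      rewrite ltr_norml; apply/andP; split; lra.
  exists (\row_i q i, k) => //; rewrite /B/=; case: asboolP => [_|[]].
    by rewrite ball_rVE// => i; rewrite !mxE.
  move=> y; rewrite ball_rVE// => qy; apply: eA; rewrite ball_rVE// => i.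
  have := qy i; have := qx i; rewrite !mxE distrC => h1 h2.
  rewrite -(subrK (ratr (q i)) (x ord0 i)) -addrA.
  apply: le_lt_trans (ler_normD _ _) _.
  by move: (k.+1%:R^-1) ke h1 h2 => r; lra.
apply: countable_bigcupT_measurable; first exact: countableP.
move=> p; rewrite /B; case: asboolP => _ //.
by apply: measurable_ball_rV; rewrite invr_gt0.
Qed.

Lemma closed_measurable_rV A : closed A -> measurable A.
Proof. by move/closed_openC/open_measurable_rV/measurableC; rewrite setCK. Qed.

Lemma open_continuous_measurable_fun_rV D f : open D ->
  (forall x, D x -> {for x, continuous f}) -> measurable_fun D f.
Proof.
move=> oD cf; apply: (measurability _ (measurable_realfun.RGenOpens.measurableE R)).
move=> _ [_ [a [b ->] <-]]; apply: open_measurable_rV.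
rewrite openE => x [Dx fx]; apply: filterI; first exact: open_nbhs_nbhs.
apply: (cf x Dx); apply: open_nbhs_nbhs; split => //.
Qed.

Lemma norm_coord_le (x : E) i : `|x ord0 i| <= `|x|.
Proof.
rewrite [leRHS]/Num.Def.normr/= mx_normrE.
exact: (le_bigmax _ (fun ij : 'I_1 * 'I_m => `|x ij.1 ij.2|) (ord0, i)).
Qed.

Lemma bounded_finite_measure A : measurable A -> bounded_set A -> (mu A < +oo)%E.
Proof.
move=> mA [M [_ /(_ (`|M| + 1))]].
rewrite (le_lt_trans (ler_norm _)) ?ltrDl// => /(_ isT) AM.
set r := `|M| + 1 in AM.
pose B (i : 'I_m) : set (measurableTypeR R) := `[- r, r]%classic.
apply: (@le_lt_trans _ _ (mu [set x | forall i, B i (x ord0 i)])).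
  apply: le_measure; rewrite ?inE//.
    by apply: measurable_box => i; exact: measurable_itv.
  move=> x Ax i; rewrite /B/= in_itv/= -ler_norml.
  exact: le_trans (norm_coord_le x i) (AM x Ax).
rewrite lebesgue_rV_box => [|i]; last exact: measurable_itv.
rewrite ltey_eq; apply/orP; left.
apply: (@big_ind _ (fun x => x \is a fin_num)) => //= [|i _]; first exact: fin_numM.
by rewrite lebesgue_measure_itv/=; case: ifP => _ //; rewrite -EFinB.
Qed.

Lemma open_gt0_measure U : open U -> U !=set0 -> (0 < mu U)%E.
Proof.
move=> oU [x Ux].
have /nbhs_ballP[e /= e0 eU] : nbhs x U by exact: open_nbhs_nbhs.
apply: (@lt_le_trans _ _ (mu (ball x e))); last first.
  apply: le_measure; rewrite ?inE//; first exact: measurable_ball_rV.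
  exact: open_measurable_rV.
rewrite ball_rVE// (lebesgue_rV_box (A := fun i => [set y | `|x ord0 i - y| < e])).
  apply: (@big_ind _ (fun x => 0 < x)%E) => //=.
    by move=> a b a0 b0; rewrite mule_gt0.
  move=> i _; rewrite ballRE lebesgue_measure_itv/= lte_fin ifT ?lte_fin; lra.
by move=> i; rewrite ballRE; exact: measurable_itv.
Qed.

Lemma Rintegral_gt0 D f U e : measurable D -> mu.-integrable D (EFin \o f) ->
  (forall x, D x -> 0 <= f x) -> open U -> U !=set0 -> U `<=` D ->
  0 < e -> (forall x, U x -> e <= f x) -> 0 < \int[mu]_(x in D) f x.
Proof.
move=> mD intf f0 oU U0 UD e0 ef.
have mU := open_measurable_rV oU.
rewrite /Rintegral -lte_fin fineK; last exact: integrable_fin_num.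
have mf := measurable_int _ intf.
apply: (@lt_le_trans _ _ (\int[mu]_(x in U) (f x)%:E)%E); last first.
  by apply: ge0_subset_integral => // x Dx; rewrite lee_fin f0.
apply: (@lt_le_trans _ _ (\int[mu]_(x in U) (cst e%:E x))%E).
  by rewrite integral_cst// mule_gt0// open_gt0_measure.
apply: ge0_le_integral => //.
- by move=> x _; rewrite lee_fin ltW.
- exact: measurable_funS mf.
Qed.

End lebesgue_rV_theory.

(** * Reference cells *)

Section reference_cells.
Variable R : realType.

Lemma polyfun_shape_fun k m (a : node k m) : polyfun (@shape_fun R k m a).
Proof.
case: k a => a; rewrite /shape_fun.
  case: (unlift ord0 a) => [i|]; first exact: polyfun_coord.
  apply: polyfunB; first exact: polyfun_cst.
  by apply: polyfun_sum => i; exact: polyfun_coord.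
apply: polyfun_prod => i /=; case: ((a : {ffun _ -> bool}) i).
  exact: polyfun_coord.
by apply: polyfunB; [exact: polyfun_cst|exact: polyfun_coord].
Qed.

Lemma sum_shape_fun k m (x : 'rV[R]_m) : \sum_(a : node k m) shape_fun a x = 1.
Proof.
case: k => /=.
  rewrite big_ord_recl/= unlift_none.
  by under [X in _ + X]eq_bigr do rewrite liftK; rewrite subrK.
rewrite -(bigA_distr_bigA (fun i (b : bool) => if b then x ord0 i else 1 - x ord0 i)).
by rewrite big1// => i _; rewrite big_bool/= subrKC.
Qed.

Lemma simplexP m (x : 'rV[R]_m) :
  ref_cell Simplex m x <-> forall a : node Simplex m, 0 <= shape_fun a x.
Proof.
split=> [[x0 x1] a|x0]; first by rewrite /=; case: (unlift ord0 a) => // ; rewrite subr_ge0.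
split=> [i|]; first by have := x0 (lift ord0 i); rewrite /= liftK.
by have := x0 ord0; rewrite /= unlift_none subr_ge0.
Qed.

Lemma shape_fun_ge0 k m (a : node k m) (x : 'rV[R]_m) :
  ref_cell k m x -> 0 <= shape_fun a x.
Proof.
case: k a => [a /simplexP|a /= x01]; first exact.
apply: prodr_ge0 => i _; have /andP[x0 x1] := x01 i.
by case: ((a : {ffun _ -> bool}) i) => //; rewrite subr_ge0.
Qed.

Definition ref_int k m : set 'rV[R]_m :=
  match k with
  | Simplex => [set x | (forall i, 0 < x ord0 i) /\ \sum_i x ord0 i < 1]
  | Cube => [set x | forall i, 0 < x ord0 i < 1]
  end.
Arguments ref_int : clear implicits.

Lemma ref_int_sub k m : ref_int k m `<=` ref_cell k m.
Proof.
case: k => x /=; first by move=> [x0 x1]; split => [i|]; exact: ltW.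
by move=> x01 i; have /andP[x0 x1] := x01 i; rewrite !ltW.
Qed.

Lemma open_polyfun_gt0 m (f : 'rV[R]_m -> R) :
  polyfun f -> open [set x | 0 < f x].
Proof.
move=> pf; apply: (@open_comp _ _ f [set y | 0 < y]); last exact: open_gt.
by move=> x _; exact: polyfun_continuous.
Qed.

Lemma open_ref_int k m : open (ref_int k m).
Proof.
have open_forall (P : 'I_m -> set 'rV[R]_m) : (forall i, open (P i)) ->
    open [set x | forall i, P i x].
  move=> oP; rewrite (_ : mkset _ = \big[setI/setT]_(i < m) P i).
    by apply: (@big_ind _ (@open 'rV[R]_m)) => //; [exact: openT|exact: openI].
  apply/seteqP; split=> x /=.
    by move=> Ax; elim/big_ind : _ => // i _; exact: Ax.
  by move=> + i; rewrite (bigD1 i)//= => -[].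
case: k => /=.
  apply: openI; first by apply: open_forall => i; exact/open_polyfun_gt0/polyfun_coord.
  rewrite [X in open X](_ : _ = [set x : 'rV[R]_m | 0 < 1 - \sum_i x ord0 i]).
    apply: open_polyfun_gt0; apply: polyfunB; first exact: polyfun_cst.
    by apply: polyfun_sum => i; exact: polyfun_coord.
  by apply/seteqP; split => x /=; rewrite subr_gt0.
apply: open_forall => i.
rewrite [X in open X](_ : _ = [set x : 'rV[R]_m | 0 < x ord0 i] `&` [set x | 0 < 1 - x ord0 i]).
  apply: openI; apply: open_polyfun_gt0; first exact: polyfun_coord.
  by apply: polyfunB; [exact: polyfun_cst|exact: polyfun_coord].
by apply/seteqP; split => x /=; rewrite subr_gt0 => /andP.
Qed.

Lemma closed_ref_cell k m : closed (@ref_cell R k m).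
Proof.
(* the reference cell is cut out by inequalities between polynomial functions *)
have ->: @ref_cell R k m = \bigcap_(f in [set f | polyfun f /\
    forall x, ref_cell k m x -> 0 <= f x]) [set x | 0 <= f x].
  apply/seteqP; split => [x rx f [_]|x]; first exact.
  case: k => /= h.
    split=> [i|]; first by apply: (h (fun x => x ord0 i)); split;
      [exact: polyfun_coord|move=> y []].
    rewrite -subr_ge0; apply: (h (fun x => 1 - \sum_i x ord0 i)); split.
      apply: polyfunB; first exact: polyfun_cst.
      by apply: polyfun_sum => i; exact: polyfun_coord.
    by move=> y []; rewrite subr_ge0.
  move=> i; apply/andP; split.
    apply: (h (fun x => x ord0 i)); split; first exact: polyfun_coord.
    by move=> y /(_ i)/andP[].
  rewrite -subr_ge0; apply: (h (fun x => 1 - x ord0 i)); split.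
    by apply: polyfunB; [exact: polyfun_cst|exact: polyfun_coord].
  by move=> y /(_ i)/andP[]; rewrite subr_ge0.
apply: closed_bigI => f [pf _].
apply: (@closed_comp _ _ f [set y | 0 <= y]); last exact: closed_ge.
by move=> x _; exact: polyfun_continuous.
Qed.

Lemma bounded_ref_cell k m : bounded_set (@ref_cell R k m).
Proof.
exists 1; split=> // M M1 x rx /=; apply: le_trans (ltW M1).
rewrite [leLHS]/Num.Def.normr/= mx_normrE; apply: bigmax_le => // -[i j] _ /=.
rewrite (ord1 i).
have : 0 <= x ord0 j <= 1.
  case: k rx => /=; last exact.
  move=> [x0 x1]; rewrite x0/=; apply: le_trans x1.
  by rewrite (bigD1 j)//= lerDl sumr_ge0.
by move=> /andP[? ?]; rewrite ger0_norm.
Qed.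

Lemma compact_ref_cell k m : compact (@ref_cell R k m).
Proof.
by apply: bounded_closed_compact; [exact: bounded_ref_cell|exact: closed_ref_cell].
Qed.

Lemma ref_int_mix k m (x y : 'rV[R]_m) t : ref_cell k m x -> ref_int k m y ->
  0 < t <= 1 -> ref_int k m (x + t *: (y - x)).
Proof.
have mix (p q : R) : 0 <= p -> 0 < q -> 0 < t <= 1 -> 0 < p + t * (q - p).
  move=> p0 q0 /andP[t0 t1]; rewrite (_ : _ + _ = (1 - t) * p + t * q); last by ring.
  by rewrite ltr_wpDl ?mulr_gt0// mulr_ge0// subr_ge0.
case: k => /= [[x0 x1] [y0 y1]|x01 y01] t01.
  split=> [i|]; first by rewrite !mxE mix.
  have := mix (1 - \sum_i x ord0 i) (1 - \sum_i y ord0 i).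
  rewrite subr_ge0 subr_gt0 => /(_ x1 y1 t01).
  under [in X in _ -> X]eq_bigr do rewrite !mxE.
  by rewrite big_split/= -mulr_sumr sumrB; lra.
move=> i; rewrite !mxE; have /andP[x0 x1] := x01 i; have /andP[y0 y1] := y01 i.
rewrite mix//=; have := mix (1 - x ord0 i) (1 - y ord0 i).
by rewrite subr_ge0 subr_gt0 => /(_ x1 y1 t01); lra.
Qed.

Lemma ref_int_neq0 k m : ref_int k m !=set0.
Proof.
case: k => /=; last first.
  by exists (\row_i 2^-1) => i; rewrite mxE; lra.
exists (\row_i (m.+1%:R)^-1); split=> [i|]; first by rewrite mxE invr_gt0.
under eq_bigr do rewrite mxE.
rewrite sumr_const card_ord -[X in X < _]mulr_natl ltr_pdivrMr// mul1r ltr_nat.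
by rewrite ltnS.
Qed.

Lemma ref_int_dense k m (x : 'rV[R]_m) (O : set 'rV[R]_m) :
  ref_cell k m x -> open O -> O x -> O `&` ref_int k m !=set0.
Proof.
move=> rx oO Ox; have [c ci] := ref_int_neq0 k m.
have /nbhs_ballP[e /= e0 eO] := near_line (c - x) oO Ox.
pose t := Num.min (e / 2) 1.
exists (x + t *: (c - x)); split; last first.
  apply: ref_int_mix => //; rewrite /t lt_min ge_min lexx orbT andbT.
  by rewrite divr_gt0// ltr01.
apply: eO; rewrite -ball_normE/= sub0r normrN ger0_norm.
  by rewrite /t gt_min; apply/orP; left; lra.
by rewrite /t le_min ler01 andbT; lra.
Qed.

End reference_cells.
Arguments ref_int {R} k m.

Section facets.
Variable R : realType.

Lemma facet_node_inj k m (f : facet k m) : injective (facet_node f).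
Proof.
case: k f => f a b /=; first exact: lift_inj.
move=> /ffunP ab; apply/ffunP => i; have := ab (lift f.1 i).
by rewrite !ffunE liftK.
Qed.

(** Affine parametrization of a facet by the reference cell of lower dimension,
    chosen so that the shape functions of the nodes of the facet restrict to the
    shape functions of that cell. *)
Definition facet_emb k m (f : facet k m) : 'rV[R]_m -> 'rV[R]_m.+1 :=
  match k return facet k m -> _ with
  | Simplex => fun f x =>
      \row_i (if unlift f (lift ord0 i) is Some a
              then @shape_fun R Simplex m a x else 0)
  | Cube => fun f x =>
      \row_i (if unlift f.1 i is Some j then x ord0 j else f.2%:R)
  end f.

Lemma shape_fun_facet_simplex m (f : facet Simplex m) (b : node Simplex m.+1)
    (x : 'rV[R]_m) :
  shape_fun b (facet_emb f x) =
  if unlift (f : 'I_m.+2) b is Some a then @shape_fun R Simplex m a x else 0.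
Proof.
rewrite {1}/shape_fun; have [j ->|->] := unliftP ord0 b; first by rewrite mxE.
pose g (b : 'I_m.+2) := if unlift (f : 'I_m.+2) b is Some a
  then @shape_fun R Simplex m a x else 0.
suff : \sum_b g b = 1.
  rewrite big_ord_recl => /eqP; rewrite eq_sym -subr_eq => /eqP g0.
  rewrite -[RHS]/(g ord0) -g0; congr (_ - _).
  by apply: eq_bigr => i _; rewrite mxE.
rewrite (bigD1_ord f)//= {1}/g unlift_none add0r -[RHS](@sum_shape_fun R Simplex m x).
by apply: eq_bigr => i _; rewrite /g liftK.
Qed.

Lemma shape_fun_facet_node k m (f : facet k m) (a : node k m) (x : 'rV[R]_m) :
  shape_fun (facet_node f a) (facet_emb f x) = shape_fun a x.
Proof.
case: k f a => f a; first by rewrite shape_fun_facet_simplex liftK.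
rewrite /= (bigD1_ord f.1)//= ffunE unlift_none !mxE unlift_none.
rewrite (_ : (if f.2 then _ else _) = 1) ?mul1r; last by case: f.2; rewrite ?subr0.
by apply: eq_bigr => i _; rewrite ffunE liftK !mxE liftK.
Qed.

Lemma shape_fun_off_facet k m (f : facet k m) (b : node k m.+1) (x : 'rV[R]_m) :
  ~~ on_facet f b -> shape_fun b (facet_emb f x) = 0.
Proof.
case: k f b => f b nb.
  rewrite shape_fun_facet_simplex; case: unliftP => // a ba.
  by move: nb; rewrite /on_facet ba (codom_f (facet_node (f : facet Simplex m))).
rewrite /= (bigD1 f.1)//= !mxE unlift_none.
rewrite (_ : (if _ then _ else _) = 0) ?mul0r//.
have : (b : {ffun _ -> bool}) f.1 != f.2.
  apply: contra nb => /eqP bf; apply/codomP.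
  exists [ffun j => (b : {ffun _ -> bool}) (lift f.1 j)]; apply/ffunP => i.
  by rewrite !ffunE; case: unliftP => [j ->|->]; rewrite ?ffunE.
by case: ((b : {ffun _ -> bool}) f.1); case: f.2 => //; rewrite subrr.
Qed.

Lemma facet_emb_affine k m (f : facet k m) (x v : 'rV[R]_m) (t : R) :
  facet_emb f (x + t *: v) =
  facet_emb f x + t *: (facet_emb f v - facet_emb f 0).
Proof.
apply/rowP => i; case: k f => f; rewrite !mxE.
  case: (unlift _ _) => [a|]; last by ring.
  rewrite /shape_fun; case: (unlift ord0 a) => [j|]; first by rewrite !mxE; ring.
  under [in LHS]eq_bigr do rewrite !mxE.
  rewrite big_split/= -mulr_sumr [X in _ - (1 - X)]big1; first by ring.
  by move=> j _; rewrite mxE.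
by case: (unlift _ _) => [a|]; rewrite ?mxE; ring.
Qed.

Lemma facet_emb_inj k m (f : facet k m) : injective (facet_emb f).
Proof.
case: k f => f x y xy; apply/rowP => i; last first.
  by move/rowP/(_ (lift f.1 i)) : xy; rewrite !mxE liftK.
have := @shape_fun_facet_node Simplex m f (lift ord0 i) x.
have := @shape_fun_facet_node Simplex m f (lift ord0 i) y.
by rewrite xy /= liftK => -> ->.
Qed.

Lemma facet_emb_ref k m (f : facet k m) (x : 'rV[R]_m) :
  ref_cell k m x -> ref_cell k m.+1 (facet_emb f x).
Proof.
case: k f => f rx.
  apply/simplexP => b; rewrite shape_fun_facet_simplex.
  by case: (unlift _ _) => // a; exact: shape_fun_ge0.
move=> i; rewrite !mxE; case: (unlift _ _) => [j|]; first exact: rx.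
by case: f.2; rewrite /= ?lexx ?ler01.
Qed.

(** On the boundary of the simplex the barycentric coordinate of some node [f]
    vanishes; on the boundary of the cube some coordinate is 0 or 1. *)
Lemma ref_boundary k m (x : 'rV[R]_m.+1) :
  ref_cell k m.+1 x -> ~ ref_int k m.+1 x ->
  exists (f : facet k m) (y : 'rV[R]_m), ref_cell k m y /\ x = facet_emb f y.
Proof.
case: k => rx nx.
  have [f f0] : exists f : 'I_m.+2, @shape_fun R Simplex m.+1 f x = 0.
    apply: contrapT => nf; apply: nx; split=> [i|].
      rewrite lt_neqAle rx.1 andbT eq_sym; apply/eqP => xi; apply: nf.
      by exists (lift ord0 i); rewrite /= liftK.
    rewrite lt_neqAle rx.2 andbT; apply/eqP => xi; apply: nf.
    by exists ord0; rewrite /= unlift_none xi subrr.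
  pose y : 'rV[R]_m := \row_j @shape_fun R Simplex m.+1 (lift f (lift ord0 j)) x.
  have yE (a : node Simplex m) : shape_fun a y = @shape_fun R Simplex m.+1 (lift f a) x.
    rewrite {1}/shape_fun; have [j ->|->] := unliftP ord0 a; first by rewrite mxE.
    pose g (b : 'I_m.+2) := @shape_fun R Simplex m.+1 b x.
    have : \sum_b g b = 1 by exact: (@sum_shape_fun R Simplex m.+1 x).
    rewrite (bigD1_ord f)//= {1}/g f0 add0r big_ord_recl => /eqP.
    rewrite eq_sym -subr_eq => /eqP y0; rewrite -[RHS]y0; congr (_ - _).
    by apply: eq_bigr => i _; rewrite mxE.
  exists f, y; split.
    by apply/simplexP => a; rewrite yE; exact: shape_fun_ge0.
  apply/rowP => i; rewrite mxE.
  have -> : x ord0 i = @shape_fun R Simplex m.+1 (lift ord0 i) x by rewrite /= liftK.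
  by case: unliftP => [a ->|->//]; rewrite yE.
have [i [b xb]] : exists i, exists b : bool, x ord0 i = b%:R.
  apply: contrapT => nf; apply: nx => i; have /andP[x0 x1] := rx i.
  rewrite !lt_neqAle x0 x1 !andbT; apply/andP; split; apply/eqP => xi; apply: nf.
    by exists i, false.
  by exists i, true.
exists (i, b), (\row_j x ord0 (lift i j)); split=> [j|]; first by rewrite mxE; exact: rx.
by apply/rowP => l; rewrite mxE /=; case: unliftP => [j ->|->]; rewrite ?mxE.
Qed.

End facets.

Section cell_maps.
Variables (R : realType) (d : nat) (k : cell_kind).

Lemma cell_mapE m (p : node k m -> 'rV[R]_d) x j :
  cell_map p x ord0 j = \sum_a shape_fun a x * p a ord0 j.
Proof. by rewrite summxE; apply: eq_bigr => a _; rewrite mxE. Qed.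

Lemma polyfun_cell_map m (p : node k m -> 'rV[R]_d) j :
  polyfun (fun x => cell_map p x ord0 j).
Proof.
rewrite (_ : (fun x => _) = fun x => \sum_a shape_fun a x * p a ord0 j).
  apply: polyfun_sum => a; apply: polyfunM; first exact: polyfun_shape_fun.
  exact: polyfun_cst.
by apply/funext => x; exact: cell_mapE.
Qed.

Lemma rV_continuous (T : topologicalType) (g : T -> 'rV[R]_d) x :
  (forall j, {for x, continuous (fun y => g y ord0 j)}) -> {for x, continuous g}.
Proof.
move=> cg; apply/cvg_ballP => e e0; near=> y; rewrite ball_rVE//.
near: y; apply: filter_forall => j.
by move/cvg_ballP : (cg j) => /(_ e e0).
Unshelve. all: by end_near. Qed.

Lemma continuous_cell_map m (p : node k m -> 'rV[R]_d) : continuous (cell_map p).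
Proof.
by move=> x; apply: rV_continuous => j; exact/polyfun_continuous/polyfun_cell_map.
Qed.

Lemma dotv_cell_map m (p : node k m -> 'rV[R]_d) (nu : 'rV[R]_d) x :
  dotv nu (cell_map p x) = \sum_a shape_fun a x * dotv nu (p a).
Proof.
rewrite dotvE; under eq_bigr do rewrite cell_mapE mulr_sumr.
rewrite exchange_big/=; apply: eq_bigr => a _; rewrite dotvE mulr_sumr.
by apply: eq_bigr => j _; rewrite mulrCA.
Qed.

(** The surface integrals are thus expressed through the element map, whose
    jacobian is known to be invertible. *)
Lemma cell_map_facet m (p : node k m.+1 -> 'rV[R]_d) (f : facet k m) x :
  cell_map (fun a => p (facet_node f a)) x = cell_map p (facet_emb f x).
Proof.
rewrite /cell_map [RHS](bigID (on_facet f))/= [X in _ + X]big1 ?addr0; last first.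
  by move=> b nb; rewrite shape_fun_off_facet// scale0r.
apply/esym; rewrite (@reindex_omap _ _ _ _ _ (facet_node f)
    (fun b => [pick a | facet_node f a == b])).
  apply: eq_big => [a|a _]; last by rewrite shape_fun_facet_node.
  rewrite /on_facet codom_f/=; case: pickP => [l /eqP/facet_node_inj ->|/(_ a)].
    by rewrite eqxx.
  by rewrite eqxx.
move=> b /codomP[a ->]; case: pickP => [l /eqP /= ->//|/(_ a)].
by rewrite eqxx.
Qed.

Lemma cell_map_differentiable m (p : node k m -> 'rV[R]_d) x :
  differentiable (cell_map p) x.
Proof.
rewrite (_ : cell_map p = fun x => \sum_a shape_fun a x *: p a)//.
have h (r : seq (node k m)) :
    differentiable (fun x => \sum_(a <- r) shape_fun a x *: p a) x.
  elim: r => [|a r ih].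
    rewrite (_ : (fun x => _) = cst 0); first exact: differentiable_cst.
    by apply/funext => y; rewrite big_nil.
  rewrite (_ : (fun x => _) =
      (fun x => shape_fun a x *: p a + \sum_(a <- r) shape_fun a x *: p a)).
    apply: differentiableD => //.
    apply: differentiableZl; exact/polyfun_differentiable/polyfun_shape_fun.
  by apply/funext => y; rewrite big_cons.
exact: h.
Qed.

Lemma mul_jacobian m (p : node k m -> 'rV[R]_d) x v j :
  (v *m jacobian (cell_map p) x) ord0 j = 'D_v (fun y => cell_map p y ord0 j) x.
Proof.
have df := cell_map_differentiable p x.
rewrite /jacobian mul_rV_lin1/= -deriveE// derive_mx; first by rewrite mxE.
exact: diff_derivable.
Qed.

Lemma jacobianE m (p : node k m -> 'rV[R]_d) x i j :
  jacobian (cell_map p) x i j =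
  'D_(delta_mx ord0 i) (fun y => cell_map p y ord0 j) x.
Proof. by rewrite -mul_jacobian -rowE [RHS]mxE. Qed.

Lemma polyfun_jacobian m (p : node k m -> 'rV[R]_d) i j :
  polyfun (fun x => jacobian (cell_map p) x i j).
Proof.
rewrite (_ : (fun x => _) = 'D_(delta_mx ord0 i) (fun y => cell_map p y ord0 j)).
  exact/polyfun_derive/polyfun_cell_map.
by apply/funext => x; exact: jacobianE.
Qed.

Lemma polyfun_det m n (M : 'rV[R]_m -> 'M[R]_n) :
  (forall i j, polyfun (fun x => M x i j)) -> polyfun (fun x => \det (M x)).
Proof.
move=> pM; apply: polyfun_sum => s; apply: polyfunM; first exact: polyfun_cst.
exact: polyfun_prod.
Qed.

End cell_maps.

(** * Regular elements *)

Section polynomial_minimum.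
Variables (R : realType) (m : nat).
Implicit Types (f g : 'rV[R]_m -> R) (x v : 'rV[R]_m).

(** By Hadamard's lemma [f (x + t *: v) - f x = t * psi t] with [psi] continuous and
    [psi 0] the derivative; at a minimum [t * psi t] is nonnegative for small [t] of
    both signs. *)
Lemma polyfun_local_min f x v : polyfun f ->
  (\forall y \near x, f x <= f y) -> 'D_v f x = 0.
Proof.
move=> pf fmin; have [D pD fD] := polyfun_hadamard x pf.
rewrite (hadamard_derive v pf pD fD).
pose psi (t : R) := \sum_j v ord0 j * D j (x + t *: v).
have psi0 : \sum_j v ord0 j * D j x = psi 0 by rewrite /psi scale0r addr0.
have cpsi : {for 0, continuous psi}.
  have pc : polyfun (fun y => \sum_j v ord0 j * D j y).
    by apply: polyfun_sum => j; apply: polyfunM => //; exact: polyfun_cst.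
  exact: (continuous_comp (@continuous_line _ _ x v 0) (@polyfun_continuous _ _ _ pc _)).
have psi_ge0 : \forall t \near (0 : R), 0 <= t * psi t.
  have : nbhs (0 : R) ((fun t => x + t *: v) @^-1` [set y | f x <= f y]).
    by apply: (@continuous_line _ _ x v (0 : R)); rewrite /= scale0r addr0.
  apply: filterS => t /=.
  rewrite (fD (x + t *: v)) lerDl addrAC subrr add0r mulr_sumr.
  by under eq_bigr do rewrite mxE -mulrA.
rewrite psi0; apply/eqP; apply: contraT => psi_neq0.
have npsi0 : 0 < `|psi 0| by rewrite normr_gt0.
have /nbhs_ballP[e /= e0 eP] : \forall t \near (0 : R),
    `|psi 0 - psi t| < `|psi 0| /\ 0 <= t * psi t.
  by apply: filterI => //; move/cvgrPdist_lt : cpsi; exact.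
have be t : `|t| < e -> ball (0 : R) e t by rewrite -ball_normE/= sub0r normrN.
have [] := eP (e / 2); first by apply: be; rewrite ger0_norm; lra.
have [] := eP (- (e / 2)); first by apply: be; rewrite normrN ger0_norm; lra.
rewrite mulNr oppr_ge0 pmulr_rle0 ?divr_gt0// pmulr_rge0 ?divr_gt0//.
rewrite !ltr_norml => /andP[h1 h2] h3 /andP[h4 h5] h6.
move: h1 h2 h4 h5; case: (ltgtP (psi 0) 0) psi_neq0 => // h _.
  by rewrite ltr0_norm// => *; lra.
by rewrite gtr0_norm// => *; lra.
Qed.

Lemma derive_sum_fun I (r : seq I) (h : I -> 'rV[R]_m -> R) x v :
  (forall i, polyfun (h i)) ->
  'D_v (fun y => \sum_(i <- r) h i y) x = \sum_(i <- r) 'D_v (h i) x.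
Proof.
move=> ph; elim: r => [|i r ih].
  rewrite big_nil (_ : (fun y => _) = cst 0) ?derive_cst//.
  by apply/funext => y; rewrite big_nil.
rewrite big_cons -ih -deriveD; [|exact: polyfun_derivable..|].
  by congr ('D_v _ x); apply/funext => y; rewrite big_cons.
by apply: polyfun_derivable; exact: polyfun_sum.
Qed.

Lemma polyfun_derive0_cst f x y : polyfun f ->
  (forall z, segment x y z -> 'D_(y - x) f z = 0) -> f y = f x.
Proof.
move=> pf f0; pose h (t : R) := f (x + t *: (y - x)).
have hd (t : R) : t \in `]0, 1[ -> is_derive t 1 h (cst 0 t).
  rewrite in_itv/= => /andP[t0 t1].
  pose z := x + t *: (y - x).
  have hE : (fun s : R => s^-1 *: (h (s *: (1 : R) + t) - h t)) =
      (fun s : R => s^-1 *: (f (s *: (y - x) + z) - f z)).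
    apply/funext => s; rewrite /h /z [s *: 1]mulr1 scalerDl.
    by rewrite addrCA addrA [s *: _ + x]addrC.
  have fz : 'D_(y - x) f z = 0.
    by apply: f0; exists t => //=; rewrite in_itv/= !ltW.
  apply: DeriveDef; last by rewrite -[RHS]fz /derive -hE.
  by rewrite /derivable hE; exact: (@polyfun_derivable _ _ f z (y - x) pf).
have ch : {within `[0, 1], continuous h}.
  apply: continuous_subspaceT => t.
  exact: (continuous_comp (@continuous_line _ _ x (y - x) t) (@polyfun_continuous _ _ _ pf _)).
have [c _] := MVT_segment ler01 hd ch.
rewrite /h mul0r scale0r addr0 scale1r subrKC => /eqP.
by rewrite subr_eq0 => /eqP.
Qed.

End polynomial_minimum.

Lemma bounded_subset (R : realType) m (A B : set 'rV[R]_m) :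
  bounded_set B -> A `<=` B -> bounded_set A.
Proof.
by move=> [M [Mr BM]] AB; exists M; split=> // N MN x /AB; exact: (BM N MN).
Qed.

Section regular_elements.
Variables (R : realType) (k : cell_kind) (n : nat) (p : node k n.+1 -> 'rV[R]_n.+1).
Hypothesis hp : regular_element p.
Local Notation E := 'rV[R]_n.+1.
Local Notation F := (cell_map p).
Local Notation ref := (ref_cell k n.+1).
Let J := jacobian F.

Lemma off_facet_node (f : facet k n) : exists b : node k n.+1, ~~ on_facet f b.
Proof.
case: (k) f => f.
  exists f; apply/negP => /codomP[a /= fa].
  by have := neq_lift (f : 'I_n.+2) a; rewrite -fa eqxx.
exists [ffun => ~~ f.2]; apply/negP => /codomP[a /ffunP/(_ f.1)].
by rewrite !ffunE unlift_none; case: f.2.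
Qed.

(** The values of [F] are convex combinations of the vertices of the element, and
    on a facet, of the vertices of that facet. *)
Lemma facet_hyperplane (f : facet k n) : exists (nu : E) (c : R),
  [/\ nu != 0, forall y, cell p y -> dotv nu y <= c
    & forall x, dotv nu (F (facet_emb f x)) = c].
Proof.
have [_ _ /(_ f)[nu [c nuc]]] := hp; exists nu, c.
have le_c a : dotv nu (p a) <= c.
  by have := nuc a; case: ifP => _; [move=> ->|exact: ltW].
split.
- apply/eqP => nu0; have [b nb] := off_facet_node f.
  have [a] : exists a, on_facet f a.
    have [a] : exists a : node k n, true.
      case: (k) => /=; first by exists ord0.
      by exists [ffun => true].
    by exists (facet_node f a); exact: codom_f.
  move=> ha; have := nuc a; have := nuc b; rewrite ha (negPf nb) nu0.
  by rewrite !dotvE !big1 => [|i _|i _]; rewrite ?mxE ?mul0r// => /[swap] <-; rewrite ltxx.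
- move=> _ [x rx <-]; rewrite dotv_cell_map.
  rewrite -[leRHS]mul1r -(sum_shape_fun k x) mulr_suml; apply: ler_sum => a _.
  by rewrite ler_wpM2l// shape_fun_ge0.
- move=> x; rewrite -cell_map_facet dotv_cell_map.
  rewrite -[RHS]mul1r -(sum_shape_fun k x) mulr_suml; apply: eq_bigr => a _.
  by have := nuc (facet_node f a); rewrite /on_facet codom_f => ->.
Qed.

Lemma compact_cell : compact (cell p).
Proof.
apply: continuous_compact; last exact: compact_ref_cell.
exact/continuous_subspaceT/continuous_cell_map.
Qed.

Lemma closed_cell : closed (cell p).
Proof. by apply: compact_closed; [exact: norm_hausdorff|exact: compact_cell]. Qed.

Lemma cell_map_inj x y : ref x -> ref y -> F x = F y -> x = y.
Proof. by move=> rx ry; have [inj _ _] := hp; apply: inj; rewrite inE. Qed.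

(** The image of the compact set [ref `\` O] is closed and misses [F x]. *)
Lemma inverse_continuous x (O : set E) : ref x -> open O -> O x ->
  \forall y \near F x, forall x', ref x' -> F x' = y -> O x'.
Proof.
move=> rx oO Ox; pose C := ref `\` O.
have cC : compact (F @` C).
  apply: continuous_compact; first exact/continuous_subspaceT/continuous_cell_map.
  apply: bounded_closed_compact.
    exact: (bounded_subset (@bounded_ref_cell R k n.+1) (@subIsetl _ _ _)).
  by apply: closedI; [exact: closed_ref_cell|exact: open_closedC].
have : nbhs (F x) (~` (F @` C)).
  apply: open_nbhs_nbhs; split.
    by apply: closed_openC; apply: compact_closed => //; exact: norm_hausdorff.
  move=> [x' [rx' nOx'] xx']; apply: nOx'.
  by rewrite (cell_map_inj rx' rx xx').
apply: filterS => y Cy x' rx' xy; apply: contrapT => nO.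
by apply: Cy; exists x'.
Qed.

Lemma derive_sqr_dist y x v :
  'D_v (fun x => dotv (F x - y) (F x - y)) x =
  2 * dotv (v *m J x) (F x - y).
Proof.
have pF j : polyfun (fun x => F x ord0 j - y ord0 j).
  by apply: polyfunB; [exact: polyfun_cell_map|exact: polyfun_cst].
rewrite (_ : (fun x => _) = fun x => \sum_j (F x ord0 j - y ord0 j) * (F x ord0 j - y ord0 j)).
  rewrite derive_sum_fun => [|j]; last exact: polyfunM.
  rewrite dotvE mulr_sumr; apply: eq_bigr => j _.
  rewrite deriveM; [|exact: polyfun_derivable..].
  rewrite deriveB; [|exact/polyfun_derivable/polyfun_cell_map
    |exact/polyfun_derivable/polyfun_cst].
  by rewrite derive_cst subr0 mul_jacobian !mxE /GRing.scale/=; ring.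
by apply/funext => z; rewrite dotvE; apply: eq_bigr => j _; rewrite !mxE.
Qed.

(** A point [y] close to [F x0] is attained: on a small closed ball around [x0]
    the squared distance from [F x] to [y] is minimal at an interior point, as it
    is larger on the sphere than at [x0], and at this critical point the
    invertibility of the jacobian forces [F x = y]. *)
Lemma cell_map_open x0 : ref_int k n.+1 x0 -> (cell p)° (F x0).
Proof.
move=> ix0; have [inj det0 _] := hp.
have /nbhs_ballP[e /= e0 er] : nbhs x0 (ref_int k n.+1).
  by apply: open_nbhs_nbhs; split => //; exact: open_ref_int.
pose r := e / 2; have r0 : 0 < r by rewrite divr_gt0.
pose C := [set x : E | `|x - x0| <= r].
have Cr x : C x -> ref_int k n.+1 x.
  move=> Cx; apply: er; rewrite -ball_normE/= distrC; apply: le_lt_trans Cx _.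
  by rewrite /r; lra.
have cdist : continuous (fun x : E => `|x - x0|).
  have cs : continuous (fun x : E => x - x0).
    by move=> x; apply: (@continuousB _ _ _ id (cst x0) x); [exact: (fun A xA => xA)|exact: cst_continuous].
  by move=> x; exact: (continuous_comp (cs x) (@norm_continuous _ _ _)).
have bC : bounded_set C.
  exists (`|x0| + r); split=> [|M rM x Cx /=]; first exact: num_real.
  rewrite -(subrK x0 x).
  by apply: le_trans (ler_normD _ _) _; move: Cx rM; rewrite /C/=; lra.
have cC : compact C.
  apply: bounded_closed_compact => //.
  rewrite (_ : C = (fun x : E => `|x - x0|) @^-1` [set t | t <= r])//.
  by apply: closed_comp; [move=> x _; exact: cdist|exact: closed_le].
pose S := [set x : E | `|x - x0| = r].
have cS : compact S.
  apply: bounded_closed_compact.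
    by apply: (bounded_subset bC) => x Sx; rewrite /C/= Sx.
  rewrite (_ : S = (fun x : E => `|x - x0|) @^-1` [set t | t = r])//.
  by apply: closed_comp; [move=> x _; exact: cdist|exact: closed_eq].
have S0 : S !=set0.
  exists (x0 + r *: const_mx 1); rewrite /S/= addrAC subrr add0r normrZ ger0_norm ?ltW//.
  suff -> : `|const_mx 1 : E| = 1 by rewrite mulr1.
  apply/eqP; rewrite eq_le; apply/andP; split.
    rewrite [leLHS]/Num.Def.normr/= mx_normrE; apply: bigmax_le => // i _.
    by rewrite mxE normr1.
  by have := norm_coord_le (const_mx 1 : E) ord0; rewrite mxE normr1.
pose dist y x := dotv (F x - y) (F x - y).
have pdist y : polyfun (dist y).
  apply: polyfun_dotvv => j; rewrite (_ : (fun x => _) = fun x => F x ord0 j - y ord0 j).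
    by apply: polyfunB; [exact: polyfun_cell_map|exact: polyfun_cst].
  by apply/funext => x; rewrite !mxE.
have [s Ss smin] := compact_EVT_min S0 cS
  (continuous_subspaceT (polyfun_continuous (pdist (F x0)))).
rewrite inE in Ss; pose delta := dist (F x0) s.
have delta0 : 0 < delta.
  rewrite lt_neqAle dotvv_ge0 andbT eq_sym dotvv_eq0 subr_eq0.
  apply/eqP => /cell_map_inj sx0; have := Ss; rewrite /S/= sx0 ?subrr ?normr0.
  - by move=> r0'; move: r0; rewrite -r0' ltxx.
  - by apply: ref_int_sub; apply: Cr; rewrite /C/= Ss.
  - exact: ref_int_sub.
pose N := [set y : E | 0 < delta / 4 - dotv (y - F x0) (y - F x0)].
have pN : polyfun (fun y : E => delta / 4 - dotv (y - F x0) (y - F x0)).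
  apply: polyfunB; first exact: polyfun_cst.
  apply: (@polyfun_dotvv _ _ _ (fun y : E => y - F x0)) => j.
  rewrite (_ : (fun y => _) = fun y : E => y ord0 j - F x0 ord0 j).
    by apply: polyfunB; [exact: polyfun_coord|exact: polyfun_cst].
  by apply/funext => y; rewrite !mxE.
have : nbhs (F x0) N.
  apply: open_nbhs_nbhs; split; first exact: open_polyfun_gt0.
  rewrite /N/= subrr; have /eqP -> : dotv (0 : E) 0 == 0 by rewrite dotvv_eq0.
  by rewrite subr0 divr_gt0.
apply: filterS => y Ny.
have C0 : C !=set0 by exists x0; rewrite /C/= subrr normr0 ltW.
have [x Cx xmin] := compact_EVT_min C0 cC
  (continuous_subspaceT (polyfun_continuous (pdist y))).
rewrite inE in Cx.
have x0y : dist y x0 = dotv (y - F x0) (y - F x0).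
  rewrite /dist !dotvE; apply: eq_bigr => j _; rewrite !mxE; ring.
have nSx : ~ S x.
  move=> Sx; have := xmin x0; rewrite inE x0y => /(_ _).
  have Cx0 : C x0 by rewrite /C/= subrr normr0 ltW.
  move=> /(_ Cx0) min0.
  have := smin x; rewrite inE -/delta => /(_ Sx) deltax.
  have : dist (F x0) x <= 2 * dist y x + 2 * dotv (y - F x0) (y - F x0).
    rewrite /dist !dotvE !mulr_sumr -big_split/=; apply: ler_sum => j _.
    rewrite !mxE -subr_ge0; set u := F x ord0 j; set w := F x0 ord0 j; set z := y ord0 j.
    rewrite (_ : _ - _ = (u - 2 * z + w) ^+ 2) ?sqr_ge0//.
    by ring.
  by move: Ny; rewrite /N/=; lra.
have lt_r : `|x - x0| < r by rewrite lt_neqAle Cx andbT; apply/eqP.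
have grad0 v : dotv (v *m J x) (F x - y) = 0.
  have : 'D_v (dist y) x = 0.
    apply: polyfun_local_min => //.
    have : nbhs x [set z : E | `|z - x0| < r].
      apply: open_nbhs_nbhs; split => //.
      rewrite (_ : mkset _ = (fun z : E => `|z - x0|) @^-1` [set t | t < r])//.
      by apply: open_comp; [move=> z _; exact: cdist|exact: open_lt].
    by apply: filterS => z zr; apply: xmin; rewrite inE /C/= ltW.
  by rewrite derive_sqr_dist => /eqP; rewrite mulf_eq0 pnatr_eq0/= => /eqP.
have rx : ref x by apply: ref_int_sub; exact: Cr.
have uJ : J x \in unitmx by rewrite unitmxE unitfE; exact: det0.
exists x => //; apply/eqP; rewrite -subr_eq0 -dotvv_eq0.
by have := grad0 ((F x - y) *m invmx (J x)); rewrite mulmxKV// => ->.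
Qed.

(** The image of a boundary point lies on a supporting hyperplane of the element,
    and moving along the outer normal leaves the element. *)
Lemma interior_cell : (cell p)° = F @` ref_int k n.+1.
Proof.
apply/seteqP; split => [y yK|_ [x ix <-]]; last exact: cell_map_open.
have [x rx xy] := interior_subset yK.
exists x => //; apply: contrapT => nix.
have [f [x' [_ xE]]] := ref_boundary rx nix.
have [nu [c [nu0 le_c eq_c]]] := facet_hyperplane f.
have /nbhs_ballP[e /= e0 eK] := near_line nu (@open_interior _ (cell p)) yK.
have t0 : 0 < e / 2 by rewrite divr_gt0.
have /eK/interior_subset/le_c : ball (0 : R) e (e / 2).
  by rewrite -ball_normE/= sub0r normrN ger0_norm; lra.
rewrite dotvDr -xy xE eq_c dotvZr gerDl leNgt mulr_gt0//.
by rewrite lt_neqAle dotvv_ge0 andbT eq_sym dotvv_eq0.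
Qed.

End regular_elements.

Section element_gradient.
Variables (R : realType) (k : cell_kind) (n : nat) (p : node k n.+1 -> 'rV[R]_n.+1).
Hypothesis hp : regular_element p.
Local Notation E := 'rV[R]_n.+1.
Local Notation F := (cell_map p).
Local Notation ref := (ref_cell k n.+1).
Let J x := jacobian F x.

(** The derivative along [v], at the point [F x], of the function [q \o F^-1];
    Cramer's rule displays it as a quotient of polynomial functions of [x]. *)
Definition element_derive (q : E -> R) (v x : E) : R :=
  (\sum_i (v *m \adj (J x)) ord0 i * 'D_(delta_mx ord0 i) q x) / \det (J x).

Lemma polyfun_mul_adj (M : E -> 'M[R]_n.+1) (v : E) i :
  (forall i j, polyfun (fun x => M x i j)) ->
  polyfun (fun x => (v *m \adj (M x)) ord0 i).
Proof.
move=> pM; rewrite (_ : (fun x => _) = fun x => \sum_l v ord0 l * (\adj (M x)) l i).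
  apply: polyfun_sum => l; apply: polyfunM; first exact: polyfun_cst.
  rewrite (_ : (fun x => _) = fun x => cofactor (M x) i l); last first.
    by apply/funext => x; rewrite mxE.
  apply: polyfunM; first exact: polyfun_cst.
  apply: polyfun_det => a b.
  rewrite (_ : (fun x => _) = fun x => M x (lift i a) (lift l b))//.
  by apply/funext => x; rewrite !mxE.
by apply/funext => x; rewrite mxE.
Qed.

Lemma continuous_quotient (f g : E -> R) x : polyfun f -> polyfun g -> g x != 0 ->
  {for x, continuous (fun y => f y / g y)}.
Proof.
move=> pf pg gx; apply: (@continuousM R _ f (fun y => (g y)^-1) x).
  exact: polyfun_continuous.
by apply: (@continuousV R _ g x) => //; exact: polyfun_continuous.
Qed.

Lemma continuous_element_derive q v x : polyfun q -> ref x ->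
  {for x, continuous (element_derive q v)}.
Proof.
move=> pq rx; have [_ /(_ x rx) det0 _] := hp.
apply: continuous_quotient => //.
  apply: polyfun_sum => i; apply: polyfunM; last exact: polyfun_derive.
  by apply: polyfun_mul_adj; exact: polyfun_jacobian.
by apply: polyfun_det; exact: polyfun_jacobian.
Qed.

Lemma bounded_element_derive q v : polyfun q ->
  exists C, forall x, ref x -> `|element_derive q v x| <= C.
Proof.
move=> pq.
have [x0 ix0] := @ref_int_neq0 R k n.+1.
have cf : {within ref, continuous (fun x => `|element_derive q v x|)}.
  apply: continuous_in_subspaceT => x; rewrite inE => rx.
  apply: (@continuous_comp _ _ _ (element_derive q v) (@Num.norm R R)).
    exact: continuous_element_derive.
  exact: norm_continuous.
have [c _ cmax] := compact_EVT_max (ex_intro _ x0 (ref_int_sub ix0))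
  (@compact_ref_cell R k n.+1) cf.
by exists `|element_derive q v c| => x rx; apply: cmax; rewrite inE.
Qed.

(** The adjugate is invertible, so the gradient of [q] vanishes on the interior of
    the reference cell, which is convex and dense. *)
Lemma element_derive0 q : polyfun q ->
  (forall x i, ref_int k n.+1 x -> element_derive q (delta_mx ord0 i) x = 0) ->
  forall x y, ref x -> ref y -> q x = q y.
Proof.
move=> pq q0.
have dq0 x i : ref_int k n.+1 x -> 'D_(delta_mx ord0 i) q x = 0.
  move=> ix; have [_ /(_ x (ref_int_sub ix)) det0 _] := hp.
  pose g : 'cV[R]_n.+1 := \col_i 'D_(delta_mx ord0 i) q x.
  have ag : \adj (J x) *m g = 0.
    apply/colP => l; have := q0 x l ix; rewrite /element_derive -rowE => /eqP.
    rewrite mulf_eq0 invr_eq0 (negPf det0) orbF => /eqP e; rewrite [RHS]mxE -[RHS]e.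
    by rewrite mxE; apply: eq_bigr => j _; rewrite [row _ _ _ _]mxE [g _ _]mxE.
  have : J x *m (\adj (J x) *m g) = 0 by rewrite ag mulmx0.
  rewrite mulmxA mul_mx_adj mul_scalar_mx => /eqP.
  rewrite scaler_eq0 (negPf det0)/= => /eqP/colP/(_ i).
  by rewrite !mxE.
have dqv x v : ref_int k n.+1 x -> 'D_v q x = 0.
  move=> ix; have [D pD qD] := polyfun_hadamard x pq.
  rewrite (hadamard_derive v pq pD qD) big1// => i _.
  suff -> : D i x = 0 by rewrite mulr0.
  rewrite -[RHS](dq0 x i ix) (hadamard_derive _ pq pD qD) (bigD1 i)//=.
  rewrite mxE !eqxx mul1r big1 ?addr0// => l li.
  by rewrite mxE (negPf li) andbF mul0r.
have cst_int x y : ref_int k n.+1 x -> ref_int k n.+1 y -> q y = q x.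
  move=> ix iy; apply: polyfun_derive0_cst => // z [t t01 <-]; apply: dqv.
  move: t01; rewrite /= in_itv/= le_eqVlt => /andP[/predU1P[<-|t0] t1].
    by rewrite scale0r addr0.
  by apply: ref_int_mix; rewrite ?t0//; exact: ref_int_sub.
have [c ic] := @ref_int_neq0 R k n.+1.
suff cst_ref x : ref x -> q x = q c by move=> x y rx ry; rewrite !cst_ref.
move=> rx; apply: contrapT => qxc.
have oO : open [set y | q y <> q c].
  rewrite (_ : mkset _ = q @^-1` (~` [set t | t = q c]))//.
  apply: open_comp; first by move=> y _; exact: polyfun_continuous.
  exact/closed_openC/closed_eq.
have [y [/= qyc iy]] := ref_int_dense rx oO qxc.
by apply: qyc; exact: cst_int.
Qed.

(** Hadamard's factorizations of the coordinates of [F] and of [q] at [x0] turn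
    the difference quotient into a quotient of polynomial functions evaluated at
    the preimage of the moving point, which tends to [x0]. *)
Lemma derive_element (q w : E -> R) v x0 : polyfun q -> ref_int k n.+1 x0 ->
  (\forall y \near F x0, forall x, ref x -> F x = y -> w y = q x) ->
  derivable w (F x0) v /\ 'D_v w (F x0) = element_derive q v x0.
Proof.
move=> pq ix0 hw.
have rx0 := ref_int_sub ix0.
have [_ /(_ x0 rx0) det0 _] := hp.
have wx0 : w (F x0) = q x0 by exact: (nbhs_singleton hw).
have /all_sig2[DF pDF DFE] := fun j =>
  cid2 (polyfun_hadamard x0 (@polyfun_cell_map R n.+1 k n.+1 p j)).
have [Dq pDq DqE] := polyfun_hadamard x0 pq.
pose M x := \matrix_(i, j) DF j i x.
have pM i j : polyfun (fun x => M x i j).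
  rewrite (_ : (fun x => _) = DF j i); first exact: pDF.
  by apply/funext => x; rewrite mxE.
have M0 : M x0 = J x0.
  apply/matrixP => i j; rewrite jacobianE mxE.
  rewrite (hadamard_derive _ (polyfun_cell_map p j) (pDF j) (DFE j)) (bigD1 i)//=.
  rewrite mxE !eqxx mul1r big1 ?addr0// => l li.
  by rewrite mxE (negPf li) andbF mul0r.
have Dq0 i : Dq i x0 = 'D_(delta_mx ord0 i) q x0.
  rewrite (hadamard_derive _ pq pDq DqE) (bigD1 i)//=.
  rewrite mxE !eqxx mul1r big1 ?addr0// => l li.
  by rewrite mxE (negPf li) andbF mul0r.
pose num x := \sum_i (v *m \adj (M x)) ord0 i * Dq i x.
have pnum : polyfun num.
  by apply: polyfun_sum => i; apply: polyfunM => //; exact: polyfun_mul_adj.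
have pdet : polyfun (fun x => \det (M x)) by exact: polyfun_det.
have detM0 : \det (M x0) != 0 by rewrite M0.
have psi0 : num x0 / \det (M x0) = element_derive q v x0.
  by rewrite /element_derive /num M0; under eq_bigr do rewrite Dq0.
have cpsi : {for x0, continuous (fun x => num x / \det (M x))}.
  exact: (@continuous_quotient num (fun x => \det (M x)) x0).
suff cvgq : h^-1 *: ((w \o shift (F x0)) (h *: v) - w (F x0)) @[h --> 0^'] -->
    element_derive q v x0.
  split; first by apply/cvg_ex; exists (element_derive q v x0).
  exact/cvg_lim.
apply/cvgrPdist_lt => e e0.
have near_x0 : \forall x \near x0,
    `|element_derive q v x0 - num x / \det (M x)| < e /\ \det (M x) != 0.
  apply: filterI.
    by move/cvgrPdist_lt : cpsi => /(_ e e0); rewrite /= psi0.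
  have : nbhs x0 ((fun x => \det (M x)) @^-1` (~` [set t | t = 0])).
    apply: (polyfun_continuous pdet); apply: open_nbhs_nbhs.
    by split; [exact/closed_openC/closed_eq|exact/eqP].
  by apply: filterS => x /= dx; exact/eqP.
have near_y0 : \forall y \near F x0, cell p y /\ forall x, ref x -> F x = y ->
    w y = q x /\ (`|element_derive q v x0 - num x / \det (M x)| < e /\ \det (M x) != 0).
  have cy : nbhs (F x0) (cell p) by exact: cell_map_open.
  have inv := inverse_continuous hp rx0 (@open_interior E _) near_x0.
  apply: filterS (filterI cy (filterI hw inv)) => y [ky [wy iy]].
  split=> // x rx xy; split; first exact: wy.
  exact: interior_subset (iy x rx xy).
have near_h : \forall h \near (0 : R), [set y | cell p y /\ forall x, ref x -> F x = y ->
    w y = q x /\ (`|element_derive q v x0 - num x / \det (M x)| < e /\ \det (M x) != 0)]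
    (F x0 + h *: v).
  by apply: (@continuous_line _ _ (F x0) v 0); rewrite /= scale0r addr0.
near=> h.
have h0 : h != 0 by near: h; exact: nbhs_dnbhs_neq.
have [[x rx xh]] : [set y | cell p y /\ forall x, ref x -> F x = y ->
    w y = q x /\ (`|element_derive q v x0 - num x / \det (M x)| < e /\ \det (M x) != 0)]
    (F x0 + h *: v).
  by near: h; exact: nbhs_dnbhs.
move=> /(_ x rx xh)[wy [xe detx]].
rewrite /= [h *: v + _]addrC wy wx0.
suff -> : h^-1 *: (q x - q x0) = num x / \det (M x) by [].
have xM : h *: v = (x - x0) *m M x.
  apply/rowP => j; have := congr1 (fun z : E => z ord0 j) xh.
  rewrite [in RHS]mxE (DFE j x) => /addrI <-.
  by rewrite mxE; apply: eq_bigr => i _; rewrite [M x _ _]mxE.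
have xadj i : (x - x0) ord0 i * \det (M x) = h * (v *m \adj (M x)) ord0 i.
  transitivity ((h *: v *m \adj (M x)) ord0 i).
    by rewrite xM -mulmxA mul_mx_adj mul_mx_scalar [RHS]mxE mulrC.
  by rewrite -scalemxAl [LHS]mxE.
rewrite (DqE x) addrAC subrr add0r /num scaler_sumr mulr_suml.
apply: eq_bigr => i _.
have -> : (v *m \adj (M x)) ord0 i = h^-1 * ((x - x0) ord0 i * \det (M x)).
  by rewrite xadj mulKf.
by rewrite /GRing.scale/=; field; rewrite detx h0.
Unshelve. all: by end_near. Qed.

End element_gradient.

(** * Local connectedness of a Lipschitz domain *)

Section lipschitz_domains.
Variables (R : realType) (m : nat).
Local Notation E := 'rV[R]_m.
Implicit Types (Omega : set E) (q : E).

(** Here [q] may be a boundary point, at which [Omega] is then required to have a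
    single local component. *)
Definition locally_connected_at Omega q : Prop :=
  forall N, nbhs q N -> exists2 N', nbhs q N' &
    forall x y, N' x -> N' y -> Omega x -> Omega y ->
    exists A, [/\ connected A, A x, A y & A `<=` N `&` Omega].

Lemma segment_sub_convex (P : set E) x y :
  (forall s, s \in `[0, 1] -> P (x + s *: (y - x))) -> segment x y `<=` P.
Proof. by move=> h _ [s s01 <-]; exact: h. Qed.

Lemma ball_convex (c : E) e x y : ball c e x -> ball c e y ->
  segment x y `<=` ball c e.
Proof.
rewrite -ball_normE/= => cx cy; apply: segment_sub_convex => s.
rewrite in_itv/= => /andP[s0 s1].
rewrite /= (_ : c - _ = (1 - s) *: (c - x) + s *: (c - y)); last first.
  by apply/rowP => i; rewrite !mxE; ring.
apply: le_lt_trans (ler_normD _ _) _; rewrite !normrZ !ger0_norm ?subr_ge0//.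
have : (1 - s) * `|c - x| + s * `|c - y| <= Num.max `|c - x| `|c - y|.
  set M := Num.max _ _; rewrite (_ : M = (1 - s) * M + s * M); last by ring.
  by apply: lerD; rewrite ler_wpM2l// ?subr_ge0// le_max lexx ?orbT.
by move/le_lt_trans; apply; rewrite gt_max cx.
Qed.

Lemma open_locally_connected Omega q : open Omega -> Omega q ->
  locally_connected_at Omega q.
Proof.
move=> oO Oq N Nq.
have /nbhs_ballP[e /= e0 eN] : nbhs q (N `&` Omega).
  by apply: filterI => //; exact: open_nbhs_nbhs.
exists (ball q e); first exact: nbhsx_ballx.
move=> x y qx qy _ _; exists (segment x y); split.
- exact: connected_segment.
- exact: segmentl.
- exact: segmentr.
- by apply: subset_trans eN; exact: ball_convex.
Qed.

(** Two points of a strict epigraph are joined by going up, across at a height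
    above the graph, and down. *)
Lemma epigraph_locally_connected Omega q : open Omega -> closure Omega q ->
  ~ Omega q -> lipschitz_epigraph_at Omega q -> locally_connected_at Omega q.
Proof.
move=> oO clq nOq [e [r [h [L [g [ee r0 h0 gL [_ epi]]]]]]] N Nq.
pose tt (x : E) : R := dotv (x - q) e; pose yy (x : E) : E := x - q - tt x *: e.
have {}epi (x : E) : `|yy x| < r -> `|tt x| < h -> Omega x <-> g (yy x) < tt x.
  exact: epi.
have qE x : x = q + yy x + tt x *: e.
  by rewrite /yy; apply/rowP => i; rewrite !mxE; ring.
have gD x : `|g (yy x) - g 0| <= `|L| * `|yy x|.
  have := gL (yy x, 0) (conj I I); rewrite /= subr0 => /le_trans; apply.
  by rewrite ler_wpM2r// ler_norm.
have ptt : polyfun tt.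
  rewrite (_ : tt = fun x => dotv e x - dotv e q).
    by apply: polyfunB; [exact: polyfun_dotv|exact: polyfun_cst].
  by apply/funext => z; rewrite /tt dotvC dotvBr.
have ctt : continuous tt by exact: polyfun_continuous.
have cyy : continuous yy.
  move=> x; apply: rV_continuous => i; apply: polyfun_continuous.
  rewrite (_ : (fun y => _) = fun y : E => y ord0 i - q ord0 i - tt y * e ord0 i).
    apply: polyfunB; last by apply: polyfunM => //; exact: polyfun_cst.
    by apply: polyfunB; [exact: polyfun_coord|exact: polyfun_cst].
  by apply/funext => y; rewrite !mxE.
have ttq : tt q = 0 by rewrite /tt subrr dotvC dotvE big1// => i _; rewrite mxE mulr0.
have yyq : yy q = 0 by rewrite /yy ttq scale0r subrr subr0.
have near_q a : 0 < a -> \forall x \near q, `|yy x| < a /\ `|tt x| < a.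
  move=> a0; apply: filterI.
    move/cvgrPdist_lt : (cyy q) => /(_ a a0); apply: filterS => x.
    by rewrite yyq sub0r normrN.
  move/cvgrPdist_lt : (ctt q) => /(_ a a0); apply: filterS => x.
  by rewrite ttq sub0r normrN.
have L1 : 0 < `|L| + 1 by rewrite ltr_wpDl.
have g0 : g 0 = 0.
  apply/eqP; rewrite eq_le; apply/andP; split; last first.
    have := epi q; rewrite ttq yyq normr0 => /(_ r0).
    by rewrite normr0 => /(_ h0)[_ gq]; rewrite leNgt; apply/negP => /gq.
  rewrite leNgt; apply/negP => g0.
  pose a := Num.min (Num.min r h) (g 0 / (`|L| + 1)).
  have a0 : 0 < a by rewrite !lt_min r0 h0 divr_gt0.
  have [x [Ox [yx tx]]] := clq _ (near_q a a0).
  move: (yx) (tx); rewrite !lt_min => /andP[/andP[yr _] ya] /andP[/andP[_ th] ta].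
  have [/(_ Ox) gx _] := epi x yr th.
  have := gD x; rewrite ler_norml => /andP[gx' _].
  have : (`|L| + 1) * a <= g 0.
    by rewrite mulrC -ler_pdivlMr// ge_min lexx orbT.
  have : `|L| * `|yy x| <= `|L| * a by rewrite ler_wpM2l// ltW.
  have : tt x <= `|tt x| by exact: ler_norm.
  by rewrite mulrDl mul1r; lra.
have /nbhs_ballP[eps /= eps0 epsN] := Nq.
have e1 : 0 < `|e| + 1 by rewrite ltr_wpDl.
(* on the cylinder of radius [rho] and half-height [s], which is contained in [N],
   the graph of [g] stays below the height [s / 2] *)
pose s := Num.min h (eps / 2 / (`|e| + 1)).
have s0 : 0 < s by rewrite lt_min h0 !divr_gt0.
pose rho := Num.min (Num.min r (eps / 2)) (s / 2 / (`|L| + 1)).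
have rho0 : 0 < rho by rewrite !lt_min r0 !divr_gt0.
have rho_r : rho <= r by rewrite !ge_min lexx.
have rho_eps : rho <= eps / 2 by rewrite !ge_min lexx !orbT.
have rho_s : `|L| * rho + rho <= s / 2.
  by rewrite -[X in _ + X]mul1r -mulrDl mulrC -ler_pdivlMr// ge_min lexx orbT.
have s_h : s <= h by rewrite ge_min lexx.
have s_eps : `|e| * s <= eps / 2.
  have : (`|e| + 1) * s <= eps / 2 by rewrite mulrC -ler_pdivlMr// ge_min lexx orbT.
  by rewrite mulrDl mul1r; lra.
have inO x : `|yy x| < rho -> `|tt x| < s -> g (yy x) < tt x -> (N `&` Omega) x.
  move=> yx tx gx; split.
    apply: epsN; rewrite -ball_normE/= distrC [X in X - q](qE x).
    rewrite (_ : _ - q = yy x + tt x *: e); last first.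
      by apply/rowP => i; rewrite !mxE; ring.
    apply: le_lt_trans (ler_normD _ _) _; rewrite normrZ.
    have : `|tt x| * `|e| <= `|e| * s by rewrite mulrC ler_wpM2l// ltW.
    by move: yx rho_eps s_eps; lra.
  by have [_] := epi x (lt_le_trans yx rho_r) (lt_le_trans tx s_h); exact.
have gs x : `|yy x| < rho -> g (yy x) < s / 2.
  move=> yx; apply: le_lt_trans (ler_norm _) _.
  have := gD x; rewrite g0 subr0 => /le_lt_trans; apply.
  have : `|L| * `|yy x| <= `|L| * rho by rewrite ler_wpM2l// ltW.
  by move: rho_s; lra.
have ttA x y a : tt (x + a *: (y - x)) = tt x + a * (tt y - tt x).
  rewrite /tt !(dotvC _ e) !dotvBr dotvDr dotvZr dotvBr; ring.
have yyA x y a : yy (x + a *: (y - x)) = yy x + a *: (yy y - yy x).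
  by rewrite /yy ttA; apply/rowP => i; rewrite !mxE; ring.
pose top x := q + yy x + (s / 2) *: e.
have yye x : dotv (yy x) e = 0.
  by rewrite dotvC /yy dotvBr dotvZr ee mulr1 dotvC subrr.
have tt_top x : tt (top x) = s / 2.
  rewrite /tt /top (_ : _ - q = yy x + (s / 2) *: e); last first.
    by apply/rowP => i; rewrite !mxE; ring.
  by rewrite dotvC dotvDr dotvZr ee mulr1 dotvC yye add0r.
have yy_top x : yy (top x) = yy x.
  by rewrite {1}/yy tt_top /top; apply/rowP => i; rewrite !mxE; ring.
have up x : `|yy x| < rho -> `|tt x| < s / 2 -> Omega x ->
    segment x (top x) `<=` N `&` Omega.
  move=> yx tx Ox; apply: segment_sub_convex => a; rewrite in_itv/= => /andP[a0 a1].
  have ypx : yy (x + a *: (top x - x)) = yy x.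
    by rewrite yyA yy_top subrr scaler0 addr0.
  have yr : `|yy x| < r := lt_le_trans yx rho_r.
  have th : `|tt x| < h by move: tx s_h; lra.
  have [/(_ Ox) gx _] := epi x yr th.
  have gx' : g (yy x) < tt x by exact: gx.
  move: tx; rewrite ltr_norml => /andP[tx1 tx2].
  have b1 : 0 <= a * (s / 2 - tt x) by rewrite mulr_ge0//; lra.
  have b2 : 0 <= (1 - a) * (s / 2 - tt x) by rewrite mulr_ge0//; lra.
  have tp : tt (x + a *: (top x - x)) = tt x + a * (s / 2 - tt x).
    by rewrite ttA tt_top.
  have b3 : tt x + a * (s / 2 - tt x) <= s / 2.
    by move: b2; rewrite mulrBl mul1r; lra.
  apply: inO; rewrite ?ypx// tp; last by lra.
  by rewrite ltr_norml; apply/andP; split; lra.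
exists [set x | `|yy x| < rho /\ `|tt x| < s / 2].
  have a0 : 0 < Num.min rho (s / 2) by rewrite lt_min rho0 divr_gt0.
  apply: filterS (near_q _ a0) => x [/lt_le_trans yx /lt_le_trans tx].
  by split; [apply: yx|apply: tx]; rewrite ge_min lexx ?orbT.
move=> x y [yx tx] [yy' ty] Ox Oy.
have across : segment (top x) (top y) `<=` N `&` Omega.
  apply: segment_sub_convex => a a01.
  have tp : tt (top x + a *: (top y - top x)) = s / 2.
    by rewrite ttA !tt_top subrr mulr0 addr0.
  have yp : `|yy (top x + a *: (top y - top x))| < rho.
    rewrite yyA !yy_top.
    have yb z : `|z| < rho -> ball (0 : E) rho z by rewrite -ball_normE/= sub0r normrN.
    have : ball (0 : E) rho (yy x + a *: (yy y - yy x)).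
      by apply: (ball_convex (yb _ yx) (yb _ yy')); exists a.
    by rewrite -ball_normE/= sub0r normrN.
  apply: inO => //; rewrite tp; last exact: gs.
  by rewrite ger0_norm; lra.
exists (segment x (top x) `|` segment (top x) (top y) `|` segment y (top y)); split.
- apply: connectedU; [|apply: connectedU|]; try exact: connected_segment.
    by exists (top y); split; [right; exact: segmentr|exact: segmentr].
  by exists (top x); split; [exact: segmentr|exact: segmentl].
- by left; left; exact: segmentl.
- by right; exact: segmentl.
- by rewrite !subUset; split; [split => //|]; exact: up.
Qed.

Lemma lipschitz_locally_connected Omega q : lipschitz_polyhedral_domain Omega ->
  closure Omega q -> locally_connected_at Omega q.
Proof.
move=> [[oO _ _] _ lip _] clq.
have [Oq|nOq] := pselect (Omega q); first exact: open_locally_connected.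
apply: epigraph_locally_connected => //; apply: lip; split=> //.
by apply: contra_not nOq => /interior_subset.
Qed.

(** Otherwise the parts of [Omega] near [q] inside and outside [omega] would be
    disconnected by [omega]. *)
Lemma adherent_to_frontier Omega omega q : locally_connected_at Omega q ->
  omega `<=` Omega -> closure omega q -> closure (Omega `\` closure omega) q ->
  closure (frontier omega `&` Omega) q.
Proof.
move=> lcq sub clq clq' N Nq; have [N' N'q conn] := lcq N Nq.
have [x [ox N'x]] := clq _ N'q.
have [y [[Oy noy] N'y]] := clq' _ N'q.
have [A [cA Ax Ay AN]] := conn x y N'x N'y (sub _ ox) Oy.
have [||z [Az fz]] := @connected_frontier _ _ A omega cA.
- by exists x.
- by exists y; split=> // oy; apply: noy; exact: subset_closure.
by have [Nz Oz] := AN z Az; exists z.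
Qed.

End lipschitz_domains.

Lemma continuous_at_dist (R : realType) (X : topologicalType) (f : X -> R) x :
  (forall e, 0 < e -> \forall y \near x, `|f x - f y| < e) -> {for x, continuous f}.
Proof. by move=> h; apply/cvgrPdist_lt. Qed.

Lemma within_continuous_dist (R : realType) (X : topologicalType) (f : X -> R) A :
  (forall x, A x -> forall e, 0 < e -> \forall y \near x, A y -> `|f x - f y| < e) ->
  {within A, continuous f}.
Proof.
move=> h; apply/subspace_continuousP => x Ax.
by apply/cvgrPdist_lt => e e0; rewrite near_withinE; exact: h.
Qed.

(** * Subdomains resolved by a mesh *)

Section mesh_topology.
Variables (R : realType) (n : nat).
Local Notation E := 'rV[R]_n.+1.
Variables (Omega GammaD : set E) (T : mesh R n) (J : {set elt T}).
Implicit Types K : elt T.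
Hypotheses (hT : regular_partition T Omega) (oOmega : open Omega).
Local Notation omega := (subdomain J).
Local Notation Omega_ := (closure Omega).
Hypothesis subO : omega `<=` Omega.
Local Notation ref K := (ref_cell (kind K) n.+1).
Local Notation ref_int K := (ref_int (kind K) n.+1).
Local Notation F K := (cell_map (@vertex R n T K)).

Lemma regular_vertex K : regular_element (@vertex R n T K).
Proof. by have [h _ _ _] := hT; exact: h. Qed.

Lemma interior_element K : (element K)° = F K @` ref_int K.
Proof. exact/interior_cell/regular_vertex. Qed.

Lemma closed_element K : closed (element K).
Proof. exact: closed_cell. Qed.

Lemma element_sub K : element K `<=` Omega_.
Proof. by case: hT => _ <- _ _ x Kx; exists K. Qed.

Lemma element_closure_interior K : element K `<=` closure (element K)°.
Proof.
move=> _ [x rx <-] N Nx; rewrite interior_element.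
have [U [oU Ux] UN] : exists2 U, open U /\ U x & U `<=` F K @^-1` N.
  have : nbhs x (F K @^-1` N) by exact: (continuous_cell_map (p := @vertex R n T K)).
  by rewrite nbhsE => -[U [oU Ux] UN]; exists U.
have [y [Uy iy]] := ref_int_dense rx oU Ux.
by exists (F K y); split; [exists y|exact: UN].
Qed.

Lemma closed_union : closed (\bigcup_(K in [set` J]) element K).
Proof.
apply: closed_bigcup => [|K _]; last exact: closed_element.
exact: finite_finset.
Qed.

Lemma open_subdomain : open omega.
Proof. exact: open_interior. Qed.

Lemma interior_subdomain : omega° = omega.
Proof. by have := open_subdomain; rewrite interior_id. Qed.

Lemma interior_element_sub K : K \in J -> (element K)° `<=` omega.
Proof. by move=> KJ; apply: interiorS => x Kx; exists K. Qed.

Lemma closure_subdomain : closure omega = \bigcup_(K in [set` J]) element K.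
Proof.
apply/seteqP; split=> [x|x [K KJ Kx]].
  move=> clx; have /closure_id -> := closed_union.
  exact: closure_subset (@interior_subset _ _) _ clx.
apply: closure_subset (interior_element_sub KJ) _ _.
exact: element_closure_interior.
Qed.

Lemma element_sub_closure K : K \in J -> element K `<=` closure omega.
Proof. by move=> KJ x Kx; rewrite closure_subdomain; exists K. Qed.

Lemma interior_closure_subdomain : (closure omega)° = omega.
Proof. by rewrite closure_subdomain. Qed.

Lemma closure_subdomain_sub : closure omega `<=` Omega_.
Proof. exact: closure_subset. Qed.

Lemma interior_element_disjoint K :
  K \notin J -> (element K)° `&` closure omega = set0.
Proof.
move=> KJ; rewrite -subset0 => x [iKx]; rewrite closure_subdomain => -[K' K'J K'x].
have KK' : K != K' by apply: contraNneq KJ => ->.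
have : nbhs x (element K)° by apply: open_nbhs_nbhs; split => //; exact: open_interior.
move=> /(element_closure_interior K'x)[y [iK'y iKy]].
have [_ _ /(_ K K' KK') disj _] := hT.
have : ((element K)° `&` (element K')°) y by split.
by rewrite disj.
Qed.

Lemma frontier_covered x : frontier omega x ->
  exists (K : elt T) (f : facet (kind K) n) (y : 'rV[R]_n),
    [/\ K \in J, ref_cell (kind K) n y & x = F K (facet_emb f y)].
Proof.
rewrite /frontier closure_subdomain interior_subdomain.
move=> [[K KJ [z rz zx]] nox].
have nz : ~ ref_int K z.
  move=> iz; apply: nox; apply: (interior_element_sub KJ).
  by rewrite interior_element; exists z.
have [f [y [ry zy]]] := ref_boundary rz nz.
by exists K, f, y; split=> //; rewrite -zx zy.
Qed.

(** A subdomain resolved by the mesh is the interior of its closure: it has no slit,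
    along which a function of [Vh0] could be nonzero. *)
Lemma outside_dense x N : frontier omega x -> Omega x -> nbhs x N ->
  exists2 y, (N `&` Omega) y & ~ closure omega y.
Proof.
move=> [_ nox] Ox Nx; apply: contrapT => h; apply: nox.
rewrite interior_subdomain -interior_closure_subdomain.
have : nbhs x (N `&` Omega) by apply: filterI => //; exact: open_nbhs_nbhs.
by apply: filterS => y NOy; apply: contrapT => ny; apply: h; exists y.
Qed.

Lemma Vh_continuous w x : Vh T Omega w -> Omega_ x ->
  forall e, 0 < e -> \forall y \near x, Omega_ y -> `|w x - w y| < e.
Proof.
move=> [_ cw _] Ox e e0.
have /subspace_continuousP/(_ x Ox)/cvgrPdist_lt/(_ e e0) := cw.
by rewrite near_withinE.
Qed.

Lemma Vh_continuous_at w x : Vh T Omega w -> Omega x -> {for x, continuous w}.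
Proof.
move=> Vw Ox; apply: continuous_at_dist => e e0.
have := Vh_continuous Vw (subset_closure Ox) e0.
have : nbhs x Omega by exact: open_nbhs_nbhs.
by apply: filterS2 => y Oy; apply; exact: subset_closure.
Qed.

Lemma Vh_closed_zero w (A : set E) x : Vh T Omega w -> A `<=` Omega_ ->
  (forall y, A y -> w y = 0) -> closure A x -> w x = 0.
Proof.
move=> Vw AO wA Ax; apply/eqP; apply: contraT => wx.
have wx0 : 0 < `|w x| by rewrite normr_gt0.
have clO : Omega_ x.
  by rewrite (_ : Omega_ = closure Omega_); [exact: closure_subset Ax|
    exact/closure_id/closed_closure].
have [y [Ay wy]] := Ax _ (Vh_continuous Vw clO wx0).
by have := wy (AO _ Ay); rewrite (wA y)// subr0 ltxx.
Qed.

Lemma Vh_element w K : Vh T Omega w -> exists q : E -> R,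
  polyfun q /\ forall x, ref K x -> w (F K x) = q x.
Proof.
move=> [_ _ /(_ K)[c wc]]; exists (fun x => \sum_a c a * shape_fun a x); split=> //.
apply: polyfun_sum => a; apply: polyfunM; first exact: polyfun_cst.
exact: polyfun_shape_fun.
Qed.

(** The extension [w] of [v] vanishes outside [closure omega], hence at the limits
    in [Omega] of points outside [closure omega]. *)
Lemma Vh0_interface v x : Vh0 Omega GammaD J v ->
  frontier omega x -> Omega x -> v x = 0.
Proof.
move=> [_ [w [Vw -> supp]]] fx Ox.
have clx : closure omega x by case: fx.
rewrite patchT ?inE//; apply/eqP; apply: contraT => wx.
have wx0 : 0 < `|w x| by rewrite normr_gt0.
have [y [wy Oy] noy] :=
  outside_dense fx Ox (Vh_continuous Vw (subset_closure Ox) wx0).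
suff wy0 : w y = 0.
  by have := wy (subset_closure Oy); rewrite wy0 subr0 ltxx.
by apply: contrapT => /eqP wy0; apply: noy; apply: supp; exact: subset_closure.
Qed.

Hypothesis lcO : forall q, Omega_ q -> locally_connected_at Omega q.

(** If [v] vanishes on the interface then it is its own extension by zero: it is
    continuous because the points of [closure omega] adherent to the rest of
    [Omega] are adherent to the interface. *)
Lemma interface_Vh0 v : VhD Omega GammaD J v ->
  (forall x, frontier omega x -> Omega x -> v x = 0) -> Vh0 Omega GammaD J v.
Proof.
move=> VDv v0; have [[w Vw wv] _] := VDv.
have vE : v = patch (fun=> 0) (closure omega) w by rewrite -wv.
have vin x : closure omega x -> v x = w x by move=> ox; rewrite vE patchT ?inE.
have vout x : ~ closure omega x -> v x = 0.
  by move=> ox; rewrite vE patchC// inE.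
have w0 x : closure omega x -> closure (Omega `\` closure omega) x -> w x = 0.
  move=> ox nox; apply: (@Vh_closed_zero w (frontier omega `&` Omega)) => //.
  - by move=> y [_ Oy]; exact: subset_closure.
  - by move=> y [fy Oy]; rewrite -vin ?v0//; case: fy.
  - exact: adherent_to_frontier (lcO (closure_subdomain_sub ox)) subO ox nox.
have clout x : Omega_ x -> ~ closure omega x -> closure (Omega `\` closure omega) x.
  move=> Ox nox N Nx.
  have [y [Oy [Ny noy]]] := Ox (N `&` ~` closure omega)
    (filterI Nx (open_nbhs_nbhs (conj (closed_openC (@closed_closure _ omega)) nox))).
  by exists y.
split=> //; exists v; split; first split.
- move=> x nOx; apply: vout => ox; apply: nOx; exact: closure_subdomain_sub.
- apply: within_continuous_dist => x Ox e e0.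
  have near_out : ~ closure omega x -> \forall y \near x, ~ closure omega y.
    move=> nox; apply: open_nbhs_nbhs; split=> //.
    exact/closed_openC/closed_closure.
  have [ox|/[dup] nox /near_out] := pselect (closure omega x); last first.
    by apply: filterS => y noy Oy; rewrite !vout// subrr normr0.
  have [acc|nacc] := pselect (closure (Omega `\` closure omega) x).
    have := Vh_continuous Vw Ox e0; apply: filterS => y wy Oy.
    rewrite vin// w0// sub0r normrN.
    have [oy|noy] := pselect (closure omega y); last by rewrite vout// normr0.
    by rewrite vin//; have := wy Oy; rewrite w0// sub0r normrN.
  have : nbhs x (~` closure (Omega `\` closure omega)).
    apply: open_nbhs_nbhs; split=> //; exact/closed_openC/closed_closure.
  have := Vh_continuous Vw Ox e0; apply: filterS2 => y wy nacc' Oy.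
  have oy : closure omega y by apply: contrapT => /(clout _ Oy).
  by rewrite !vin//; exact: wy.
- move=> K; have [KJ|KJ] := boolP (K \in J).
    have [_ _ /(_ K)[c wc]] := Vw; exists c => x rx.
    by rewrite vin ?wc//; apply: (element_sub_closure KJ); exists x.
  exists (fun=> 0) => x rx; rewrite big1 => [|a _]; last by rewrite mul0r.
  have Kx : element K (F K x) by exists x.
  have [ox|/vout//] := pselect (closure omega (F K x)).
  rewrite vin//; apply: w0 => // N Nx.
  have [y [iy Ny]] := element_closure_interior Kx (@nbhs_interior _ _ _ Nx).
  have noy : ~ closure omega y.
    by move=> oy; have := interior_element_disjoint KJ; rewrite -subset0 => /(_ y); apply.
  have Oy : Omega_ y by apply: (@element_sub K); exact: interior_subset.
  by have [z [nz Nz]] := clout y Oy noy N Ny; exists z.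
- by apply/funext => x; rewrite /patch; case: ifPn => //; rewrite notin_setE => /vout.
- have /closure_id -> := @closed_closure _ omega; apply: closure_subset => x /=.
  by move=> vx; apply: contrapT => /vout vx0; move: vx; rewrite vx0 eqxx.
Qed.

End mesh_topology.

(** * The bilinear forms *)

Section bounded_measurable.
Variables (R : realType) (m : nat).
Local Notation E := 'rV[R]_m.
Implicit Types (D : set E) (f g : E -> R).

(** On a bounded set these functions are integrable, and unlike the integrable
    functions they are stable under products. *)
Definition bounded_measurable D f : Prop :=
  measurable_fun D (f : E -> measurableTypeR R) /\
  exists C, forall x, D x -> `|f x| <= C.

Lemma bounded_measurable_cst D c : bounded_measurable D (fun=> c).
Proof. by split; [exact: measurable_cst|exists `|c|]. Qed.

Lemma bounded_measurableD D f g : bounded_measurable D f ->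
  bounded_measurable D g -> bounded_measurable D (fun x => f x + g x).
Proof.
move=> [mf [C fC]] [mg [C' gC']]; split; first exact: measurable_funD.
exists (C + C') => x Dx; apply: le_trans (ler_normD _ _) _.
by rewrite lerD ?fC ?gC'.
Qed.

Lemma bounded_measurableM D f g : bounded_measurable D f ->
  bounded_measurable D g -> bounded_measurable D (fun x => f x * g x).
Proof.
move=> [mf [C fC]] [mg [C' gC']]; split; first exact: measurable_funM.
exists (C * C') => x Dx; rewrite normrM.
by rewrite ler_pM ?fC ?gC'.
Qed.

Lemma bounded_measurable_sum D I (r : seq I) (h : I -> E -> R) :
  (forall i, bounded_measurable D (h i)) ->
  bounded_measurable D (fun x => \sum_(i <- r) h i x).
Proof.
move=> bh; elim: r => [|i r ih].
  rewrite (_ : (fun x => _) = fun=> 0); first exact: bounded_measurable_cst.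
  by apply/funext => x; rewrite big_nil.
rewrite (_ : (fun x => _) = fun x => h i x + \sum_(i <- r) h i x).
  exact: bounded_measurableD.
by apply/funext => x; rewrite big_cons.
Qed.

Lemma bounded_measurable_eq D f g : {in D, f =1 g} ->
  bounded_measurable D f -> bounded_measurable D g.
Proof.
move=> fg [mf [C fC]]; split; first exact: eq_measurable_fun mf.
by exists C => x Dx; rewrite -fg ?inE//; exact: fC.
Qed.

Lemma bounded_measurable_integrable D f : measurable D -> bounded_set D ->
  bounded_measurable D f -> (lebesgue_rV R m).-integrable D (EFin \o f).
Proof.
move=> mD bD [mf [C fC]]; apply: measurable_bounded_integrable => //.
  exact: bounded_finite_measure.
exists C; split; first exact: num_real.
by move=> M CM x Dx /=; apply: le_trans (fC x Dx) (ltW CM).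
Qed.

End bounded_measurable.

Section gradients.
Variables (R : realType) (n : nat).
Local Notation E := 'rV[R]_n.+1.
Variables (Omega : set E) (T : mesh R n) (J : {set elt T}).
Implicit Types K : elt T.
Hypothesis hT : regular_partition T Omega.
Local Notation omega := (subdomain J).
Local Notation ref K := (ref_cell (kind K) n.+1).
Local Notation ref_int K := (ref_int (kind K) n.+1).
Local Notation F K := (cell_map (@vertex R n T K)).

Let interiors : set E := \bigcup_(K in [set: elt T]) (element K)°.

Lemma Vh_locE u : Vh_loc Omega J u -> exists2 w, Vh T Omega w &
  forall y, closure omega y -> u y = w y.
Proof. by move=> [w Vw <-]; exists w => // y oy; rewrite patchT ?inE. Qed.

Lemma Vh_loc_subspace : linear_subspace (Vh_loc Omega J).
Proof.
have V0 : Vh T Omega 0.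
  split=> // [|K]; first by apply: within_continuous_dist => x _ e e0;
      apply: (@nearW _ (nbhs x)) => y _; rewrite subrr normr0.
  by exists (fun=> 0) => x _; rewrite big1// => a _; rewrite mul0r.
split; first by exists 0 => //; apply/funext => x; rewrite /patch; case: ifP.
move=> c _ _ [u [uO cu uK] <-] [v [vO cv vK] <-].
exists (c *: u + v); last first.
  apply/funext => x /=; rewrite /patch.
  rewrite -[RHS]/(c *: (if x \in closure omega then u x else 0) +
    (if x \in closure omega then v x else 0)).
  by case: ifP => // _; rewrite scaler0 addr0.
split=> [x nx||K].
- by rewrite -[LHS]/(c *: u x + v x) uO// vO// scaler0 addr0.
- apply/subspace_continuousP => x Ox.
  move/subspace_continuousP/(_ x Ox) : cu => cu.
  move/subspace_continuousP/(_ x Ox) : cv => cv.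
  exact: cvgD (cvgM (cvg_cst c) cu) cv.
have [cu' uE] := uK K; have [cv' vE] := vK K.
exists (fun a => c * cu' a + cv' a) => x rx.
rewrite -[LHS]/(c * u _ + v _) uE// vE// mulr_sumr -big_split/=.
by apply: eq_bigr => a _; rewrite mulrDl mulrA.
Qed.

(** In [omega] a local function coincides with a function of [Vh], that is, on each
    element, with a polynomial function composed with the inverse of the element
    map. *)
Lemma loc_derive u K : Vh_loc Omega J u -> exists2 q : E -> R, polyfun q &
  (forall x, ref K x -> closure omega (F K x) -> u (F K x) = q x) /\
  forall x v, ref_int K x -> omega (F K x) ->
    derivable u (F K x) v /\
    'D_v u (F K x) = element_derive (@vertex R n T K) q v x.
Proof.
move=> /Vh_locE [w Vw uw]; have [q [pq wq]] := Vh_element K Vw.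
exists q => //; split=> [x rx ox|x v ix ox]; first by rewrite uw// wq.
apply: derive_element => //; first exact: regular_vertex hT K.
have : nbhs (F K x) omega by apply: open_nbhs_nbhs; split=> //; exact: open_subdomain.
by apply: filterS => y oy z rz zy; rewrite uw -?zy ?wq//; rewrite zy; exact: subset_closure.
Qed.

Lemma open_skeleton_complement : open interiors.
Proof. by apply: bigcup_open => K _; exact: open_interior. Qed.

Lemma loc_derivable u y v : Vh_loc Omega J u -> interiors y -> omega y -> derivable u y v.
Proof.
move=> Vu [K _]; rewrite (interior_element hT) => -[x ix <-] oy.
by have [q _ [_ /(_ x v ix oy)[]]] := loc_derive K Vu.
Qed.

Lemma loc_derive_continuous u y v : Vh_loc Omega J u -> interiors y -> omega y ->
  {for y, continuous ('D_v u)}.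
Proof.
move=> Vu [K _] iy; have := iy; rewrite (interior_element hT) => -[x ix xy] oy.
have [q pq [_ dq]] := loc_derive K Vu.
have reg := regular_vertex hT K; have rx := ref_int_sub ix.
apply: continuous_at_dist => e e0.
pose d := element_derive (@vertex R n T K) q v.
have nP : nbhs x [set z | `|d x - d z| < e].
  by have /cvgrPdist_lt/(_ e e0) := @continuous_element_derive _ _ _ _ reg q v x pq rx.
have inv := inverse_continuous reg rx (@open_interior E _) nP.
have n1 : nbhs y omega by apply: open_nbhs_nbhs; split=> //; exact: open_subdomain.
have n2 : nbhs y (element K)° by apply: open_nbhs_nbhs; split=> //; exact: open_interior.
rewrite -xy in n1 n2 *.
apply: filterS (filterI inv (filterI n1 n2)) => y' [iz [oz]].
rewrite (interior_element hT) => -[z iz' zE]; rewrite -zE in iz oz *.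
have [_ ->] := dq x v ix (nbhs_singleton n1).
have [_ ->] := dq z v iz' oz.
exact: interior_subset (iz z (ref_int_sub iz') erefl).
Qed.

Lemma loc_derive_bounded u v : Vh_loc Omega J u ->
  exists C, forall y, interiors y -> omega y -> `|'D_v u y| <= C.
Proof.
move=> Vu.
have /choice[C CE] : forall K, exists C, forall y, (element K)° y -> omega y ->
    `|'D_v u y| <= C.
  move=> K; have [q pq [_ dq]] := loc_derive K Vu.
  have [C Cq] := @bounded_element_derive _ _ _ _ (regular_vertex hT K) q v pq.
  exists C => y; rewrite (interior_element hT) => -[x ix <-] oy.
  by have [_ ->] := dq x v ix oy; apply: Cq; exact: ref_int_sub.
exists (\sum_K `|C K|) => y [K _ iy] oy.
apply: le_trans (CE K y iy oy) _; apply: le_trans (ler_norm _) _.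
by rewrite (bigD1 K)//= lerDl sumr_ge0.
Qed.

Lemma gradE u x i : grad T u x ord0 i = if x \in interiors then 'D_(delta_mx ord0 i) u x else 0.
Proof. by rewrite /grad /patch -/interiors; case: ifP => _; rewrite mxE. Qed.

Lemma grad_linear u v c x : Vh_loc Omega J u -> Vh_loc Omega J v -> omega x ->
  grad T (c *: u + v) x = c *: grad T u x + grad T v x.
Proof.
move=> Vu Vv ox; apply/rowP => i; rewrite !mxE !gradE.
case: ifPn => [|_]; last by rewrite mulr0 addr0.
rewrite inE => Sx; rewrite deriveD; last exact: loc_derivable.
  rewrite deriveZ//; exact: loc_derivable.
by apply: derivableZ; exact: loc_derivable.
Qed.

Lemma bounded_measurable_grad u i : Vh_loc Omega J u ->
  bounded_measurable omega (fun x => grad T u x ord0 i).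
Proof.
move=> Vu; split; last first.
  have [C CE] := loc_derive_bounded (delta_mx ord0 i) Vu.
  exists `|C| => x ox; rewrite gradE; case: ifPn => [|_]; last by rewrite normr0.
  by rewrite inE => Sx; apply: le_trans (CE x Sx ox) (ler_norm _).
have oS := open_skeleton_complement; have oo := @open_subdomain R n T J.
have -> : omega = (omega `&` interiors) `|` (omega `\` interiors) by rewrite setUIDK.
have mS := open_measurable_rV oS; have mo := open_measurable_rV oo.
apply/measurable_funU; [exact: measurableI|exact: measurableD|split].
  apply: (eq_measurable_fun ('D_(delta_mx ord0 i) u : E -> measurableTypeR R)).
    by move=> x; rewrite inE => -[_ Sx]; rewrite gradE mem_set.
  apply: open_continuous_measurable_fun_rV; first exact: openI.
  by move=> x [ox Sx]; exact: loc_derive_continuous.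
apply: (eq_measurable_fun (fun=> 0 : measurableTypeR R)); last exact: measurable_cst.
by move=> x; rewrite inE => -[_ Sx]; rewrite gradE memNset.
Qed.

End gradients.

Section energy_form.
Variables (R : realType) (n : nat).
Local Notation E := 'rV[R]_n.+1.
Variables (Omega GammaD : set E) (T : mesh R n) (J : {set elt T}).
Implicit Types K : elt T.
Hypotheses (hT : regular_partition T Omega) (oOmega : open Omega).
Local Notation omega := (subdomain J).
Hypothesis subO : omega `<=` Omega.
Hypothesis bO : bounded_set Omega.
Variables (A : E -> 'M[R]_n.+1) (alpha beta : R).
Hypotheses (hA : essentially_bounded_coefficient Omega A) (alpha0 : 0 < alpha)
  (hell : symmetric_elliptic Omega A alpha beta).
Local Notation F K := (cell_map (@vertex R n T K)).
Local Notation Vloc := (Vh_loc Omega J).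
Let interiors : set E := \bigcup_(K in [set: elt T]) (element K)°.

Lemma measurable_subdomain : measurable omega.
Proof. by apply: open_measurable_rV; exact: open_subdomain. Qed.

Lemma bounded_subdomain : bounded_set omega.
Proof. exact: bounded_subset bO subO. Qed.

(** Polarization of the ellipticity bounds. *)
Lemma coefficient_bound x i j : Omega x -> `|A x i j| <= 2 * beta.
Proof.
move=> Ox; have [AT Aell] := hell Ox.
pose e (i : 'I_n.+1) : E := delta_mx ord0 i.
have bilE i' j' : bil (A x)^T (e i') (e j') = A x j' i'.
  by rewrite /bil -rowE [LHS]mxE (bigD1 j')//= big1 ?addr0 => [|l lj];
    rewrite !mxE ?eqxx ?mulr1// (negPf lj) mulr0.
have dotvE' i' j' : dotv (e i') (e j') = (i' == j')%:R.
  rewrite dotvE (bigD1 i')//= big1 ?addr0 => [|l li].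
    by rewrite !mxE !eqxx mul1r.
  by rewrite !mxE (negPf li) mul0r.
have AS : (A x)^T^T = (A x)^T by rewrite AT.
have bilD u v w : bil (A x)^T (u + v) w = bil (A x)^T u w + bil (A x)^T v w.
  by have := bilPl (A x)^T 1 u v w; rewrite scale1r mul1r.
have dotvDD : dotv (e i + e j) (e i + e j) =
    dotv (e i) (e i) + 2 * dotv (e i) (e j) + dotv (e j) (e j).
  by rewrite dotvDr !(dotvC (e i + e j)) !dotvDr (dotvC (e j) (e i)); ring.
have := Aell (e i + e j); have := Aell (e i); have := Aell (e j).
rewrite -![dotv (_ *m _) _]/(bil (A x)^T _ _) !bilD ![bil _ _ (_ + _)]bilC// !bilD.
rewrite dotvDD !dotvE' !bilE.
have Aij : A x i j = A x j i by rewrite -{1}AT mxE.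
have arith (al be r s t : R) (c : bool) : 0 < al -> al <= r <= be -> al <= s <= be ->
    al * (1 + 2 * c%:R + 1) <= s + t + (t + r) <= be * (1 + 2 * c%:R + 1) ->
    - (2 * be) <= t <= 2 * be.
  move=> al0 /andP[r0 r1] /andP[s0 s1].
  by case: c; rewrite /= ?mulr1 ?mulr0 => /andP[h0 h1]; apply/andP; split; lra.
by rewrite !eqxx Aij ler_norml !mulr1; exact: arith.
Qed.

Definition energy_density (u v : E -> R) (x : E) : R :=
  bil (A x)^T (grad T u x) (grad T v x).

Lemma bounded_measurable_coefficient i j : bounded_measurable omega (fun x => A x i j).
Proof.
split; last by exists (2 * beta) => x ox; apply: coefficient_bound; exact: subO.
have [mA _] := hA i j.
by apply: measurable_funS mA => //; exact: open_measurable_rV.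
Qed.

Lemma bounded_measurable_energy u v : Vloc u -> Vloc v ->
  bounded_measurable omega (energy_density u v).
Proof.
move=> Vu Vv.
rewrite (_ : energy_density u v = fun x => \sum_j
    (\sum_i grad T u x ord0 i * A x j i) * grad T v x ord0 j).
  apply: bounded_measurable_sum => j; apply: bounded_measurableM.
    apply: bounded_measurable_sum => i; apply: bounded_measurableM.
      exact: (bounded_measurable_grad hT).
    exact: bounded_measurable_coefficient.
  exact: (bounded_measurable_grad hT).
apply/funext => x; rewrite /energy_density /bil mxE.
apply: eq_bigr => j _; rewrite [_^T j _]mxE; congr (_ * _).
by rewrite mxE; apply: eq_bigr => i _; rewrite [_^T i j]mxE.
Qed.

Lemma integrable_energy u v : Vloc u -> Vloc v ->
  (lebesgue_rV R n.+1).-integrable omega (EFin \o energy_density u v).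
Proof.
move=> Vu Vv; apply: bounded_measurable_integrable.
- exact: measurable_subdomain.
- exact: bounded_subdomain.
- exact: bounded_measurable_energy.
Qed.

Lemma a_formE u v :
  a_form T A omega u v = \int[lebesgue_rV R n.+1]_(x in omega) energy_density u v x.
Proof. by []. Qed.

Lemma energy_ge u x : omega x ->
  alpha * dotv (grad T u x) (grad T u x) <= energy_density u u x.
Proof. by move=> /subO/hell[_ /(_ (grad T u x))/andP[]]. Qed.

Lemma energy_ge0 u x : omega x -> 0 <= energy_density u u x.
Proof.
by move=> ox; apply: le_trans (energy_ge u ox); rewrite mulr_ge0 ?dotvv_ge0// ltW.
Qed.

Lemma psd_energy : psd_form Vloc (a_form T A omega).
Proof.
split=> [c u v w Vu Vv Vw|u v Vu Vv|u Vu]; rewrite !a_formE.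
- have mo := measurable_subdomain.
  rewrite -RintegralZl//; last exact: integrable_energy.
  rewrite -RintegralD//; last 2 first.
  + have [mf [C fC]] := bounded_measurableM (bounded_measurable_cst omega c)
      (bounded_measurable_energy Vu Vw).
    apply: bounded_measurable_integrable => //; first exact: bounded_subdomain.
    by split=> //; exists C.
  + exact: integrable_energy.
  apply: eq_Rintegral => x; rewrite inE => ox.
  rewrite /energy_density -bilPl; congr (bil _ _ _).
  exact: (grad_linear hT c Vu Vv ox).
- apply: eq_Rintegral => x; rewrite inE => /subO/hell[AT _].
  by rewrite /energy_density bilC// !AT.
- by apply: Rintegral_ge0 => x; exact: energy_ge0.
Qed.

(** A nonzero gradient would stay away from zero on a small open set, which by
    ellipticity would contribute to the energy. *)
Lemma energy0_grad0 u x i : Vloc u -> a_form T A omega u u = 0 ->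
  interiors x -> omega x -> grad T u x ord0 i = 0.
Proof.
move=> Vu a0 Sx ox; apply/eqP; apply: contraT => gi0.
have oS : open interiors by exact: open_skeleton_complement.
have oU : open (omega `&` interiors) by apply: openI => //; exact: open_subdomain.
pose d y := 'D_(delta_mx ord0 i) u y.
have gE y : interiors y -> grad T u y ord0 i = d y by move=> Sy; rewrite gradE ifT ?inE.
have cd := loc_derive_continuous hT (v := delta_mx ord0 i) Vu Sx ox.
have dx0 : 0 < `|d x| by rewrite normr_gt0 -gE.
have nU : nbhs x (omega `&` interiors) by exact: open_nbhs_nbhs.
have near_d : \forall y \near x, `|d x| / 2 < `|d y|.
  have d20 : 0 < `|d x| / 2 by rewrite divr_gt0.
  move/cvgrPdist_lt : cd => /(_ _ d20); apply: filterS => y dxy.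
  by have := ler_distD (d y) (d x) 0; rewrite !subr0; move: dxy; lra.
pose U := ([set y | `|d x| / 2 < `|d y|] `&` (omega `&` interiors))°.
have Ux : U x by exact: filterI.
have US y : U y -> [/\ `|d x| / 2 < `|d y|, omega y & interiors y].
  by move=> /interior_subset[? []].
suff : 0 < a_form T A omega u u by rewrite a0 ltxx.
rewrite a_formE; apply: (@Rintegral_gt0 _ _ _ _ U (alpha * (`|d x| / 2) ^+ 2)).
- exact: measurable_subdomain.
- exact: integrable_energy.
- by move=> y; exact: energy_ge0.
- exact: open_interior.
- by exists x.
- by move=> y /US[].
- by rewrite mulr_gt0// exprn_gt0// divr_gt0.
move=> y /US[dy oy Sy]; apply: le_trans (energy_ge u oy).
rewrite ler_pM2l// dotvE (bigD1 i)//= gE// -expr2 -[X in _ <= X + _]real_normK ?num_real//.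
rewrite -[leLHS]addr0 lerD//.
  by rewrite lerXn2r// ?nnegrE// ?divr_ge0// ltW.
by rewrite sumr_ge0// => l _; rewrite -expr2 sqr_ge0.
Qed.

Hypothesis cO : connected Omega.
Hypotheses (omega0 : omega !=set0) (properO : omega != Omega).

Lemma interface_neq0 : exists x, frontier omega x /\ Omega x.
Proof.
have [x ox] := omega0.
have [||z [Oz fz]] := @connected_frontier _ _ Omega omega cO.
- by exists x; split=> //; exact: subO.
- apply: contrapT => h; move/eqP: properO; apply; apply/seteqP; split=> // y Oy.
  by apply: contrapT => noy; apply: h; exists y.
- by exists z.
Qed.

(** A function of zero energy is constant on each element of [J], hence on the
    connected set [omega], and it vanishes on the nonempty interface. *)
Lemma energy_definite v : connected omega -> Vh0 Omega GammaD J v ->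
  a_form T A omega v v = 0 -> v = 0.
Proof.
move=> co V0v a0; have [[Vv _] _] := V0v.
have cst K : K \in J -> exists c, forall y, element K y -> v y = c.
  move=> KJ; have [q pq [vq dq]] := loc_derive hT K Vv.
  have reg := regular_vertex hT K.
  have clK : element K `<=` closure omega := element_sub_closure hT KJ.
  have [x0 ix0] := @ref_int_neq0 R (kind K) n.+1.
  exists (q x0) => _ [x rx <-].
  rewrite vq//; last by apply: clK; exists x.
  apply: (element_derive0 reg pq) => //; last exact: ref_int_sub.
  move=> z i iz.
  have iKz : (element K)° (F K z) by rewrite (interior_element hT); exists z.
  have oz : omega (F K z) := interior_element_sub KJ iKz.
  have Sz : interiors (F K z) by exists K.
  have [_ <-] := dq z (delta_mx ord0 i) iz oz.
  by have := energy0_grad0 i Vv a0 Sz oz; rewrite gradE mem_set.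
have [x0 ox0] := omega0.
have JE y : omega y -> exists2 K, K \in J & element K y.
  by move=> oy; have [K KJ Ky] := interior_subset oy; exists K.
have v_cst y : omega y -> v y = v x0.
  suff : omega `&` [set y | v y = v x0] = omega.
    by move=> e oy; move: (oy); rewrite -e => -[].
  have clo (P : R -> Prop) : closed (\bigcup_(K in [set K | K \in J /\
      exists y, element K y /\ P (v y)]) element K).
    apply: closed_bigcup => [|K _]; last exact: closed_element.
    exact: finite_finset.
  have cloE (P : R -> Prop) x : omega x ->
      (\bigcup_(K in [set K | K \in J /\ exists y, element K y /\ P (v y)]) element K) x <->
      P (v x).
    move=> ox; split=> [[K [KJ [z [Kz Pz]]] Kx]|Px].
      by have [c cE] := cst K KJ; rewrite cE// -(cE z).
    by have [K KJ Kx] := JE x ox; exists K => //; split=> //; exists x.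
  apply: co.
  - by exists x0.
  - exists (~` (\bigcup_(K in [set K | K \in J /\
      exists y, element K y /\ v y <> v x0]) element K)).
      exact/closed_openC/(clo (fun t => t <> v x0)).
    apply/seteqP; split=> x [ox vx]; split=> //.
      by move=> /(cloE (fun t => t <> v x0) x ox).
    by apply: contrapT => nvx; apply: vx; apply/(cloE (fun t => t <> v x0) x ox).
  - exists (\bigcup_(K in [set K | K \in J /\
      exists y, element K y /\ v y = v x0]) element K); first exact: (clo (fun t => t = v x0)).
    apply/seteqP; split=> x [ox vx]; split=> //.
      exact/(cloE (fun t => t = v x0) x ox).
    exact/(cloE (fun t => t = v x0) x ox).
have v_cl y : closure omega y -> v y = v x0.
  rewrite (closure_subdomain J hT) => -[K KJ Ky].
  have [c cE] := cst K KJ; have [z iz] := @ref_int_neq0 R (kind K) n.+1.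
  have iKz : (element K)° (F K z) by rewrite (interior_element hT); exists z.
  rewrite cE// -(cE _ (interior_subset iKz)); apply: v_cst.
  exact: (interior_element_sub KJ).
have [p [fp Op]] := interface_neq0.
have vx0 : v x0 = 0.
  by rewrite -(v_cl p) ?(Vh0_interface hT oOmega V0v)//; case: fp.
apply/funext => y; have [oy|noy] := pselect (closure omega y).
  by rewrite v_cl// vx0.
by have [w _ <-] := Vv; rewrite patchC// inE.
Qed.

End energy_form.

Section gram.
Variables (R : realType) (m d : nat).

(** Along the segment from the identity to the Gram matrix the determinant does
    not vanish, so it keeps its sign. *)
Lemma gram_det_gt0 (M : 'M[R]_(m, d)) :
  (forall v : 'rV[R]_m, v *m M = 0 -> v = 0) -> 0 < \det (M *m M^T).
Proof.
move=> M0; set G := M *m M^T.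
pose h (x : 'rV[R]_1) := \det (x ord0 ord0 *: G + (1 - x ord0 ord0) *: 1%:M).
have ph : polyfun h.
  apply: polyfun_det => i j.
  rewrite (_ : (fun x => _) = fun x : 'rV[R]_1 => x ord0 ord0 * G i j +
    (1 - x ord0 ord0) * (1%:M : 'M[R]_m) i j); last first.
    by apply/funext => x; rewrite !mxE.
  have px : polyfun (fun x : 'rV[R]_1 => x ord0 ord0) by exact: polyfun_coord.
  apply: polyfunD; apply: polyfunM; rewrite ?px//; try exact: polyfun_cst.
  by apply: polyfunB => //; exact: polyfun_cst.
pose f (t : R) := h (0 + t *: const_mx 1).
have fE t : f t = \det (t *: G + (1 - t) *: 1%:M) by rewrite /f /h add0r !mxE mulr1.
have cf : continuous f.
  move=> t; exact: (continuous_comp (@continuous_line _ _ 0 (const_mx 1) t)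
    (@polyfun_continuous _ _ _ ph _)).
have f0 t : 0 <= t <= 1 -> f t != 0.
  move=> /andP[t0 t1]; rewrite fE; apply/negP => /det0P[v v0 vG].
  have : t * dotv (v *m M) (v *m M) + (1 - t) * dotv v v = 0.
    transitivity (dotv (v *m (t *: G + (1 - t) *: 1%:M)) v); last first.
      by rewrite vG dotvE big1// => i _; rewrite mxE mul0r.
    rewrite mulmxDr -!scalemxAr mulmx1 dotvC dotvDr !dotvZr; congr (_ * _ + _).
    by rewrite dotvC /dotv /G trmx_mul !mulmxA.
  have a0 : 0 <= t * dotv (v *m M) (v *m M) by rewrite mulr_ge0// dotvv_ge0.
  have b0 : 0 <= (1 - t) * dotv v v by rewrite mulr_ge0 ?dotvv_ge0// subr_ge0.
  move/eqP; rewrite paddr_eq0// => /andP[]; rewrite !mulf_eq0 !dotvv_eq0.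
  rewrite (negPf v0) orbF subr_eq0 => /orP[/eqP ->|/eqP vM _]; first by rewrite oner_eq0.
  by rewrite (M0 v vM) eqxx in v0.
have f00 : f 0 = 1 by rewrite fE scale0r add0r subr0 scale1r det1.
have f1 : f 1 = \det G by rewrite fE scale1r subrr scale0r addr0.
rewrite ltNge -f1; apply/negP => f1_le.
have [|c c01 fc] := @IVT R f 0 1 0 ler01 (continuous_subspaceT cf).
  by rewrite f00 ge_min le_max f1_le ler01 orbT.
have c01' : 0 <= c <= 1 by move: c01; rewrite in_itv.
by have := f0 c c01'; rewrite fc eqxx.
Qed.

End gram.

Section facet_jacobian.
Variables (R : realType) (k : cell_kind) (n : nat) (p : node k n.+1 -> 'rV[R]_n.+1).
Hypothesis hp : regular_element p.
Variable f : facet k n.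
Local Notation pf := (fun a => p (facet_node f a)).

Definition surface_density (x : 'rV[R]_n) : R :=
  Num.sqrt (\det (jacobian (cell_map pf) x *m (jacobian (cell_map pf) x)^T)).

Lemma continuous_surface_density : continuous surface_density.
Proof.
pose g x := \det (jacobian (cell_map pf) x *m (jacobian (cell_map pf) x)^T).
have pg : polyfun g.
  apply: polyfun_det => i j; rewrite (_ : (fun x => _) = fun x => \sum_l
    jacobian (cell_map pf) x i l * jacobian (cell_map pf) x j l).
    by apply: polyfun_sum => l; apply: polyfunM; exact: polyfun_jacobian.
  by apply/funext => x; rewrite [LHS]mxE; apply: eq_bigr => l _; rewrite [_^T _ _]mxE.
move=> x; apply: (@continuous_comp _ _ _ g Num.sqrt x).
  exact: (@polyfun_continuous R n g pg).
exact: sqrt_continuous.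
Qed.

(** The derivative of the affine map [facet_emb f] is injective, and so is that of
    the element map. *)
Lemma facet_jacobian_free (x v : 'rV[R]_n) : ref_cell k n x ->
  v *m jacobian (cell_map pf) x = 0 -> v = 0.
Proof.
move=> rx vJ.
have [_ /(_ _ (facet_emb_ref f rx)) det0 _] := hp.
set L := facet_emb f v - facet_emb f 0.
suff : L *m jacobian (cell_map p) (facet_emb f x) = 0.
  move=> LJ; apply: (@facet_emb_inj R _ _ f); apply/eqP; rewrite -subr_eq0 -/L.
  have uJ : jacobian (cell_map p) (facet_emb f x) \in unitmx by rewrite unitmxE unitfE.
  by rewrite -(mulmxK uJ L) LJ mul0mx.
apply/rowP => j; rewrite [RHS]mxE mul_jacobian.
move/rowP : vJ => /(_ j); rewrite [RHS]mxE mul_jacobian => <-.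
rewrite /derive; do 2 f_equal; apply/funext => h /=.
by rewrite !cell_map_facet [h *: v + x]addrC facet_emb_affine [_ + h *: L]addrC.
Qed.

Lemma surface_density_gt0 x : ref_cell k n x -> 0 < surface_density x.
Proof.
by move=> rx; rewrite sqrtr_gt0; apply: gram_det_gt0 => v; exact: facet_jacobian_free.
Qed.

Lemma continuous_facet_emb : continuous (@facet_emb R k n f).
Proof.
move=> x; apply: rV_continuous => j; apply: polyfun_continuous.
case: (k) f => f'.
  rewrite (_ : (fun y => _) = fun y => if unlift f' (lift ord0 j) is Some a
    then @shape_fun R Simplex n a y else 0); last by apply/funext => y; rewrite mxE.
  by case: (unlift _ _) => [a|]; [exact: (@polyfun_shape_fun R Simplex n a)|exact: polyfun_cst].
rewrite (_ : (fun y => _) = fun y : 'rV[R]_n => if unlift f'.1 j is Some l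
  then y ord0 l else f'.2%:R); last by apply/funext => y; rewrite mxE.
by case: (unlift _ _) => [a|]; [exact: polyfun_coord|exact: polyfun_cst].
Qed.

End facet_jacobian.

Section interface_form.
Variables (R : realType) (n : nat).
Local Notation E := 'rV[R]_n.+1.
Variables (Omega : set E) (T : mesh R n) (J : {set elt T}).
Implicit Types K : elt T.
Hypotheses (hT : regular_partition T Omega) (oOmega : open Omega).
Local Notation omega := (subdomain J).
Local Notation F K := (cell_map (@vertex R n T K)).
Local Notation Vloc := (Vh_loc Omega J).
Local Notation vf K f := (fun a => @vertex R n T K (facet_node f a)).
Let Sigma : set E := frontier omega `&` Omega.

Definition interface_part K (f : facet (kind K) n) : set 'rV[R]_n :=
  ref_cell (kind K) n `&` cell_map (vf K f) @^-1` Sigma.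

Definition interface_density K (f : facet (kind K) n) (u v : E -> R)
    (x : 'rV[R]_n) : R :=
  u (cell_map (vf K f) x) * v (cell_map (vf K f) x) *
  surface_density (@vertex R n T K) f x.

Lemma b_formE u v : b_form Omega J u v = \sum_(K in J) \sum_(f : facet (kind K) n)
  \int[lebesgue_rV R n]_(x in interface_part f) interface_density f u v x.
Proof. by []. Qed.

Lemma measurable_interface_part K (f : facet (kind K) n) :
  measurable (interface_part f).
Proof.
have cF := @continuous_cell_map R n.+1 (kind K) n (vf K f).
apply: measurableI; first by apply: closed_measurable_rV; exact: closed_ref_cell.
rewrite preimage_setI; apply: measurableI.
  apply: closed_measurable_rV; apply: closed_comp; last exact: closed_frontier.
  by move=> x _; exact: cF.
have oF : open (cell_map (vf K f) @^-1` Omega).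
  by apply: open_comp => // x _; exact: cF.
exact: open_measurable_rV oF.
Qed.

Lemma bounded_interface_part K (f : facet (kind K) n) : bounded_set (interface_part f).
Proof. exact: (bounded_subset (@bounded_ref_cell R (kind K) n) (@subIsetl _ _ _)). Qed.

Lemma continuous_bounded_measurable K (f : facet (kind K) n) (g : 'rV[R]_n -> R) :
  continuous g -> bounded_measurable (interface_part f) g.
Proof.
move=> cg; split.
  apply: (@measurable_funS _ _ _ _ setT) => //.
  by apply: open_continuous_measurable_fun_rV; [exact: openT|move=> x _; exact: cg].
have [x0 ix0] := @ref_int_neq0 R (kind K) n.
have cn : {within @ref_cell R (kind K) n, continuous (fun x => `|g x|)}.
  apply: continuous_subspaceT => x.
  by apply: (@continuous_comp _ _ _ g (@Num.norm R R)); [exact: cg|exact: norm_continuous].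
have [c _ cmax] := compact_EVT_max (ex_intro _ x0 (ref_int_sub ix0))
  (@compact_ref_cell R (kind K) n) cn.
by exists `|g c| => x [rx _]; apply: cmax; rewrite inE.
Qed.

Lemma bounded_measurable_interface K (f : facet (kind K) n) u v : Vloc u -> Vloc v ->
  bounded_measurable (interface_part f) (interface_density f u v).
Proof.
have trace w : Vloc w ->
    bounded_measurable (interface_part f) (fun x => w (cell_map (vf K f) x)).
  move=> Vw; have [q pq [wq _]] := loc_derive hT K Vw.
  apply: (@bounded_measurable_eq _ _ _ (q \o @facet_emb R _ n f)).
    move=> x; rewrite inE => -[rx [[ox _] _]] /=; move: ox; rewrite cell_map_facet => ox.
    by rewrite wq//; exact: facet_emb_ref.
  apply: continuous_bounded_measurable => x.
  apply: continuous_comp; first exact: continuous_facet_emb.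
  exact: polyfun_continuous.
move=> Vu Vv; apply: bounded_measurableM.
  by apply: bounded_measurableM; exact: trace.
exact/continuous_bounded_measurable/continuous_surface_density.
Qed.

Lemma integrable_interface K (f : facet (kind K) n) u v : Vloc u -> Vloc v ->
  (lebesgue_rV R n).-integrable (interface_part f) (EFin \o interface_density f u v).
Proof.
move=> Vu Vv; apply: bounded_measurable_integrable.
- exact: measurable_interface_part.
- exact: bounded_interface_part.
- exact: bounded_measurable_interface.
Qed.

Lemma interface_density_ge0 K (f : facet (kind K) n) u x : 0 <= interface_density f u u x.
Proof. by rewrite mulr_ge0 ?sqrtr_ge0// -expr2 sqr_ge0. Qed.

Lemma psd_interface : psd_form Vloc (b_form Omega J).
Proof.
split=> [c u v w Vu Vv Vw|u v Vu Vv|u Vu]; rewrite !b_formE.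
- rewrite mulr_sumr -big_split/=; apply: eq_bigr => K KJ.
  rewrite mulr_sumr -big_split/=; apply: eq_bigr => f _.
  have mo := measurable_interface_part f.
  rewrite -RintegralZl//; last exact: integrable_interface.
  rewrite -RintegralD//; last 2 first.
  + apply: bounded_measurable_integrable => //; first exact: bounded_interface_part.
    apply: bounded_measurableM; first exact: bounded_measurable_cst.
    exact: bounded_measurable_interface.
  + exact: integrable_interface.
  apply: eq_Rintegral => x _; rewrite /interface_density.
  by rewrite -[(c *: u + v) _]/(c * u _ + v _); ring.
- apply: eq_bigr => K KJ; apply: eq_bigr => f _; apply: eq_Rintegral => x _.
  by rewrite /interface_density [u _ * _]mulrC.
- apply: sumr_ge0 => K KJ; apply: sumr_ge0 => f _; apply: Rintegral_ge0 => x _.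
  exact: interface_density_ge0.
Qed.

Lemma interface_form0 u v : (forall x, frontier omega x -> Omega x -> u x = 0) ->
  b_form Omega J u v = 0.
Proof.
move=> u0; rewrite b_formE big1// => K _; rewrite big1// => f _.
rewrite (@eq_Rintegral _ _ _ _ _ (fun=> 0)).
  by rewrite Rintegral_cst ?mul0r//; exact: measurable_interface_part.
by move=> x; rewrite inE => -[_ [fx Ox]]; rewrite /interface_density u0// !mul0r.
Qed.

(** If [v] were nonzero on a ball [U] around a point of the interface, then no
    facet of [J] could have a piece with nonempty relative interior in the
    frontier of [omega] inside [U], as it would contribute to [b v v]. The
    frontier would thus be too thin to separate [omega] from the rest of [U]. *)
Lemma interface_form_definite v : Vloc v -> b_form Omega J v v = 0 ->
  forall x, frontier omega x -> Omega x -> v x = 0.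
Proof.
have half (s t : R) : s - t < s / 2 -> s / 2 < t by lra.
move=> Vv bv p0 fp0 Op0; apply/eqP; apply: contraT => vp0.
have int0 K (f : facet (kind K) n) : K \in J ->
    \int[lebesgue_rV R n]_(x in interface_part f) interface_density f v v x = 0.
  move=> KJ.
  have ge0 K' (g : facet (kind K') n) : 0 <=
      \int[lebesgue_rV R n]_(x in interface_part g) interface_density g v v x.
    by apply: Rintegral_ge0 => x _; exact: interface_density_ge0.
  move/eqP: bv; rewrite b_formE psumr_eq0 => [|K' _]; last first.
    by apply: sumr_ge0 => g _; exact: ge0.
  move=> /allP/(_ K (mem_index_enum _)); rewrite KJ/= psumr_eq0 => [|g _]; last exact: ge0.
  by move=> /allP/(_ f (mem_index_enum _))/= /eqP.
have [w Vw vw] := Vh_locE Vv.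
have clp0 : closure omega p0 by case: fp0.
pose del := `|v p0| / 2; have del0 : 0 < del by rewrite divr_gt0// normr_gt0.
have /nbhs_ballP[e0 /= e00 eU] : nbhs p0 (Omega `&` [set y | del < `|w y|]).
  apply: filterI; first exact: open_nbhs_nbhs.
  have /cvgrPdist_lt/(_ del del0) := Vh_continuous_at oOmega Vw Op0.
  apply: filterS => y /=; rewrite -vw// => vwy.
  have := ler_distD (w y) (v p0) 0; rewrite !subr0.
  by move: vwy; rewrite /del; lra.
set U := ball p0 e0 in eU.
have UO y : U y -> Omega y by move=> /eU[].
have oU : open U by exact: ball_open.
(* the frontier of [omega] is covered by the sets [P i], each of which lies in the
   supporting hyperplane of a facet *)
pose I := {K : elt T & facet (kind K) n}.
have /choice[nuk nukP] : forall i : I, exists nc : E * R, [/\ nc.1 != 0,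
    forall y, element (tag i) y -> dotv nc.1 y <= nc.2
    & forall x, dotv nc.1 (F (tag i) (facet_emb (tagged i) x)) = nc.2].
  move=> [K f]; have [nu [c [h1 h2 h3]]] := facet_hyperplane (regular_vertex hT K) f.
  by exists (nu, c).
pose P (i : I) : set E := if tag i \in J then
  frontier omega `&` (cell_map (vf (tag i) (tagged i)) @` ref_cell (kind (tag i)) n) else set0.
have [|||||||||||y [z [[Uy oy] [Uz noz] seg]]] :=
  @generic_segment R n.+1 I (fun i => (nuk i).1) (fun i => (nuk i).2) P U
    (U `&` omega) (U `&` ~` closure omega).
- by move=> x y; exact: ball_convex.
- by apply: openI => //; exact: open_subdomain.
- have [y [oy Uy]] := clp0 U (nbhsx_ballx _ _ e00).
  by exists y.
- by move=> y [].
- by apply: openI => //; exact/closed_openC/closed_closure.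
- have [y [Uy _] noy] := outside_dense hT oOmega fp0 Op0 (nbhsx_ballx _ _ e00).
  by exists y.
- by move=> y [].
- by move=> i; have [] := nukP i.
- move=> i; rewrite /P; case: ifP => _; last exact: closed0.
  apply: closedI; first exact: closed_frontier.
  apply: compact_closed; first exact: norm_hausdorff.
  apply: continuous_compact; last exact: compact_ref_cell.
  exact/continuous_subspaceT/continuous_cell_map.
- move=> i y; rewrite /P; case: ifP => // _ [_ [x rx <-]].
  by have [_ _] := nukP i; rewrite /= cell_map_facet.
- move=> [K f] h Uh; rewrite /P/=; case: ifPn => // KJ [fh [x rx xh]] e epos.
  apply: contrapT => nh.
  have [_ _ hyp] := nukP (existT _ K f).
  set nu := (nuk _).1 in hyp nh; set c := (nuk _).2 in hyp nh.
  have cF := @continuous_cell_map R n.+1 (kind K) n (vf K f).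
  pose O := cell_map (vf K f) @^-1` (U `&` ball h e).
  have oO : open O.
    by apply: open_comp; [move=> ? _; exact: cF|apply: openI => //; exact: ball_open].
  have Ox : O x by rewrite /O/= xh; split => //; exact: ballxx.
  have [x1 [Ox1 ix1]] := ref_int_dense rx oO Ox.
  have front y : O y -> ref_int (kind K) n y -> frontier omega (cell_map (vf K f) y).
    move=> [Uy hy] iy; apply: contrapT => nfy; apply: nh.
    exists (cell_map (vf K f) y); split.
    + by rewrite cell_map_facet; exact: hyp.
    + by move: hy; rewrite -ball_normE/= distrC.
    + by case.
  have part y : O y -> ref_int (kind K) n y -> interface_part f y.
    move=> Oy iy; split; first exact: ref_int_sub.
    by split; [exact: front|apply: UO; case: Oy].
  pose dens := surface_density (@vertex R n T K) f.
  have dens0 : 0 < dens x1.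
    by apply: (surface_density_gt0 (regular_vertex hT K)); exact: ref_int_sub.
  have d20 : 0 < dens x1 / 2 by rewrite divr_gt0.
  pose N := ([set y | dens x1 / 2 < dens y] `&` (O `&` ref_int (kind K) n))°.
  have Nx1 : N x1.
    apply: filterI.
      have /cvgrPdist_lt/(_ _ d20) :=
        @continuous_surface_density R (kind K) n (@vertex R n T K) f x1.
      by apply: filterS => y /=; rewrite -/(dens x1) -/(dens y) ltr_norml => /andP[_]; exact: half.
    by apply: open_nbhs_nbhs; split=> //; apply: openI => //; exact: open_ref_int.
  suff : 0 < \int[lebesgue_rV R n]_(x in interface_part f) interface_density f v v x.
    by rewrite int0// ltxx.
  apply: (@Rintegral_gt0 _ _ _ _ N (del ^+ 2 * (dens x1 / 2))).
  + exact: measurable_interface_part.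
  + exact: integrable_interface.
  + by move=> y _; exact: interface_density_ge0.
  + exact: open_interior.
  + by exists x1.
  + by move=> y /interior_subset[_ [Oy iy]]; exact: part.
  + by rewrite mulr_gt0// exprn_gt0.
  + move=> y /interior_subset[/= dy [Oy iy]].
    have [[clF _] [/eU[_ /= wF] _]] := (front y Oy iy, Oy).
    apply: ler_pM; [exact: sqr_ge0|exact: ltW d20| |exact: ltW dy].
    rewrite (vw _ clF) -[leRHS]expr2 -[leRHS]real_normK ?num_real//.
    by apply: lerXn2r; rewrite ?nnegrE ?(ltW del0) ?normr_ge0// ltW.
have [||q [qs fq]] := connected_frontier (@connected_segment _ _ z y) (B := omega).
- by exists y; split=> //; exact: segmentr.
- exists z; split; first exact: segmentl.
  by move=> oz; apply: noz; exact: subset_closure.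
have [K [f [x [KJ rx qE]]]] := frontier_covered hT fq.
have : (segment z y `&` P (existT _ K f)) q.
  split=> //; rewrite /P/= KJ; split=> //.
  by exists x => //; rewrite cell_map_facet.
by rewrite seg.
Qed.

End interface_form.

(** * Finite dimension of the local spaces *)

Section local_spaces.
Variables (R : realType) (n : nat).
Local Notation E := 'rV[R]_n.+1.
Variables (Omega GammaD : set E) (T : mesh R n) (J : {set elt T}).
Hypotheses (hT : regular_partition T Omega) (subO : subdomain J `<=` Omega).
Local Notation omega := (subdomain J).
Local Notation F K := (cell_map (@vertex R n T K)).

Lemma VhD_subspace : linear_subspace (VhD Omega GammaD J).
Proof.
have [V0 VP] := @Vh_loc_subspace R n Omega T J.
split=> [|c u v [Vu u0] [Vv v0]]; first by split.
split=> [|x fx]; first exact: VP.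
by rewrite -[LHS]/(c * u x + v x) u0// v0// mulr0 addr0.
Qed.

(** A point shared by several elements is assigned to one of them, so that a
    finite element function is a combination of pulled back shape functions. *)
Lemma VhD_has_dim : exists m, has_dim (VhD Omega GammaD J) m.
Proof.
pose sel (x : E) : option (elt T) := [pick K | `[< element K x >]].
pose inv K (x : E) : E := xget 0 [set z | ref_cell (kind K) n.+1 z /\ F K z = x].
pose I : finType := {K : elt T & node (kind K) n.+1}.
pose e (i : I) : E -> R := patch (fun=> 0) (closure omega)
  (fun x => if sel x == Some (tag i) then shape_fun (tagged i) (inv (tag i) x) else 0).
apply: (@exists_basis _ _ _ #|I| (fun j => e (enum_val j))); first exact: VhD_subspace.
move=> _ [[w [wO _ wK] <-] _].
pose c K := sval (cid (wK K)).
have cE K : forall x, ref_cell (kind K) n.+1 x ->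
    w (F K x) = \sum_a c K a * shape_fun a x := svalP (cid (wK K)).
exists (fun j => c (tag (enum_val j)) (tagged (enum_val j))) => //.
rewrite fct_sumE; apply/funext => x.
transitivity (\sum_(i : I) c (tag i) (tagged i) * e i x).
  exact: (esym (@big_enum_val _ _ _ I I (fun i => c (tag i) (tagged i) * e i x))).
rewrite /e /patch; case: (boolP (x \in closure omega)) => [|_]; last first.
  by rewrite /= big1// => i _; rewrite mulr0.
rewrite /= inE => ox; rewrite -(@sig_big_dep _ _ _ _ (fun K => node (kind K) n.+1) xpredT
  (fun _ => xpredT) (fun K a => c K a * (if sel x == Some K then
    shape_fun a (inv K x) else 0)))/=.
have [K selx Kx] : exists2 K, sel x = Some K & element K x.
  have : closure Omega x by exact: (closure_subset subO).
  case: hT => _ <- _ _ [K _ Kx]; rewrite /sel; case: pickP => [K' /asboolP K'x|/(_ K)].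
    by exists K'.
  by move/asboolP: Kx => ->.
rewrite (bigD1 K)//= [X in _ + X]big1 ?addr0 => [|K' K'K]; last first.
  rewrite big1// => a _; rewrite selx (_ : (Some K == Some K') = false) ?mulr0//.
  by apply/eqP => -[KK']; rewrite KK' eqxx in K'K.
have [rx xE] : [set z | ref_cell (kind K) n.+1 z /\ F K z = x] (inv K x).
  by apply: xgetPex; move: Kx => [z rz zx]; exists z.
rewrite -[in RHS]xE cE//; apply: eq_bigr => a _.
by rewrite selx eqxx.
Qed.

End local_spaces.

Theorem lemma4p4 (R : realType) (n : nat)
  (hdim : n.+1 = 2%N \/ n.+1 = 3%N)
  (Omega GammaD GammaN : set 'rV[R]_n.+1)
  (hOmega : lipschitz_polyhedral_domain Omega)
  (hGamma : boundary_partition Omega GammaD GammaN)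
  (A : 'rV[R]_n.+1 -> 'M[R]_n.+1) (alpha beta : R)
  (hA : essentially_bounded_coefficient Omega A)
  (halphabeta : 0 < alpha < beta)
  (hell : symmetric_elliptic Omega A alpha beta)
  (T : mesh R n) (hT : regular_partition T Omega)
  (M : nat) (J Js : 'I_M -> {set elt T})
  (hJ : overlapping_decomposition Omega J)
  (hJs : forall i, oversampling Omega (J i) (Js i))
  (j : 'I_M) :
  let omega := subdomain (Js j) in
  let a := a_form T A omega in
  let b := b_form Omega (Js j) in
  let VD := VhD Omega GammaD (Js j) in
  let W := Wh Omega GammaD A (Js j) in
  let V0 := Vh0 Omega GammaD (Js j) in
  exists (N K : nat) (lambda : 'I_N -> R) (phi : 'I_N -> 'rV[R]_n.+1 -> R)
         (varphi : 'I_K -> 'rV[R]_n.+1 -> R),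
    [/\ has_dim W N,
        forall k, 0 <= lambda k,
        forall k l : 'I_N, (k <= l)%N -> lambda k <= lambda l,
        forall k, [/\ VD (phi k), phi k <> 0
            & forall v, VD v -> a (phi k) v = lambda k * b (phi k) v]
      & [/\ forall mu : R, has_dim (pencil_eigenspace Omega GammaD A (Js j) mu)
                                   #|[pred k | lambda k == mu]|,
            is_basis W phi
          & forall k l, b (phi k) (phi l) = (k == l)%:R]] /\
    [/\ has_dim V0 K,
        is_basis V0 varphi
      & forall i, infinite_eigenfunction Omega GammaD A (Js j) phi (varphi i)].
Proof.
move=> omega a b VD W V0.
have [dO bO _ _] := hOmega; have [oO cO nO] := dO.
have [_ [oo co no] [subO nsub]] := hJs j.
rewrite -/omega in oo co no subO nsub.
have lc q : closure Omega q -> locally_connected_at Omega q.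
  exact: lipschitz_locally_connected.
have sD : linear_subspace VD by exact: VhD_subspace.
have sub v : VD v -> Vh_loc Omega (Js j) v by case.
have psd_sub q : psd_form (Vh_loc Omega (Js j)) q -> psd_form VD q.
  move=> [qP qC q0]; split=> [c u v w /sub Vu /sub Vv /sub Vw|u v /sub Vu /sub Vv|u /sub Vu];
    [exact: qP|exact: qC|exact: q0].
have [alpha0 _] := andP halphabeta.
have pa : psd_form VD a.
  exact: (psd_sub _ (psd_energy hT oO subO bO hA alpha0 hell)).
have pb : psd_form VD b by exact: (psd_sub _ (psd_interface (Js j) hT oO)).
have V0P : V0 = [set v | VD v /\ b v v = 0].
  apply/seteqP; split=> [v V0v|v [Vv bv]].
    split; first by case: V0v.
    by apply: (interface_form0 oO) => x; exact: (Vh0_interface hT oO V0v).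
  apply: (interface_Vh0 hT subO lc Vv).
  exact: (interface_form_definite hT oO (sub _ Vv) bv).
have ab0 v : VD v -> b v v = 0 -> a v v = 0 -> v = 0.
  move=> Vv bv av; have V0v : V0 v by rewrite V0P.
  apply: (energy_definite hT oO subO bO hA alpha0 hell cO no _ co V0v av).
  by apply/eqP => e; apply: nsub; rewrite /omega e.
have [m mD] : exists m, has_dim VD m by exact: VhD_has_dim.
have := pencil_eigenbasis sD pa pb ab0 mD; rewrite -V0P.
move=> [N [K [lambda [phi [varphi]]]]].
move=> [[l0 lle eig [pencil basisW ortho]] [basis0 nz orth0]].
exists N, K, lambda, phi, varphi; split; split=> //.
- by exists phi.
- by exists varphi.
move=> i; have Vi : V0 (varphi i).
  have [_ ->] := basis0; exists (fun l => (l == i)%:R) => //.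
  rewrite (bigD1 i)//= eqxx scale1r big1 ?addr0// => l /negPf ->.
  by rewrite scale0r.
split=> //; first by case: Vi.
move=> v _; apply: (interface_form0 oO) => x.
exact: (Vh0_interface hT oO Vi).
Qed.
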